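(* Let $G$ be a connected cubic graph on $n$ vertices. If $n\leq 6$ then $\rho(G)=2$, and if $n>6$ then $\rho(G)\leq (n-1)/3$.
   Context: Graphs are finite and simple. A cubic graph is a $3$-regular graph. A subgraph $H$ of $G$ is induced if any two vertices of $H$ are adjacent in $H$ if and only if they are adjacent in $G$. An induced path factor (IPF) of a graph $G$ is a set of induced paths in $G$ such that every vertex of $G$ is in exactly one of the paths; paths of any length are allowed, including trivial paths consisting of a single vertex. The induced path number $\rho(G)$ is the minimum number of paths in an IPF of $G$. *)

(* Defs.v *)
From mathcomp Require Import all_boot all_order all_algebra.

Set Implicit Arguments.
Unset Strict Implicit.
Unset Printing Implicit Defensive.

Record sgraph := SGraph {
  vertex :> finType;
  adj : rel vertex;
  adj_sym : symmetric adj;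
  adj_irrefl : irreflexive adj
}.

Section Graphs.

Variable G : sgraph.
Implicit Types (u v x : G) (s : seq G) (P : {set G}) (F : {set {set G}}).

Definition cubic : Prop := forall x, #|[set y | adj x y]| = 3.

(* The graph with no vertices is not connected. *)
Definition connected_graph : Prop :=
  0 < #|G| /\ forall x y : G, connect (@adj G) x y.

(* Adjacency in the path whose vertices, in order, are those of s (intended
   for duplicate-free s and for u, v in s). *)
Definition path_adj s u v : bool :=
  (index v s == (index u s).+1) || (index u s == (index v s).+1).

Definition is_path s : bool :=
  [&& s != [::], uniq s & sorted (@adj G) s].

Definition is_induced_path s : bool :=
  is_path s && [forall u in s, forall v in s, path_adj s u v == adj u v].

(* An induced subgraph is determined by its vertex set, so induced paths are
   represented by their vertex sets; s ranges over the orderings of P. *)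
Definition induced_path P : bool :=
  [exists s : #|P|.-tuple G, (P == [set:: s]) && is_induced_path s].

Definition ipf F : bool :=
  partition F [set: G] && [forall P in F, induced_path P].

Definition has_ipf_of_size (k : nat) : bool :=
  [exists F : {set {set G}}, ipf F && (#|F| == k)].

Lemma ipf_singletons : ipf [set [set x] | x : G].
Proof.
apply/andP; split.
- apply/and3P; split.
  + apply/eqP/setP=> x; rewrite inE; apply/bigcupP.
    by exists [set x]; rewrite ?set11 // imset_f.
  + apply/trivIsetP=> _ _ /imsetP[x _ ->] /imsetP[y _ ->] nxy.
    rewrite disjoints1 inE; apply: contraNN nxy => /eqP->; exact: eqxx.
  + apply/imsetP=> -[x _ /setP /(_ x)]; by rewrite !inE eqxx.
- apply/forall_inP=> _ /imsetP[x _ ->]; apply/existsP.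
  have sz : size [:: x] == #|[set x]| by rewrite cards1.
  exists (Tuple sz) => /=; apply/andP; split.
    by apply/eqP/setP=> y; rewrite !inE.
  apply/andP; split=> //.
  apply/forall_inP=> u; rewrite inE => /eqP->.
  apply/forall_inP=> v; rewrite inE => /eqP->.
  by rewrite /path_adj /= eqxx adj_irrefl.
Qed.

Lemma ex_ipf : exists k, has_ipf_of_size k.
Proof.
by exists #|[set [set x] | x : G]|; apply/existsP; exists [set [set x] | x : G];
  rewrite ipf_singletons eqxx.
Qed.

Definition induced_path_number : nat := ex_minn ex_ipf.

End Graphs.

(* Main.v *)
Require Import Defs.
From mathcomp Require Import all_boot all_order all_algebra.
From mathcomp Require Import zify.
Set Implicit Arguments.
Unset Strict Implicit.
Unset Printing Implicit Defensive.
Import GRing.Theory.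

(** The proof takes an optimal factor: a list of induced paths covering every vertex once, with as few
    paths as possible and, among those, with the largest weight, the sum of 5 to the power of the sizes of
    the paths. Optimality is used through exchanges ([exch]): a few paths cannot be replaced by fewer ones,
    nor by equally many ones of which one is longer than all the old ones. For m paths and n vertices one
    has to show 3 m < n when n > 6, since the bound (n - 1) / 3 then follows by integrality.

    The inequality 3 m <= n is obtained by discharging. All charges are multiplied by 4: an interior vertex
    of a path starts with 4, an end with -2, and a path with one vertex with -8, so a path with k vertices
    has 4 (k - 3) and the sum over all paths is 4 (n - 3 m). Charge then moves along the edges between
    different paths ([transfer]). An end receives 4 from each neighbour in the interior of another path.
    When two ends are adjacent, the one whose path has larger rank receives a toll from the other, its
    captive; by optimality all the neighbours of a captive on other paths lie on the path of its captor
    ([captive_nb]), or it is single, and the tolls are chosen such that captives end with charge 0. An end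
    can only become negative if its path P is capped, that is, if an end q of a smaller path Q is adjacent
    to both ends of P. To repair this, interior vertices of capped paths receive 4 from adjacent interior
    vertices of uncapped paths. Exchanges that open the cycle formed by P and q show which capped paths
    exist ([caps_cases]), and in each case the sum of the charges on P is nonnegative ([balance_ge0]).

    If n = 3 m, every path has balance exactly 0. One considers a path P of largest rank. If P is uncapped,
    each of its ends has charge 0, which forces either a single adjacent to both ends of P or, at each end,
    a single and a captive ([free_end_cases]). If P is capped, the cases of [caps_cases] become very
    restricted. In each situation some exchange applies. Two arguments recur: an end of a longest path
    cannot be prolonged into another path Y, so Y is blocked by edges from both of its ends to P, and as Y
    too has balance 0 this determines Y enough to find an exchange ([longest_end_interior]); and when P and
    its cap can be recut so that an interior vertex a of P becomes an end, the path of the outer neighbour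
    of a provides a path to be attached there ([extend], [reroute_any]). The exchanges fail only for graphs
    that consist of the four or six vertices of P and its cap.

    For n <= 6 a cubic graph has at least four vertices. One induced path never suffices, because its first
    vertex has at most one neighbour on it; two suffice by 3 m <= n, or, for n = 4, because the graph is
    complete. *)

(** * Induced paths as lists, and optimal factors *)

Section Chains.
Variable G : sgraph.
Implicit Types (x y u v : G) (s t : seq G).

(** On a duplicate-free list this says that the list enumerates an induced path in order. Uniqueness is
    kept apart because it is shared by all the paths of a factor. *)
Fixpoint chordless s : bool :=
  if s is x :: s' then
    (if s' is y :: t then adj x y && all (fun z => ~~ adj x z) t else true) && chordless s'
  else true.

Definition joined s t : Prop :=
  forall x y, x \in s -> y \in t -> adj x y = (x == last x s) && (y == head y t).

Lemma chordless_cat s t : uniq (s ++ t) -> chordless s -> chordless t -> joined s t ->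
  chordless (s ++ t).
Proof.
elim: s => [|x s IH] //= /andP[xn un] /andP[hx cs] ct J.
have cst : chordless (s ++ t).
  apply: IH => // u v us vt; have := J u v.
  rewrite inE us orbT => /(_ isT vt) ->.
  by case: (s) us => // a s1 us /=.
rewrite cst andbT.
case: s xn un hx cs J {IH cst} => [|y s] /= xn un hx cs J.
  case: t xn un ct J => // y t /= xn /andP[yt _] _ J.
  rewrite (J x y) ?inE ?eqxx //=; apply/allP => z zt.
  rewrite (J x z) ?inE ?eqxx ?zt ?orbT //=; apply: contraNN yt => /eqP <-//.
case/andP: hx => -> hx; rewrite all_cat hx /=; apply/allP => z zt.
rewrite (J x z) ?inE ?eqxx //=; apply/negP => /andP[/eqP e _].
have := mem_last y s; rewrite -e => xys.
by move: xn; rewrite -cat_cons mem_cat xys.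
Qed.

Lemma chordless_catl s t : chordless (s ++ t) -> chordless s.
Proof.
elim: s => //= x s IH /andP[h /IH ->]; rewrite andbT.
case: s h {IH} => //= y s /andP[->]; by rewrite all_cat => /andP[->].
Qed.

Lemma chordless_catr s t : chordless (s ++ t) -> chordless t.
Proof. by elim: s => //= x s IH /andP[_ /IH]. Qed.

Lemma chordless_joined s t : uniq (s ++ t) -> chordless (s ++ t) -> joined s t.
Proof.
elim: s => [|a s IH] //= /andP[an un] /andP[h c] x y.
rewrite inE => /orP[/eqP->|xs] yt; last first.
  by rewrite (IH un c x y xs yt); case: (s) xs.
case: s an un h {IH c} => [|b s] /= an un h.
  rewrite eqxx /=; case: t an un h yt => // b t /= an /andP[bt _] /andP[ab h].
  rewrite inE => /orP[/eqP->|yt]; first by rewrite ab eqxx.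
  rewrite (negbTE (allP h y yt)); apply/esym/negbTE; apply: contraNN bt.
  by move/eqP <-.
case/andP: h => _; rewrite all_cat => /andP[_ h].
rewrite (negbTE (allP h y yt)).
have : last b s \in b :: s by rewrite mem_last.
case: (a =P last b s) => //= e; rewrite -e.
by move: an; rewrite -cat_cons mem_cat negb_or => /andP[/negPf ->].
Qed.

Lemma chordless_rev s : uniq s -> chordless s -> chordless (rev s).
Proof.
elim: s => [|x s IH] //= /andP[xs us] /[dup] c /andP[h cs].
rewrite rev_cons -cats1; apply: chordless_cat => //; last 2 first.
- exact: IH.
- move=> u v us'; rewrite inE => /eqP->{v} /=; rewrite eqxx andbT.
  move: us'; rewrite mem_rev; case: s xs us h cs {IH c} => // y s xs us h cs.
  rewrite rev_cons last_rcons inE adj_sym; case/andP: h => xy /allP h.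
  case: eqP => [->|ne] /=; first by rewrite xy.
  by move/h/negPf->.
- by rewrite cats1 -rev_cons rev_uniq /= xs.
Qed.

(** Base 5 makes one path outweigh any four shorter ones; no exchange below involves more than four. *)
Definition weight (A : seq (seq G)) : nat := \sum_(s <- A) 5 ^ size s.

Record factor (F : seq (seq G)) : Prop := Factor {
  fac_ne : [::] \notin F;
  fac_chordless : all chordless F;
  fac_un : uniq (flatten F);
  fac_full : forall x, x \in flatten F }.

Definition better (B A : seq (seq G)) : bool :=
  (size B < size A) || (size B == size A) && (weight A < weight B).

Definition optimal F := factor F /\ forall F', factor F' -> ~~ better F' F.

Lemma weight_cat A B : weight (A ++ B) = weight A + weight B.
Proof. by rewrite /weight big_cat. Qed.

Lemma weight_cons s A : weight (s :: A) = 5 ^ size s + weight A.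
Proof. by rewrite /weight big_cons. Qed.

Lemma weight_perm A B : perm_eq A B -> weight A = weight B.
Proof. by move=> h; rewrite /weight (perm_big _ h). Qed.

Lemma uniq_flatten (A : seq (seq G)) : [::] \notin A -> uniq (flatten A) -> uniq A.
Proof.
elim: A => //= s A IH; rewrite inE negb_or => /andP[sn nA].
rewrite cat_uniq => /and3P[_ h u]; rewrite IH // andbT.
apply: contraNN h => sA; case: s sn sA => // x s _ sA.
by apply/hasP; exists x; rewrite ?inE ?eqxx //; apply/flattenP; exists (x :: s); rewrite ?inE ?eqxx.
Qed.

Lemma flatten_inj (A : seq (seq G)) s t x : uniq (flatten A) -> s \in A -> t \in A ->
  x \in s -> x \in t -> s = t.
Proof.
elim: A => //= r A IH; rewrite cat_uniq => /and3P[_ h u].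
rewrite !inE => /orP[/eqP->|sA] /orP[/eqP->|tA] xs xt //; last exact: IH.
- by case/hasP: h; exists x => //; apply/flattenP; exists t.
- by case/hasP: h; exists x => //; apply/flattenP; exists s.
Qed.

Lemma joinedI u v s t : last u s = u -> head v t = v -> adj u v ->
  (forall x y, x \in s -> y \in t -> adj x y -> x = u /\ y = v) -> joined s t.
Proof.
move=> lu hv uv h x y xs yt.
have -> : last x s = u by case: (s) xs lu.
have -> : head y t = v by case: (t) yt hv.
apply/idP/andP => [/(h _ _ xs yt)[-> ->]|[/eqP-> /eqP->]] //; by rewrite !eqxx.
Qed.

Definition segments (ss : seq (G + seq G)) : seq G :=
  flatten [seq match i with inl p => [:: p] | inr A => A end | i <- ss].

(** The entries of [ss], single vertices or whole segments, receive consecutive colours. *)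
Fixpoint color_spec (c : G -> nat) i (ss : seq (G + seq G)) : Prop :=
  if ss is a :: ss' then
    (match a with inl p => c p = i | inr A => forall x, x \in A -> c x = i end)
      /\ color_spec c i.+1 ss'
  else True.

(** Once the segments of a duplicate-free list have distinct colours, a vertex that would lie in two of
    them is refuted by comparing two numbers, whatever the order of the segments. *)
Lemma coloring (ss : seq (G + seq G)) N : uniq N -> perm_eq (segments ss) N ->
  exists c, color_spec c 0 ss.
Proof.
move=> uN pN; have : uniq (segments ss) by rewrite (perm_uniq pN).
move: 0 {uN pN}; elim: ss => [|a ss IH] i; first by exists (fun=> 0).
rewrite /segments /= -/(segments ss) cat_uniq => /and3P[_ h /(IH i.+1)[c Hc]].
pose B := match a with inl p => [:: p] | inr A => A end.
exists (fun x => if x \in B then i else c x); split.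
  by rewrite /B; case: (a) => [p|A] /=; rewrite ?inE ?eqxx // => x ->.
have {h} : all (fun x => x \notin B) (segments ss) by rewrite all_predC.
move: (i.+1) Hc; elim: ss {IH} => //= b ss IH j [hb /IH{}IH].
rewrite /segments /= all_cat => /andP[h /IH {}IH]; split => //.
case: b hb h => [p|A] /= hb h; first by move: h; rewrite andbT => /negPf ->.
by move=> x xA; rewrite (negPf (allP h x xA)) hb.
Qed.

Lemma better_max (A B : seq (seq G)) b : size B = size A -> size A <= 4 -> b \in B ->
  all (fun a => size a < size b) A -> better B A.
Proof.
move=> sB sA bB hA; rewrite /better sB ltnn eqxx /=.
have h1 : 5 ^ size b <= weight B by rewrite /weight (big_rem _ bB) /= leq_addr.
apply: leq_trans h1.
have h2 : weight A <= size A * 5 ^ (size b).-1.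
  rewrite /weight.
  elim: (A) hA => [|a C IH] /= h; rewrite ?big_nil //.
  case/andP: h => ha /IH h; rewrite big_cons mulSn leq_add //.
  by rewrite leq_exp2l // -ltnS (leq_trans ha) // leqSpred.
case: A hA {sB sA} h2 (sA) => [|a A] /= hA h2 sA; first by rewrite /weight big_nil expn_gt0.
case/andP: hA => ha _; have e : size b = (size b).-1.+1 by rewrite prednK // (leq_ltn_trans _ ha).
rewrite e expnS; have : 0 < 5 ^ (size b).-1 by rewrite expn_gt0.
by move=> e0; apply: (leq_ltn_trans h2); rewrite ltn_pmul2r.
Qed.

End Chains.

(** * Tactics for cutting and joining segments *)

(* Equality of multisets of two concatenations of the same segments, some of them reversed. *)
Ltac perm_segments :=
  let pp := fresh "pp" in
  apply/permP => pp; rewrite /segments /= ?cats0; do 5 (rewrite ?(count_cat, count_rev) /=);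
  repeat match goal with |- context [nat_of_bool ?b] => generalize (nat_of_bool b); intro end;
  repeat match goal with |- context [@count ?T ?a ?b] => generalize (@count T a b); intro end;
  clear; lia.

Ltac color_segments ss U :=
  let c := fresh "c" in let Hc := fresh "Hc" in
  have [c Hc] := @coloring _ ss _ U ltac:(perm_segments);
  cbn [color_spec] in Hc;
  repeat match goal with H : _ /\ _ |- _ => destruct H end.

Ltac color_clash :=
  exfalso;
  repeat match goal with
  | H : is_true (?x \in ?A), C : (forall z, is_true (z \in ?A) -> _ = _) |- _ =>
      generalize (C x H); clear H; intro
  end; congruence.

Ltac split_mem H :=
  rewrite ?(mem_cat, mem_rev, inE) in H;
  repeat match type of H with
  | is_true (_ || _) => case/orP: H => H
  | is_true (_ == _) => move/eqP: H => H
  end.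

(* Membership in a concatenation is split along the segments, and [k] is run in each case. *)
Ltac split_mem_then H k :=
  rewrite ?(mem_cat, mem_rev, inE) in H;
  let rec go := 
  lazymatch type of H with
  | is_true (_ || _) => case/orP: H => H; go
  | is_true (_ == _) => move/eqP: H => H; k
  | _ => k
  end in go.

Ltac subst_eq x := try match goal with E : x = _ |- _ => subst x end.

Ltac mem_side := solve [ assumption
  | rewrite ?(mem_cat, mem_rev, inE) ?eqxx ?orbT //=;
    repeat match goal with K : is_true (_ \in _) |- _ => rewrite K ?orbT //= end ].

(* An edge between two given segments is either the announced one, or it contradicts a known list of
   three neighbours, a hypothesis that forbids edges, or the colours of its ends. *)
Ltac edge h :=
  first
  [ solve [auto]
  | solve [split; congruence]
  | solve [color_clash]
  | match type of h with is_true (adj ?x ?y) =>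
     match goal with
     | N : (forall z, is_true (adj x z) -> _) |- _ =>
         let e := fresh "e" in (destruct (N _ h) as [e|[e|e]]; solve [split; congruence | color_clash])
     | N : (forall z, is_true (adj y z) -> _) |- _ =>
         let h' := fresh in have h' := h; rewrite adj_sym in h';
         let e := fresh "e" in (destruct (N _ h') as [e|[e|e]]; solve [split; congruence | color_clash])
     | X : (forall a, is_true (a \in _) -> is_true (adj a _) -> _) |- _ =>
         let e := fresh "e" in
         first [ have e := X x ltac:(mem_side) h
               | have e := X y ltac:(mem_side) ltac:(rewrite adj_sym; exact h) ];
         first [ solve [case: e] | solve [split; congruence | color_clash] ]
     | X : (forall a b, is_true (a \in _) -> is_true (b \in _) -> is_true (adj a b) -> _) |- _ =>
         let e := fresh "e" in
         first [ have e := X x y ltac:(mem_side) ltac:(mem_side) h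
               | have e := X y x ltac:(mem_side) ltac:(mem_side) ltac:(rewrite adj_sym; exact h) ];
         first [ solve [case: e] | solve [destruct e as [? ?]; first [split; congruence| color_clash]] ]
     end end ].

(* The goal states that u v is the only edge between two concatenations of segments. *)
Ltac edges :=
  let x := fresh "x" in let y := fresh "y" in
  let hx := fresh "hx" in let hy := fresh "hy" in let h := fresh "h" in
  move=> x y hx hy h;
  split_mem_then hx ltac:(split_mem_then hy ltac:(subst_eq x; subst_eq y; edge h)).

Ltac joint u v :=
  apply: (@joinedI _ u v);
  [ by rewrite /= ?(rev_cons, last_rcons, last_cat, rev_cat) /= ?(last_rcons, last_cat, last_rcons) /= ?rev_cons ?last_rcons
  | by rewrite /= ?(rev_cons, rev_cat) /=
  | by first [ assumption | rewrite adj_sym; assumption ]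
  | edges ].

Ltac new_paths :=
  let b := fresh "b" in let u := fresh "u" in let H := fresh "H" in
  move=> b; rewrite !inE; move=> H;
  repeat (case/orP: H => H); move/eqP: H => ->; clear b; move=> u.

Ltac old_paths := rewrite /=; repeat (apply/andP; split); done.
Ltac old_uniq U := by move: U; rewrite /= ?cats0.

Ltac sizes := do 4 (rewrite /= ?(size_cat, size_rev)); rewrite /=; repeat (apply/andP; split) => //;
  repeat match goal with H : is_true ?f |- _ => lazymatch f with leq _ _ => do 4 (rewrite /= ?(size_cat, size_rev) in H); rewrite /= in H; revert H | _ => clear H end end;
  clear; move=> *; lia.

(** * Exchanges in an optimal factor *)

Section Optimal.
Variable G : sgraph.
Hypothesis cubG : cubic G.
Hypothesis conG : connected_graph G.
Variable F : seq (seq G).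
Hypothesis optF : optimal F.

Let facF : factor F := optF.1.

Section Members.
Implicit Types (x y u v : G) (s t : seq G).

(** The paths of the factor, read in either direction, so that an exchange can choose the direction. *)
Definition member s : bool := (s \in F) || (rev s \in F).

Lemma member_rev s : member (rev s) = member s.
Proof. by rewrite /member revK orbC. Qed.

Lemma member_ne s : member s -> s != [::].
Proof.
by case/orP => h; apply: contraTneq h => -> //; rewrite ?rev_nil (negbTE (fac_ne facF)).
Qed.

Lemma uniq_in_F s : s \in F -> uniq s.
Proof.
have := fac_un facF; elim: (F) => //= r A IH; rewrite cat_uniq => /and3P[ur _ u].
by rewrite inE => /orP[/eqP->|/(IH u)].
Qed.

Lemma member_uniq s : member s -> uniq s.
Proof. by case/orP => /uniq_in_F; rewrite ?rev_uniq. Qed.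

Lemma member_chordless s : member s -> chordless s.
Proof.
move=> Ms; have us := member_uniq Ms; case/orP: Ms => /(allP (fac_chordless facF)) //.
by move/(chordless_rev (s := rev s)); rewrite revK rev_uniq => ->.
Qed.

Lemma member_inj s t x : member s -> member t -> x \in s -> x \in t -> s = t \/ s = rev t.
Proof.
move=> /orP[] a /orP[] b xs xt.
- by left; apply: (flatten_inj (fac_un facF) a b xs xt).
- by right; apply: (flatten_inj (fac_un facF) a b xs); rewrite mem_rev.
- by right; rewrite -[LHS]revK; congr rev; apply: (flatten_inj (x := x) (fac_un facF) a b); rewrite ?mem_rev.
- by left; rewrite -[LHS]revK -[RHS]revK; congr rev; apply: (flatten_inj (x := x) (fac_un facF) a b); rewrite ?mem_rev.
Qed.

Lemma perm_flatten_map (f : seq G -> seq G) A : (forall a, perm_eq (f a) a) ->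
  perm_eq (flatten (map f A)) (flatten A).
Proof. by move=> h; elim: A => //= a A IH; apply: perm_cat. Qed.

Lemma perm_flatten_perm (A B : seq (seq G)) : perm_eq A B -> perm_eq (flatten A) (flatten B).
Proof.
move=> h; apply/permP => p; rewrite !count_flatten.
by apply: perm_sumn; apply: perm_map.
Qed.

(** Putting B in place of A in F gives again a factor, since both cover the same vertices, and a better
    one. All exchanges below are instances. *)
Lemma exch A B : all member A -> uniq (flatten A) -> perm_eq (flatten B) (flatten A) ->
  (forall b, b \in B -> uniq b -> chordless b) -> better B A -> False.
Proof.
move=> MA uA pAB chB bet.
pose inA s := (s \in A) || (rev s \in A).
(* [can] turns the members listed in A into the direction in which they occur in F. *)
pose can s := if s \in F then s else rev s.
have canF s : member s -> can s \in F by rewrite /member /can; case: ifP.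
have canp s : perm_eq (can s) s by rewrite /can; case: ifP => // _; rewrite perm_rev.
have pcan : perm_eq (flatten (map can A)) (flatten A) by apply: perm_flatten_map.
have ucan : uniq (map can A).
  apply: uniq_flatten; last by rewrite (perm_uniq pcan).
  apply/mapP => -[a aA e]; have := member_ne (allP MA a aA).
  by rewrite -size_eq0 -(perm_size (canp a)) -e.
have uF : uniq F by apply: uniq_flatten (fac_ne facF) (fac_un facF).
have pA : perm_eq (map can A) (filter inA F).
  apply: uniq_perm; rewrite ?filter_uniq // => s; rewrite mem_filter.
  apply/mapP/andP => [[a aA ->]|[/orP sA sF]].
    by rewrite canF ?(allP MA) // /inA /can; case: ifP; rewrite ?revK aA ?orbT.
  case: sA => sA; first by exists s; rewrite // /can sF.
  exists (rev s) => //; rewrite /can revK; case: ifP => // rF.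
  case: s sF sA rF => // x s sF sA rF.
  by apply: (flatten_inj (x := x) (fac_un facF)); rewrite ?mem_rev ?inE ?eqxx.
pose R := filter (predC inA) F.
have pF : perm_eq (map can A ++ R) F.
  by rewrite (perm_trans _ (permEl (perm_filterC inA F))) // perm_cat.
(* A segment left over by an exchange may be empty. *)
pose B' := filter (predC1 [::]) B.
have fB' : flatten B' = flatten B.
  by rewrite /B'; elim: (B) => //= -[|x b] C IH //=; rewrite IH.
have pFF : perm_eq (flatten (B' ++ R)) (flatten F).
  rewrite flatten_cat fB' (perm_trans _ (perm_flatten_perm pF)) // flatten_cat.
  by rewrite perm_cat // (perm_trans pAB) // perm_sym.
have facF' : factor (B' ++ R).
  split.
  - by rewrite mem_cat !mem_filter /= (negbTE (fac_ne facF)) andbF.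
  - rewrite all_cat; apply/andP; split.
      apply/allP => b; rewrite mem_filter => /andP[_ bB]; apply: chB => //.
      have : uniq (flatten B) by rewrite (perm_uniq pAB).
      elim: (B) bB => //= r C IH; rewrite inE cat_uniq => /orP[/eqP->|bC] /and3P[] //.
      by move=> _ _; apply: IH.
    by apply/allP => b; rewrite mem_filter => /andP[_]; apply: (allP (fac_chordless facF)).
  - by rewrite (perm_uniq pFF) (fac_un facF).
  - by move=> x; rewrite (perm_mem pFF) (fac_full facF).
have sB' : size B' <= size B by rewrite size_filter count_size.
have := optF.2 _ facF'; apply/negP; rewrite negbK.
have sF : size F = size A + size R by rewrite -(perm_size pF) size_cat size_map.
have wF : weight F = weight A + weight R.
  rewrite -(weight_perm pF) weight_cat /weight big_map; congr addn.
  by apply: eq_bigr => a _; rewrite (perm_size (canp a)).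
rewrite /better size_cat weight_cat sF wF ltn_add2r eqn_add2r ltn_add2r.
case/orP: bet => [h|/andP[/eqP e h]]; first by rewrite (leq_ltn_trans sB' h).
move: sB'; rewrite leq_eqVlt e => /orP[e'|-> //].
rewrite e' orbC; suff -> : B' = B by rewrite h.
by apply/all_filterP; rewrite all_count -size_filter -/B' e eq_sym eq_sym.
Qed.

Lemma exch_lt A B : all member A -> uniq (flatten A) -> perm_eq (flatten B) (flatten A) ->
  (forall b, b \in B -> uniq b -> chordless b) -> size B < size A -> False.
Proof.
by move=> h1 h2 h3 h4 h5; apply: (exch h1 h2 h3 h4); rewrite /better h5.
Qed.

Lemma exch_max b A B : all member A -> uniq (flatten A) -> perm_eq (flatten B) (flatten A) ->
  (forall b, b \in B -> uniq b -> chordless b) -> b \in B -> size B = size A -> size A <= 4 ->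
  all (fun a => size a < size b) A -> False.
Proof.
move=> h1 h2 h3 h4 h5 h6 h7 h8; apply: (exch h1 h2 h3 h4).
exact: (better_max h6 h7 h5 h8).
Qed.

End Members.

Lemma chordless_cat_seg (s t : seq G) : uniq (s ++ t) -> (uniq s -> chordless s) -> (uniq t ->
  chordless t) -> joined s t -> chordless (s ++ t).
Proof.
move=> u hs ht; move: (u); rewrite cat_uniq => /and3P[us _ ut].
by apply: chordless_cat => //; [apply: hs| apply: ht].
Qed.

Lemma chordless_rev_seg (s : seq G) : chordless s -> uniq (rev s) -> chordless (rev s).
Proof. by rewrite rev_uniq => c u; apply: chordless_rev. Qed.

(** Otherwise the two paths could be concatenated through p q. *)
Lemma merge_ends p A q B : member (p :: A) -> member (q :: B) -> uniq ((p :: A) ++ (q :: B)) ->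
  adj p q ->
  (forall x y, x \in p :: A -> y \in q :: B -> adj x y -> x = p /\ y = q) -> False.
Proof.
move=> MP MQ U pq H; have cP := member_chordless MP; have cQ := member_chordless MQ.
apply: (@exch_lt [:: p :: A; q :: B] [:: rev (p :: A) ++ q :: B]) => //.
- by rewrite /= MP MQ.
- by move: U; rewrite /= cats0.
- perm_segments.
- move=> b; rewrite inE => /eqP-> u.
  apply: chordless_cat_seg => //; first exact: chordless_rev_seg.
  apply: (@joinedI _ p q) => //; first by rewrite rev_cons last_rcons.
  by move=> x y; rewrite mem_rev; apply: H.
Qed.

(** Otherwise q could be moved in front of p, giving a path longer than both. *)
Lemma absorb_end p A q B : member (p :: A) -> member (q :: B) -> uniq ((p :: A) ++ (q :: B)) ->
  adj p q ->
  size B <= size A ->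
  (forall x, x \in p :: A -> adj x q -> x = p) -> False.
Proof.
move=> MP MQ U pq sz H; have cP := member_chordless MP; have cQ := member_chordless MQ.
apply: (@exch_max (q :: p :: A) [:: p :: A; q :: B] [:: q :: p :: A; B]) => //.
- by rewrite /= MP MQ.
- by move: U; rewrite /= cats0.
- perm_segments.
- move=> b; rewrite !inE => /orP[] /eqP-> u; last exact: (@chordless_catr _ [:: q]).
  apply: (@chordless_cat_seg [:: q]) => //.
  apply: (@joinedI _ q p) => //; first by rewrite adj_sym.
  move=> x y; rewrite inE => /eqP-> yA h; split => //.
  by apply: H => //; rewrite adj_sym.
- by rewrite !inE eqxx.
- by rewrite /= andbT; apply/andP; split; move: sz; clear => /=; lia.
Qed.

(** Otherwise X, p, Z would form one induced path and the rest of the path of p another. *)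
Lemma join_three p A x X z Z : member (p :: A) -> member (x :: X) -> member (z :: Z) ->
  uniq ((p :: A) ++ (x :: X) ++ (z :: Z)) -> A != [::] -> adj p x -> adj p z ->
  (forall y, adj p y -> y = head p A \/ y = x \/ y = z) ->
  (forall a b, a \in x :: X -> b \in z :: Z -> adj a b -> False) -> False.
Proof.
move=> MP MX MZ U; case: A MP U => [|a A] MP U nA px pz Np H; first by [].
have cP := member_chordless MP; have cX := member_chordless MX; have cZ := member_chordless MZ.
rewrite /= in Np.
color_segments [:: inl p; inl a; inr A; inl x; inr X; inl z; inr Z] U.
apply: (@exch_lt [:: p :: a :: A; x :: X; z :: Z] [:: rev (x :: X) ++ p :: z :: Z; a :: A]) => //.
- by rewrite /= MP MX MZ.
- by move: U; rewrite /= cats0.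
- perm_segments.
- move=> b; rewrite !inE => /orP[] /eqP-> u; last exact: (@chordless_catr _ [:: p]).
  apply: chordless_cat_seg => // [|u'|]; first exact: chordless_rev_seg.
    apply: (@chordless_cat_seg [:: p]) => //; joint p z.
  joint x p.
Qed.

(** The single v is appended after p' while p leaves its path to start Z: two paths instead of three. *)
Lemma drop_end v p A p' z Z a : member [:: v] -> member (p :: A ++ [:: p']) -> member (z :: Z) ->
  uniq ([:: v] ++ (p :: A ++ [:: p']) ++ (z :: Z)) ->
  adj v p' -> adj p z ->
  (forall y, adj p y -> y = a \/ y = v \/ y = z) -> a \in A ++ [:: p'] ->
  (forall x, x \in A -> adj x v -> False) -> False.
Proof.
move=> MV MP MZ U vp' pz Np aA Hv.
have cP := member_chordless MP; have cZ := member_chordless MZ.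
have ca : uniq (p :: A ++ [:: p']) by exact: (member_uniq MP).
color_segments [:: inl v; inl p; inr A; inl p'; inl z; inr Z] U.
split_mem aA;
apply: (@exch_lt [:: [:: v]; p :: A ++ [:: p']; z :: Z] [:: (A ++ [:: p']) ++ [:: v]; p :: z :: Z]) => //;
first [old_paths | old_uniq U | perm_segments | new_paths].
1,3: apply: chordless_cat_seg => // [_|]; [exact: (@chordless_catr _ [:: p]) | joint p' v].
1,2: apply: (@chordless_cat_seg [:: p]) => //; joint p z.
Qed.

(** P and q form a cycle. It is opened at p: the path P without p is continued by q, p is put in front
    of Z, and B remains. The size of P is recovered, and since Z was not shorter than q :: B, its growth
    outweighs the loss of q. *)
Lemma open_cycle_long p A p' q B z Z a b :
  member (p :: A ++ [:: p']) -> member (q :: B) -> member (z :: Z) ->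
  uniq ((p :: A ++ [:: p']) ++ (q :: B) ++ (z :: Z)) ->
  adj p' q -> adj p z ->
  (forall y, adj p y -> y = a \/ y = q \/ y = z) -> a \in A ++ [:: p'] ->
  (forall y, adj q y -> y = b \/ y = p \/ y = p') -> b \in B ->
  size (q :: B) <= size (z :: Z) -> False.
Proof.
move=> MP MQ MZ U p'q pz Np aA Nq bB sz.
have cP := member_chordless MP; have cQ := member_chordless MQ; have cZ := member_chordless MZ.
color_segments [:: inl p; inr A; inl p'; inl q; inr B; inl z; inr Z] U.
apply: (@exch [:: p :: A ++ [:: p']; q :: B; z :: Z] [:: (A ++ [:: p']) ++ [:: q]; p :: z :: Z; B]);
  [old_paths | old_uniq U | perm_segments | new_paths | ].
- apply: chordless_cat_seg => // [_|]; first exact: (@chordless_catr _ [:: p]).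
  joint p' q.
- split_mem aA; apply: (@chordless_cat_seg [:: p]) => //; joint p z.
- exact: (@chordless_catr _ [:: q]).
- apply/orP; right; apply/andP; split => //.
  rewrite !weight_cons /weight big_nil !addn0 /= !size_cat /= !addn1.
  rewrite -(leq_exp2l (m := 5)) //= in sz.
  have : 0 < 5 ^ (size Z) by rewrite expn_gt0.
  have : 0 < 5 ^ (size B) by rewrite expn_gt0.
  move: sz; rewrite !expnS; clear; lia.
Qed.

(** The same opening of the cycle, where q takes its neighbour q2 along: the new path is longer than
    all three old ones. *)
Lemma open_cycle_two p A p' q q2 B z Z a :
  member (p :: A ++ [:: p']) -> member (q :: q2 :: B) -> member (z :: Z) ->
  uniq ((p :: A ++ [:: p']) ++ (q :: q2 :: B) ++ (z :: Z)) ->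
  adj p' q -> adj p z ->
  (forall y, adj p y -> y = a \/ y = q \/ y = z) -> a \in A ++ [:: p'] ->
  (forall y, adj q y -> y = q2 \/ y = p \/ y = p') ->
  size (q :: q2 :: B) <= size A + 2 -> size (z :: Z) <= size A + 2 ->
  (forall x, x \in A ++ [:: p'] -> adj x q2 -> False) -> False.
Proof.
move=> MP MQ MZ U p'q pz Np aA Nq sq sz H.
have cP := member_chordless MP; have cQ := member_chordless MQ; have cZ := member_chordless MZ.
have Hp' : adj p' q2 -> False by apply: H; rewrite mem_cat inE eqxx orbT.
color_segments [:: inl p; inr A; inl p'; inl q; inl q2; inr B; inl z; inr Z] U.
apply: (@exch_max ((A ++ [:: p']) ++ [:: q; q2])
  [:: p :: A ++ [:: p']; q :: q2 :: B; z :: Z] [:: (A ++ [:: p']) ++ [:: q; q2]; p :: z :: Z; B]);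
  [old_paths | old_uniq U | perm_segments | new_paths | by rewrite inE eqxx | by [] | by [] | ].
- apply: chordless_cat_seg => // [_|_|]; first exact: (@chordless_catr _ [:: p]).
    exact: (@chordless_catl _ _ B).
  joint p' q.
- split_mem aA; apply: (@chordless_cat_seg [:: p]) => //; joint p z.
- exact: (@chordless_catr _ [:: q; q2]).
- by rewrite /= !size_cat /=; repeat (apply/andP; split) => //; move: sq sz; clear => /=; lia.
Qed.

(** When p' is adjacent to q2 too, the path P without p can be continued by q2 :: B; the vertices p and
    q are hung on Z, and q' stays alone. The first of these paths is longer than the old ones. *)
Lemma tri_long p A p' q q2 B q' z Z a :
  member (p :: A ++ [:: p']) -> member (q :: q2 :: B ++ [:: q']) -> member (z :: Z) ->
  uniq ((p :: A ++ [:: p']) ++ (q :: q2 :: B ++ [:: q']) ++ (z :: Z)) ->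
  B != [::] -> adj p' q2 -> adj p q -> adj p z ->
  (forall y, adj p y -> y = a \/ y = q \/ y = z) -> a \in A ++ [:: p'] ->
  (forall y, adj q y -> y = q2 \/ y = p \/ y = p') ->
  (forall y, adj p' y -> y = q2 \/ y = q \/ y \in p :: A) ->
  (forall x y, x \in A -> y \in q2 :: B -> adj x y -> False) ->
  size (q :: q2 :: B ++ [:: q']) <= size A + 2 -> size (z :: Z) <= size A + 2 -> False.
Proof.
move=> MP MQ MZ U nB p'q2 pq pz Np aA Nq Np' H sq sz.
have cP := member_chordless MP; have cQ := member_chordless MQ; have cZ := member_chordless MZ.
have B0 : 0 < size B by case: (B) nB.
color_segments [:: inl p; inr A; inl p'; inl q; inl q2; inr B; inl q'; inl z; inr Z] U.
apply: (@exch_max ((A ++ [:: p']) ++ q2 :: B)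
  [:: p :: A ++ [:: p']; q :: q2 :: B ++ [:: q']; z :: Z]
  [:: (A ++ [:: p']) ++ q2 :: B; rev (z :: Z) ++ [:: p; q]; [:: q']]);
  [old_paths | old_uniq U | perm_segments | new_paths | by rewrite inE eqxx | by [] | by [] | ].
- apply: chordless_cat_seg => // [_|_|]; first exact: (@chordless_catr _ [:: p]).
    exact: (@chordless_catl _ (q2 :: B) [:: q'] (@chordless_catr _ [:: q] _ cQ)).
  apply: (@joinedI _ p' q2) => //; first by rewrite last_cat.
  move=> x y xA yB h; have [xA'|/eqP e] : x \in A \/ x == p'.
    by move: xA; rewrite mem_cat inE => /orP.
    by case: (H x y).
  subst x; split => //; case: (Np' _ h) => [//|[e|e]]; first by split_mem yB; color_clash.
  by exfalso; split_mem e; split_mem yB; color_clash.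
- split_mem aA; (apply: chordless_cat_seg => // [|_|]; [exact: chordless_rev_seg|by rewrite /= pq|joint z p]).
- by [].
- sizes.
Qed.

(** The analogue of [tri_long] for B empty. The path obtained from P keeps its size; the weight grows
    because Z, which has at least two vertices, gains two more. *)
Lemma tri_short p A p' q q2 q3 z z2 Z a :
  member (p :: A ++ [:: p']) -> member [:: q; q2; q3] -> member (z :: z2 :: Z) ->
  uniq ((p :: A ++ [:: p']) ++ [:: q; q2; q3] ++ (z :: z2 :: Z)) ->
  adj p' q2 -> adj p q -> adj p z ->
  (forall y, adj p y -> y = a \/ y = q \/ y = z) -> a \in A ++ [:: p'] ->
  (forall y, adj q y -> y = q2 \/ y = p \/ y = p') ->
  (forall x, x \in A -> adj x q2 -> False) -> False.
Proof.
move=> MP MQ MZ U p'q2 pq pz Np aA Nq H.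
have cP := member_chordless MP; have cQ := member_chordless MQ; have cZ := member_chordless MZ.
color_segments [:: inl p; inr A; inl p'; inl q; inl q2; inl q3; inl z; inl z2; inr Z] U.
apply: (@exch
  [:: p :: A ++ [:: p']; [:: q; q2; q3]; z :: z2 :: Z]
  [:: (A ++ [:: p']) ++ [:: q2]; rev (z :: z2 :: Z) ++ [:: p; q]; [:: q3]]);
  [old_paths | old_uniq U | perm_segments | new_paths | ].
- apply: chordless_cat_seg => // [_|]; first exact: (@chordless_catr _ [:: p]).
  joint p' q2.
- split_mem aA; (apply: chordless_cat_seg => // [|_|]; [exact: chordless_rev_seg|by rewrite /= pq|joint z p]).
- by [].
- apply/orP; right; apply/andP; split => //.
  rewrite !weight_cons /weight big_nil !addn0 /= !size_cat /= size_rev /= !addn1 !addn2.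
  have : 0 < 5 ^ (size Z) by rewrite expn_gt0.
  rewrite !expnS expn0; clear; lia.
Qed.

(** Removing p and q' from the cycle formed by P and Q leaves a path longer than both; p q' is the
    other new path. *)
Lemma cross p A p' q B q' :
  member (p :: A ++ [:: p']) -> member (q :: B ++ [:: q']) ->
  uniq ((p :: A ++ [:: p']) ++ (q :: B ++ [:: q'])) ->
  A != [::] -> B != [::] -> adj p' q -> adj p q' ->
  (forall x y, x \in A ++ [:: p'] -> y \in q :: B -> adj x y -> x = p' /\ y = q) ->
  size B <= size A -> False.
Proof.
move=> MP MQ U nA nB p'q pq' H sz.
have cP := member_chordless MP; have cQ := member_chordless MQ.
have B0 : 0 < size B by case: (B) nB.
apply: (@exch_max ((A ++ [:: p']) ++ q :: B)
  [:: p :: A ++ [:: p']; q :: B ++ [:: q']]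
  [:: (A ++ [:: p']) ++ q :: B; [:: p; q']]);
  [old_paths | old_uniq U | perm_segments | new_paths | by rewrite inE eqxx | by [] | by [] | ].
- apply: chordless_cat_seg => // [_|_|]; first exact: (@chordless_catr _ [:: p]).
    exact: (@chordless_catl _ (q :: B) [:: q'] cQ).
  apply: (@joinedI _ p' q) => //; first by rewrite last_cat.
- by rewrite /= pq'.
- sizes.
Qed.

(** P without p is continued by q and b only, and p is appended to what remains of Q. *)
Lemma cross_cut p A p' q b B q' a :
  member (p :: A ++ [:: p']) -> member (q :: b :: B ++ [:: q']) ->
  uniq ((p :: A ++ [:: p']) ++ (q :: b :: B ++ [:: q'])) ->
  adj p' q -> adj p q' ->
  (forall y, adj p y -> y = a \/ y = q \/ y = q') -> a \in A ++ [:: p'] ->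
  (forall y, adj q y -> y = b \/ y = p \/ y = p') ->
  (forall x, x \in A ++ [:: p'] -> adj x b -> False) ->
  size (q :: b :: B ++ [:: q']) <= size A + 2 -> False.
Proof.
move=> MP MQ U p'q pq' Np aA Nq H sz.
have cP := member_chordless MP; have cQ := member_chordless MQ.
color_segments [:: inl p; inr A; inl p'; inl q; inl b; inr B; inl q'] U.
apply: (@exch_max ((A ++ [:: p']) ++ [:: q; b])
  [:: p :: A ++ [:: p']; q :: b :: B ++ [:: q']]
  [:: (A ++ [:: p']) ++ [:: q; b]; (B ++ [:: q']) ++ [:: p]]);
  [old_paths | old_uniq U | perm_segments | new_paths | by rewrite inE eqxx | by [] | by [] | ].
- apply: chordless_cat_seg => // [_|_|]; first exact: (@chordless_catr _ [:: p]).
    exact: (@chordless_catl _ [:: q; b] (B ++ [:: q']) cQ).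
  joint p' q.
- split_mem aA; (apply: chordless_cat_seg => // [_|]; [exact: (@chordless_catr _ [:: q; b])| joint q' p]).
- sizes.
Qed.

(** Both vertices of the path q q' are adjacent to both ends of P. They serve P at its two ends: q, p, a
    continue into Y, and the rest of P ends in q'. Three paths become two. *)
Lemma hub_merge p a A p' q q' y Y h :
  member (p :: a :: A ++ [:: p']) -> member [:: q; q'] -> member (y :: Y) ->
  uniq ((p :: a :: A ++ [:: p']) ++ [:: q; q'] ++ (y :: Y)) ->
  adj p q -> adj p' q' -> adj a y ->
  (forall x, adj p x -> x = a \/ x = q \/ x = q') ->
  (forall x, adj q x -> x = q' \/ x = p \/ x = p') ->
  (forall x, adj q' x -> x = q \/ x = p \/ x = p') ->
  (forall x, adj a x -> x = p \/ x = h \/ x = y) -> h \in A ++ [:: p'] -> False.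
Proof.
move=> MP MQ MY U pq p'q' ay Np Nq Nq' Na hA.
have cP := member_chordless MP; have cQ := member_chordless MQ; have cY := member_chordless MY.
have pa : adj p a by case/andP: cP => /andP[].
color_segments [:: inl p; inl a; inr A; inl p'; inl q; inl q'; inl y; inr Y] U.
apply: (@exch_lt
  [:: p :: a :: A ++ [:: p']; [:: q; q']; y :: Y]
  [:: [:: q; p; a] ++ y :: Y; (A ++ [:: p']) ++ [:: q']]);
  [old_paths | old_uniq U | perm_segments | new_paths | by []].
- split_mem hA; (apply: chordless_cat_seg => // [_|]; last by joint a y).
  + rewrite /= pa [adj q p]adj_sym pq /= !andbT; apply/negP=> /Nq [?|[?|?]]; color_clash.
  + rewrite /= pa [adj q p]adj_sym pq /= !andbT; apply/negP=> /Nq [?|[?|?]]; color_clash.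
- apply: chordless_cat_seg => // [_|]; first exact: (@chordless_catr _ [:: p; a]).
  joint p' q'.
Qed.

(** Two paths, each with a pair q q' or e e' adjacent to its two ends, and an edge a y between their
    interiors. The first is cut after a, the second after y, and the two pairs absorb the remaining
    pieces: four paths become three. *)
Lemma hub_hub p a A p' q q' s C y D s' e e' h h1 h2 :
  member (p :: a :: A ++ [:: p']) -> member [:: q; q'] -> member (s :: C ++ y :: D ++ [:: s']) ->
  member [:: e; e'] ->
  uniq ((p :: a :: A ++ [:: p']) ++ [:: q; q'] ++ (s :: C ++ y :: D ++ [:: s']) ++ [:: e; e']) ->
  adj p q -> adj p' q' -> adj a y -> adj s e -> adj s' e' ->
  (forall x, adj p x -> x = a \/ x = q \/ x = q') ->
  (forall x, adj q x -> x = q' \/ x = p \/ x = p') ->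
  (forall x, adj q' x -> x = q \/ x = p \/ x = p') ->
  (forall x, adj a x -> x = p \/ x = h \/ x = y) -> h \in A ++ [:: p'] ->
  (forall x, adj y x -> x = h1 \/ x = h2 \/ x = a) -> h1 \in s :: C -> h2 \in D ++ [:: s'] ->
  (forall x, adj e x -> x = e' \/ x = s \/ x = s') ->
  (forall x, adj e' x -> x = e \/ x = s \/ x = s') -> False.
Proof.
move=> MP MQ MY ME U pq p'q' ay se s'e' Np Nq Nq' Na hA Ny h1C h2D Ne Ne'.
have cP := member_chordless MP; have cQ := member_chordless MQ; have cY := member_chordless MY.
have pa : adj p a by case/andP: cP => /andP[].
have cy : chordless (s :: C ++ [:: y]) by apply: (@chordless_catl _ _ (D ++ [:: s'])); rewrite /= -catA.
have cD : chordless (D ++ [:: s']) by apply: (@chordless_catr _ (s :: C ++ [:: y])); rewrite /= -catA.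
color_segments [:: inl p; inl a; inr A; inl p'; inl q; inl q'; inl s; inr C; inl y; inr D; inl s'; inl e; inl e'] U.
apply: (@exch_lt
  [:: p :: a :: A ++ [:: p']; [:: q; q']; s :: C ++ y :: D ++ [:: s']; [:: e; e']]
  [:: [:: q; p; a] ++ rev (s :: C ++ [:: y]) ++ [:: e]; (A ++ [:: p']) ++ [:: q']; (D ++ [:: s']) ++ [:: e']]);
  [old_paths | old_uniq U | perm_segments | new_paths | by []].
- split_mem hA; split_mem h1C; split_mem h2D; (apply: chordless_cat_seg => // [_|u'|];
   [ by rewrite /= pa [adj q p]adj_sym pq /= !andbT; apply/negP=> /Nq [?|[?|?]]; color_clash
   | apply: chordless_cat_seg => // [u2|]; [ exact: chordless_rev_seg
     | by joint s e]
   | apply: (@joinedI _ a y) => //; [ by rewrite rev_cons rev_cat | edges ]]).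
- apply: chordless_cat_seg => // [_|]; first exact: (@chordless_catr _ [:: p; a]).
  joint p' q'.
- apply: chordless_cat_seg => //; joint s' e'.
Qed.

(** A capped path Y closes up to a cycle through its cap e, so all of Y except the neighbour r of y can
    be run through starting at y and passing e. Entered from q p a this gives a path longer than all
    others, even though the number of paths stays the same. *)
Lemma small_hub p a p' q q' Y1 r y Y2 y' e e2 E h :
  member [:: p; a; p'] -> member [:: q; q'] -> member (Y1 ++ r :: y :: Y2 ++ [:: y']) ->
  member (e :: e2 :: E) ->
  uniq ([:: p; a; p'] ++ [:: q; q'] ++ (Y1 ++ r :: y :: Y2 ++ [:: y']) ++ e :: e2 :: E) ->
  adj p q -> adj p' q' -> adj a y -> adj e y' -> adj e (head r Y1) ->
  (forall x, adj p x -> x = a \/ x = q \/ x = q') ->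
  (forall x, adj q x -> x = q' \/ x = p \/ x = p') ->
  (forall x, adj a x -> x = p \/ x = p' \/ x = y) ->
  (forall x, adj y x -> x = r \/ x = h \/ x = a) -> h \in Y2 ++ [:: y'] ->
  (forall x, adj e x -> x = e2 \/ x = head r Y1 \/ x = y') ->
  size (e :: e2 :: E) <= size (Y1 ++ r :: y :: Y2 ++ [:: y']) -> False.
Proof.
move=> MP MQ MY ME U pq p'q' ay ey' er Np Nq Na Ny hY Ne sz.
have cP := member_chordless MP; have cY := member_chordless MY; have cE := member_chordless ME.
have uY := member_uniq MY.
have nY : forall x z, x \in Y1 -> z \in y :: Y2 ++ [:: y'] -> adj x z -> False.
  rewrite -cat_rcons in cY uY; move=> x z xY zY.
  rewrite (chordless_joined uY cY _ zY) ?mem_rcons ?inE ?xY ?orbT // last_rcons => /andP[/eqP ex _].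
  by move: uY; rewrite cat_uniq rcons_uniq -ex xY.
have pa : adj p a by case/andP: cP => /andP[].
color_segments [:: inl p; inl a; inl p'; inl q; inl q'; inr Y1; inl r; inl y; inr Y2; inl y'; inl e; inl e2; inr E] U.
have cy : chordless (y :: Y2 ++ [:: y']) by apply: (@chordless_catr _ (Y1 ++ [:: r])); rewrite -catA.
have hr : head r Y1 = r \/ head r Y1 \in Y1 by case: (Y1) => [|z1 ?]; [left | right; rewrite inE eqxx].
apply: (@exch_max ([:: q; p; a] ++ (y :: Y2 ++ [:: y']) ++ [:: e] ++ Y1)
  [:: [:: p; a; p']; [:: q; q']; Y1 ++ r :: y :: Y2 ++ [:: y']; e :: e2 :: E]
  [:: [:: q; p; a] ++ (y :: Y2 ++ [:: y']) ++ [:: e] ++ Y1; [:: r]; e2 :: E; [:: q'; p']]);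
  [old_paths | old_uniq U | perm_segments | new_paths | by rewrite inE eqxx | by [] | by [] | ].
- split_mem hY; (apply: chordless_cat_seg => // [_|u1|];
   [ by rewrite /= pa [adj q p]adj_sym pq /= !andbT; apply/negP=> /Nq [?|[?|?]]; color_clash
   | apply: chordless_cat_seg => // [u2|];
     [ apply: (@chordless_cat_seg [:: e]) => // [_|]; [exact: (@chordless_catl _ Y1 _ cY) | 
        apply: (@joinedI _ e (head r Y1)) => //; [by case: (Y1) | edges ] ]
     | apply: (@joinedI _ y' e) => //; [by rewrite /= last_cat | by rewrite adj_sym | case: hr => hr; edges ] ]
   | joint a y ]).
- by [].
- exact: (@chordless_catr _ [:: e] _ cE).
- by rewrite /= adj_sym p'q'.
- sizes.
Qed.

(** P and v form a chordless cycle, which can be cut beside a instead of beside v: then p is an end of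
    the remaining path and a can start Y. *)
Lemma cycle_end v p a A p' y Y x h :
  member [:: v] -> member (p :: a :: A ++ [:: p']) -> member (y :: Y) ->
  uniq ([:: v] ++ (p :: a :: A ++ [:: p']) ++ (y :: Y)) ->
  adj v p -> adj v p' -> adj a y ->
  (forall z, z \in A -> adj z v -> False) ->
  (forall z, adj p z -> z = a \/ z = v \/ z = x) -> x \notin p :: a :: A ++ [:: p'] ->
  (forall z, adj a z -> z = p \/ z = h \/ z = y) -> h \in A ++ [:: p'] -> False.
Proof.
move=> MV MP MY U vp vp' ay Hv Np xP Na hA.
have cP := member_chordless MP; have cY := member_chordless MY.
color_segments [:: inl v; inl p; inl a; inr A; inl p'; inl y; inr Y] U.
have Hp : forall z, z \in A ++ [:: p'] -> adj z p -> z = a.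
  move=> z zA; rewrite adj_sym => /Np[//|[ez|ez]]; subst z.
    by split_mem zA; color_clash.
  by move: xP; rewrite !inE zA !orbT.
split_mem hA;
(apply: (@exch_lt
  [:: [:: v]; p :: a :: A ++ [:: p']; y :: Y]
  [:: (A ++ [:: p']) ++ [:: v; p]; a :: y :: Y]);
  [old_paths | old_uniq U | perm_segments | new_paths | by []]).
1,3: apply: chordless_cat_seg => // [_|_|]; [exact: (@chordless_catr _ [:: p; a] _ cP) | by rewrite /= vp | joint p' v ].
1,2: apply: (@chordless_cat_seg [:: a]) => //; joint a y.
Qed.

(** The same cut, where the path of the neighbour r of a has a pair e e' adjacent to both its ends: a, r
    and s are attached to e, and the rest of that path to e'. *)
Lemma cycle_hub v p a A p' s r C s' e e' x h :
  member [:: v] -> member (p :: a :: A ++ [:: p']) -> member (s :: r :: C ++ [:: s']) ->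
  member [:: e; e'] ->
  uniq ([:: v] ++ (p :: a :: A ++ [:: p']) ++ (s :: r :: C ++ [:: s']) ++ [:: e; e']) ->
  adj v p -> adj v p' -> adj a r -> adj s e -> adj s' e' ->
  (forall z, z \in A -> adj z v -> False) ->
  (forall z, adj p z -> z = a \/ z = v \/ z = x) -> x \notin p :: a :: A ++ [:: p'] ->
  (forall z, adj a z -> z = p \/ z = h \/ z = r) -> h \in A ++ [:: p'] ->
  (forall z, adj s z -> z = r \/ z = e \/ z = e') ->
  (forall z, adj e z -> z = e' \/ z = s \/ z = s') ->
  (forall z, adj e' z -> z = e \/ z = s \/ z = s') -> False.
Proof.
move=> MV MP MY ME U vp vp' ar se s'e' Hv Np xP Na hA Ns Ne Ne'.
have cP := member_chordless MP; have cY := member_chordless MY.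
have sr : adj s r by case/andP: cY => /andP[].
color_segments [:: inl v; inl p; inl a; inr A; inl p'; inl s; inl r; inr C; inl s'; inl e; inl e'] U.
have Hp : forall z, z \in A ++ [:: p'] -> adj z p -> z = a.
  move=> z zA; rewrite adj_sym => /Np[//|[ez|ez]]; subst z.
    by split_mem zA; color_clash.
  by move: xP; rewrite !inE zA !orbT.
split_mem hA;
(apply: (@exch_lt
  [:: [:: v]; p :: a :: A ++ [:: p']; s :: r :: C ++ [:: s']; [:: e; e']]
  [:: (A ++ [:: p']) ++ [:: v; p]; [:: e; s; r; a]; (C ++ [:: s']) ++ [:: e']]);
  [old_paths | old_uniq U | perm_segments | new_paths | by []]).
1,4: apply: chordless_cat_seg => // [_|_|]; [exact: (@chordless_catr _ [:: p; a] _ cP) | by rewrite /= vp | joint p' v ].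
1,3: rewrite /= [adj e s]adj_sym se sr [adj r a]adj_sym ar /= !andbT;
  repeat (apply/andP; split) => //; apply/negP; first [move=> /Ne | rewrite adj_sym => /Na | move=> /Ns ];
  move=> [?|[?|?]]; color_clash.
1,2: apply: chordless_cat_seg => // [_|]; [exact: (@chordless_catr _ [:: s; r] _ cY) | joint s' e'].
Qed.

(** P is cut just before the neighbour x of z, and Z just before the neighbour w of v. The far part of P
    is joined to the near part of Z by x z, and the near part of P to the far part of Z through v, so that
    v is saved. The tails tp and tz may be cut off first and are then covered, with the members L, by R. *)
Lemma split_far v p P1 x P2 tp z Z1 w Z2 tz xi L R :
  member [:: v] -> member (p :: P1 ++ x :: P2 ++ tp) -> member (z :: Z1 ++ w :: Z2 ++ tz) ->
  all member L ->
  uniq ([:: v] ++ (p :: P1 ++ x :: P2 ++ tp) ++ (z :: Z1 ++ w :: Z2 ++ tz) ++ flatten L) ->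
  perm_eq (flatten R) (tp ++ tz ++ flatten L) -> all (@chordless G) R -> size R <= size L ->
  adj v p -> adj v w -> adj z x ->
  (forall y, adj v y -> y = p \/ y = xi \/ y = w) -> xi \in P2 ->
  (forall a b, a \in p :: P1 ++ x :: P2 -> b \in z :: Z1 ++ w :: Z2 -> adj a b ->
     b = z /\ (a = p \/ a = x)) -> False.
Proof.
move=> MV MP MZ ML U pR cR sR vp vw zx Nv xiP H.
have cP := member_chordless MP; have cZ := member_chordless MZ.
color_segments [:: inl v; inl p; inr P1; inl x; inr P2; inr tp; inl z; inr Z1; inl w; inr Z2; inr tz; inr (flatten L)] U.
have c1 : chordless (p :: P1) by exact: (@chordless_catl _ (p :: P1) (x :: P2 ++ tp) cP).
have capped : chordless (x :: P2) by exact: (@chordless_catl _ (x :: P2) tp (@chordless_catr _ (p :: P1) _ cP)).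
have c3 : chordless (z :: Z1) by exact: (@chordless_catl _ (z :: Z1) (w :: Z2 ++ tz) cZ).
have c4 : chordless (w :: Z2) by exact: (@chordless_catl _ (w :: Z2) tz (@chordless_catr _ (z :: Z1) _ cZ)).
apply: (@exch_lt
  ([:: [:: v]; p :: P1 ++ x :: P2 ++ tp; z :: Z1 ++ w :: Z2 ++ tz] ++ L)
  ([:: rev (x :: P2) ++ z :: Z1; rev (p :: P1) ++ [:: v] ++ w :: Z2] ++ R));
  [ by rewrite /= MV MP MZ | by [] | | move=> b; rewrite mem_cat => /orP[|/(allP cR)//]; move: b; new_paths | by rewrite /= !ltnS].
  rewrite !flatten_cat; apply/permP => pp; have := permP pR pp; do 5 (rewrite ?(count_cat, count_rev) /=); clear.
  repeat (match goal with |- context [nat_of_bool ?b] => generalize (nat_of_bool b); intro end);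
    repeat (match goal with |- context [@count ?T ?a ?b] => generalize (@count T a b); intro end); move=> *; lia.
- apply: chordless_cat_seg => //; first exact: chordless_rev_seg.
  apply: (@joinedI _ x z); [by rewrite rev_cons last_rcons | by [] | by rewrite adj_sym | ].
  move=> a b; rewrite mem_rev => interior_in bZ h.
  case: (H a b _ _ h) => [||-> [ea|->]//]; last by (split_mem interior_in; exfalso; color_clash).
    by rewrite inE mem_cat interior_in !orbT.
  by move: bZ; rewrite !inE mem_cat => /orP[] ->; rewrite ?orbT.
- apply: chordless_cat_seg => // [|u1|]; first exact: chordless_rev_seg.
    apply: (@chordless_cat_seg [:: v]) => //; joint v w.
  apply: (@joinedI _ p v); [by rewrite rev_cons last_rcons | by [] | by rewrite adj_sym | ].
  move=> a b; rewrite mem_rev [b \in [:: v] ++ _]mem_cat mem_seq1 => interior_in /orP[/eqP-> | bZ] h.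
    split => //; rewrite adj_sym in h; case: (Nv _ h) => [//|[e|e]]; exfalso; split_mem interior_in; color_clash.
  case: (H a b _ _ h) => [||eb [ea|ea]].
  + by move: interior_in; rewrite !inE mem_cat => /orP[] ->; rewrite ?orbT.
  + by rewrite inE mem_cat bZ !orbT.
  + by split_mem bZ; color_clash.
  + by split_mem bZ; color_clash.
Qed.

(** The same with the neighbours of v and z in the other order along P: the far part of P, which starts
    at the neighbour x of v, goes through v, and the near part is joined to z by p z. *)
Lemma split_near v p P1 x P2 tp z Z1 w Z2 tz xj L R :
  member [:: v] -> member (p :: P1 ++ x :: P2 ++ tp) -> member (z :: Z1 ++ w :: Z2 ++ tz) ->
  all member L ->
  uniq ([:: v] ++ (p :: P1 ++ x :: P2 ++ tp) ++ (z :: Z1 ++ w :: Z2 ++ tz) ++ flatten L) ->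
  perm_eq (flatten R) (tp ++ tz ++ flatten L) -> all (@chordless G) R -> size R <= size L ->
  adj v x -> adj v w -> adj z p ->
  (forall y, adj v y -> y = p \/ y = x \/ y = w) -> xj \in P2 ->
  (forall a b, a \in p :: P1 ++ x :: P2 -> b \in z :: Z1 ++ w :: Z2 -> adj a b ->
     b = z /\ (a = p \/ a = xj)) -> False.
Proof.
move=> MV MP MZ ML U pR cR sR vx vw zp Nv xjP H.
have cP := member_chordless MP; have cZ := member_chordless MZ.
color_segments [:: inl v; inl p; inr P1; inl x; inr P2; inr tp; inl z; inr Z1; inl w; inr Z2; inr tz; inr (flatten L)] U.
have c1 : chordless (p :: P1) by exact: (@chordless_catl _ (p :: P1) (x :: P2 ++ tp) cP).
have capped : chordless (x :: P2) by exact: (@chordless_catl _ (x :: P2) tp (@chordless_catr _ (p :: P1) _ cP)).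
have c3 : chordless (z :: Z1) by exact: (@chordless_catl _ (z :: Z1) (w :: Z2 ++ tz) cZ).
have c4 : chordless (w :: Z2) by exact: (@chordless_catl _ (w :: Z2) tz (@chordless_catr _ (z :: Z1) _ cZ)).
apply: (@exch_lt
  ([:: [:: v]; p :: P1 ++ x :: P2 ++ tp; z :: Z1 ++ w :: Z2 ++ tz] ++ L)
  ([:: rev (x :: P2) ++ [:: v] ++ w :: Z2; rev (p :: P1) ++ z :: Z1] ++ R));
  [ by rewrite /= MV MP MZ | by [] | | move=> b; rewrite mem_cat => /orP[|/(allP cR)//]; move: b; new_paths | by rewrite /= !ltnS].
  rewrite !flatten_cat; apply/permP => pp; have := permP pR pp; do 5 (rewrite ?(count_cat, count_rev) /=); clear.
  repeat (match goal with |- context [nat_of_bool ?b] => generalize (nat_of_bool b); intro end);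
    repeat (match goal with |- context [@count ?T ?a ?b] => generalize (@count T a b); intro end); move=> *; lia.
- apply: chordless_cat_seg => // [|u1|]; first exact: chordless_rev_seg.
    apply: (@chordless_cat_seg [:: v]) => //; joint v w.
  apply: (@joinedI _ x v); [by rewrite rev_cons last_rcons | by [] | by rewrite adj_sym | ].
  move=> a b; rewrite mem_rev [b \in [:: v] ++ _]mem_cat mem_seq1 => interior_in /orP[/eqP-> | bZ] h.
    split => //; rewrite adj_sym in h; case: (Nv _ h) => [e|[//|e]]; exfalso; split_mem interior_in; color_clash.
  case: (H a b _ _ h) => [||eb [ea|ea]].
  + by rewrite inE mem_cat interior_in !orbT.
  + by rewrite inE mem_cat bZ !orbT.
  + by split_mem bZ; color_clash.
  + by split_mem bZ; color_clash.
- apply: chordless_cat_seg => //; first exact: chordless_rev_seg.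
  apply: (@joinedI _ p z); [by rewrite rev_cons last_rcons | by [] | by rewrite adj_sym | ].
  move=> a b; rewrite mem_rev => interior_in bZ h.
  case: (H a b _ _ h) => [||-> [->|ea]//]; last by (split_mem interior_in; exfalso; color_clash).
    by move: interior_in; rewrite !inE mem_cat => /orP[] ->; rewrite ?orbT.
  by move: bZ; rewrite !inE mem_cat => /orP[] ->; rewrite ?orbT.
Qed.

(** Otherwise the part of Y up to y would prolong P to a path longer than both. *)
Lemma blocked e A Y1 y Y2 :
  member (e :: A) -> member (Y1 ++ y :: Y2) -> uniq ((e :: A) ++ (Y1 ++ y :: Y2)) ->
  adj e y -> size (Y1 ++ y :: Y2) <= size (e :: A) ->
  (forall a b, a \in e :: A -> b \in Y1 ++ [:: y] -> adj a b -> a = e /\ b = y) -> False.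
Proof.
move=> MP MY U ey sz H; have cP := member_chordless MP; have cY := member_chordless MY.
have cY1 : chordless (Y1 ++ [:: y]) by apply: (@chordless_catl _ _ Y2); rewrite -catA.
have cY2 : chordless Y2 by apply: (@chordless_catr _ (Y1 ++ [:: y])); rewrite -catA.
apply: (@exch_max (rev (e :: A) ++ rev (Y1 ++ [:: y]))
  [:: e :: A; Y1 ++ y :: Y2]
  [:: rev (e :: A) ++ rev (Y1 ++ [:: y]); Y2]);
  [old_paths | old_uniq U | perm_segments | new_paths | by rewrite inE eqxx | by [] | by [] | ].
- apply: chordless_cat_seg => // [|u1|]; [exact: chordless_rev_seg | exact: chordless_rev_seg | ].
  apply: (@joinedI _ e y); [by rewrite rev_cons last_rcons | by rewrite rev_cat | by [] | ].
  by move=> a b; rewrite !mem_rev; apply: H.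
- by [].
- sizes.
Qed.

(** The vertices of P and R are recut into two pieces X e and X'. The single v takes over the part of Y
    before y, so that the rest of Y can prolong X e: four paths become three. *)
Lemma unblock P R X e X' v Y1 y Y2 y1 :
  member P -> member R -> member [:: v] -> member (Y1 ++ y :: Y2) ->
  uniq (P ++ R ++ [:: v] ++ (Y1 ++ y :: Y2)) ->
  perm_eq (X ++ e :: X') (P ++ R) -> (uniq (X ++ [:: e]) -> chordless (X ++ [:: e])) -> chordless X' ->
  adj e y -> head v Y1 = y1 -> adj v y1 ->
  (forall u, u \in Y1 -> adj u v -> u = y1) ->
  (forall a b, a \in X ++ [:: e] -> b \in y :: Y2 -> adj a b -> a = e /\ b = y) -> y1 \in Y1 -> False.
Proof.
move=> MP MR MV MY U pX cX cX' ey l1 v1 Hv H i1; have cY := member_chordless MY.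
apply: (@exch_lt
  [:: P; R; [:: v]; Y1 ++ y :: Y2]
  [:: [:: v] ++ Y1; (X ++ [:: e]) ++ y :: Y2; X']);
  [old_paths | old_uniq U | | new_paths | by []].
- apply/permP => pp; have := permP pX pp; do 5 (rewrite ?(count_cat, count_rev) /=); clear.
  repeat (match goal with |- context [nat_of_bool ?b] => generalize (nat_of_bool b); intro end);
    repeat (match goal with |- context [@count ?T ?a ?b] => generalize (@count T a b); intro end); move=> *; lia.
- apply: (@chordless_cat_seg [:: v]) => // [_|]; first exact: (@chordless_catl _ Y1 _ cY).
  apply: (@joinedI _ v y1) => //; first by case: (Y1) i1 l1.
  by move=> a b; rewrite inE => /eqP-> bY h; split => //; apply: Hv => //; rewrite adj_sym.
- apply: chordless_cat_seg => // [_|]; first exact: (@chordless_catr _ Y1 _ cY).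
  by apply: (@joinedI _ e y) => //; rewrite last_cat.
- by [].
Qed.

(** P and Q are recut into two paths one of which starts at a; the members L provide a path that ends
    in a neighbour x of a and leave fewer paths R behind. *)
Lemma attach P Q a A B L X x R :
  member P -> member Q -> all member L -> uniq (P ++ Q ++ flatten L) ->
  perm_eq (a :: A ++ B) (P ++ Q) -> (uniq (a :: A) -> chordless (a :: A)) -> (uniq B -> chordless B) ->
  perm_eq (X ++ x :: flatten R) (flatten L) -> size R < size L -> all (@chordless G) R ->
  (uniq (X ++ [:: x]) -> chordless (X ++ [:: x])) -> adj x a ->
  (forall u w, u \in X ++ [:: x] -> w \in a :: A -> adj u w -> u = x /\ w = a) -> False.
Proof.
move=> MP MQ ML U pU cA cB pL sR cR cX xa H.
apply: (@exch_lt ([:: P; Q] ++ L) ([:: (X ++ [:: x]) ++ a :: A; B] ++ R));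
  [by rewrite /= MP MQ | by [] | | | by []].
- rewrite !flatten_cat; apply/permP => pp; have := permP pU pp; have := permP pL pp; do 5 (rewrite ?(count_cat, count_rev) /=); clear.
  repeat (match goal with |- context [nat_of_bool ?b] => generalize (nat_of_bool b); intro end);
    repeat (match goal with |- context [@count ?T ?a ?b] => generalize (@count T a b); intro end); move=> *; lia.
- move=> b; rewrite !inE => /or3P[/eqP-> u|/eqP->//|/(allP cR)//].
  by apply: chordless_cat_seg => //; apply: (@joinedI _ x a) => //; rewrite last_cat.
Qed.

(** P without p' is continued by Q up to the vertex before c; p' takes the rest of Q. *)
Lemma tri_cut p A p' q b B1 c B2 q' :
  member (p :: A ++ [:: p']) -> member (q :: b :: B1 ++ c :: B2 ++ [:: q']) ->
  uniq ((p :: A ++ [:: p']) ++ (q :: b :: B1 ++ c :: B2 ++ [:: q'])) ->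
  adj p q -> adj p' c ->
  (forall y, adj q y -> y = b \/ y = p \/ y = p') ->
  (forall x y, x \in p :: A -> y \in b :: B1 -> adj x y -> False) ->
  (forall y, y \in B2 ++ [:: q'] -> adj p' y -> False) ->
  size (q :: b :: B1 ++ c :: B2 ++ [:: q']) <= size A + 2 -> False.
Proof.
move=> MP MQ U pq p'c Nq H Hp' sz.
have cP := member_chordless MP; have cQ := member_chordless MQ.
color_segments [:: inl p; inr A; inl p'; inl q; inl b; inr B1; inl c; inr B2; inl q'] U.
apply: (@exch_max (rev (p :: A) ++ q :: b :: B1)
  [:: p :: A ++ [:: p']; q :: b :: B1 ++ c :: B2 ++ [:: q']]
  [:: rev (p :: A) ++ q :: b :: B1; [:: p'] ++ c :: B2 ++ [:: q']]);
  [old_paths | old_uniq U | perm_segments | new_paths | by rewrite inE eqxx | by [] | by [] | ].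
- apply: chordless_cat_seg => // [u1|_|].
  + by apply: chordless_rev_seg => //; exact: (@chordless_catl _ (p :: A) _ cP).
  + exact: (@chordless_catl _ (q :: b :: B1) _ cQ).
  + joint p q.
- apply: (@chordless_cat_seg [:: p']) => // [_|]; first exact: (@chordless_catr _ (q :: b :: B1) _ cQ).
  apply: (@joinedI _ p' c) => // x y; rewrite [x \in _]inE => /eqP->.
  by rewrite [y \in _]inE => /orP[/eqP->//|yB h]; case: (Hp' y yB h).
- sizes.
Qed.

(** All of Q except its two ends is appended after p'; the ends are joined through p. *)
Lemma tri_cut3 p A p' q c b B q' a :
  member (p :: A ++ [:: p']) -> member (q :: c :: b :: B ++ [:: q']) ->
  uniq ((p :: A ++ [:: p']) ++ (q :: c :: b :: B ++ [:: q'])) ->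
  adj p q -> adj p q' -> adj p' c ->
  (forall y, adj q y -> y = c \/ y = p \/ y = p') ->
  (forall y, adj p' y -> y = q \/ y = c \/ y = a) -> a \in p :: A ->
  (forall x y, x \in A -> y \in c :: b :: B -> adj x y -> False) ->
  size (q :: c :: b :: B ++ [:: q']) <= size A + 2 -> False.
Proof.
move=> MP MQ U pq pq' p'c Nq Np' aA H sz.
have cP := member_chordless MP; have cQ := member_chordless MQ.
color_segments [:: inl p; inr A; inl p'; inl q; inl c; inl b; inr B; inl q'] U.
split_mem aA; (apply: (@exch_max ((A ++ [:: p']) ++ c :: b :: B)
  [:: p :: A ++ [:: p']; q :: c :: b :: B ++ [:: q']]
  [:: (A ++ [:: p']) ++ c :: b :: B; [:: q; p; q']]);
  [old_paths | old_uniq U | perm_segments | new_paths | by rewrite inE eqxx | by [] | by [] | ]).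
1,4: apply: chordless_cat_seg => // [_|_|]; [exact: (@chordless_catr _ [:: p] _ cP)
  | exact: (@chordless_catl _ (c :: b :: B) _ (@chordless_catr _ [:: q] _ cQ)) | joint p' c].
1,3: rewrite /= [adj q p]adj_sym pq pq' /= !andbT; apply/negP=> /Nq [?|[?|?]]; color_clash.
all: sizes.
Qed.

Implicit Types (x y u v e q : G) (s t : seq G).

(** * Paths, ends and outer neighbours *)

Definition path_of x : seq G := nth [::] F (find (fun s => x \in s) F).
Definition is_end x := (x == head x (path_of x)) || (x == last x (path_of x)).
Definition single x := size (path_of x) == 1.

(** Comparison by size, where the position in F breaks ties. *)
Definition rank x := size (path_of x) * (size F).+1 + index (path_of x) F.
Definition outer x : seq G := [seq y <- enum G | adj x y & y \notin path_of x].

Lemma has_path_of x : has (fun s => x \in s) F.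
Proof. by have /flattenP[s sF xs] := fac_full facF x; apply/hasP; exists s. Qed.

Lemma path_of_F x : path_of x \in F.
Proof. by rewrite mem_nth // -has_find has_path_of. Qed.

Lemma mem_path_of x : x \in path_of x.
Proof. by rewrite /path_of; apply: (nth_find [::] (has_path_of x)). Qed.

Lemma member_path_of x : member (path_of x).
Proof. by rewrite /member path_of_F. Qed.

Lemma path_of_member s x : member s -> x \in s -> path_of x = s \/ path_of x = rev s.
Proof. by move=> Ms xs; apply: (member_inj (member_path_of x) Ms (mem_path_of x)). Qed.

Lemma mem_path_of_member s x y : member s -> x \in s -> (y \in path_of x) = (y \in s).
Proof. by move=> Ms xs; case: (path_of_member Ms xs) => ->; rewrite ?mem_rev. Qed.

Lemma size_path_of_member s x : member s -> x \in s -> size (path_of x) = size s.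
Proof. by move=> Ms xs; case: (path_of_member Ms xs) => ->; rewrite ?size_rev. Qed.

Lemma path_of_same x y : y \in path_of x -> path_of y = path_of x.
Proof. by move=> yx; apply: (flatten_inj (fac_un facF) (path_of_F y) (path_of_F x) (mem_path_of y)). Qed.

Lemma path_of_sym x y : (y \in path_of x) = (x \in path_of y).
Proof. by apply/idP/idP => h; rewrite (path_of_same h) mem_path_of. Qed.

Lemma path_of_eq s x y : member s -> x \in s -> y \in s -> path_of x = path_of y.
Proof. by move=> Ms xs ys; apply: path_of_same; rewrite (mem_path_of_member _ Ms ys). Qed.

Lemma rank_same x y : path_of x = path_of y -> rank x = rank y.
Proof. by rewrite /rank => ->. Qed.

Lemma rank_inj x y : rank x = rank y -> path_of x = path_of y.
Proof.
rewrite /rank => h; have ix z : index (path_of z) F < (size F).+1 by rewrite ltnS index_size.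
have := congr1 (fun n => n %% (size F).+1) h.
rewrite !modnMDl !modn_small // => hi.
by rewrite -[LHS](nth_index [::] (path_of_F x)) hi nth_index ?path_of_F.
Qed.

Lemma rank_size x y : rank x <= rank y -> size (path_of x) <= size (path_of y).
Proof.
rewrite /rank => h; have ix : index (path_of y) F < (size F).+1 by rewrite ltnS index_size.
rewrite -ltnS -(ltn_pmul2r (ltn0Sn (size F))) mulSn addnC.
by apply: leq_ltn_trans (leq_trans (leq_addr _ _) h) _; rewrite ltn_add2l.
Qed.

Lemma size_rank x y : size (path_of x) < size (path_of y) -> rank x < rank y.
Proof. by move=> h; rewrite ltnNge; apply: contraL h => /rank_size; rewrite -leqNgt. Qed.

Lemma uniq_members s t x : member s -> member t -> x \in s -> x \notin t -> uniq (s ++ t).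
Proof.
move=> Ms Mt xs xt; rewrite cat_uniq (member_uniq Ms) (member_uniq Mt) andbT.
apply/hasPn => y yt /=; apply: contraNN xt => ys.
by rewrite -(mem_path_of_member x Mt yt) (mem_path_of_member x Ms ys).
Qed.

Lemma is_end_head e s : member (e :: s) -> is_end e.
Proof.
move=> Ms; rewrite /is_end; case: (path_of_member Ms (mem_head e s)) => ->; first by rewrite eqxx.
by rewrite rev_cons last_rcons eqxx orbT.
Qed.

Lemma is_end_last e s : member (s ++ [:: e]) -> is_end e.
Proof. by rewrite -member_rev rev_cat => /is_end_head. Qed.

Lemma end_member e : is_end e -> exists s, member (e :: s).
Proof.
have := member_path_of e; have := mem_path_of e; rewrite /is_end.
case: (path_of e) => // a s es Ms /orP[] /eqP /= he; subst; first by exists s.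
by exists (rev (belast a s)); move: Ms; rewrite lastI -member_rev rev_rcons.
Qed.

Lemma interior_member x : ~~ is_end x -> exists s1 l r s2, member (s1 ++ l :: x :: r :: s2).
Proof.
have := member_path_of x; have := mem_path_of x; rewrite /is_end => xs Ms; move: (Ms).
case/splitPr: xs => s1 s2; case: s2 => [|r s2]; first by rewrite last_cat /= eqxx orbT.
case/lastP: s1 => [|s1 l]; first by rewrite /= eqxx.
by rewrite cat_rcons; exists s1, l, r, s2.
Qed.

Lemma interior_mid s1 l x r s2 : member (s1 ++ l :: x :: r :: s2) -> ~~ is_end x.
Proof.
move=> Ms; have us := member_uniq Ms.
have xs : x \in s1 ++ l :: x :: r :: s2 by rewrite mem_cat !inE eqxx !orbT.
have h1 : x != head x (s1 ++ l :: x :: r :: s2).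
  case: s1 us {Ms xs} => [|a s1] /=.
    by rewrite !inE !negb_or => /andP[/andP[h _] _]; rewrite eq_sym.
  by rewrite mem_cat !inE !negb_or => /andP[/and3P[_ _ /andP[h _]] _]; rewrite eq_sym.
have h2 : x != last x (s1 ++ l :: x :: r :: s2).
  rewrite last_cat /=; move: us; rewrite cat_uniq => /and3P[_ _ /=/andP[_ /andP[h _]]].
  by apply: contraNN h => /eqP {1}->; rewrite mem_last.
rewrite /is_end; case: (path_of_member Ms xs) => ->; rewrite negb_or ?h1 ?h2 //.
have hr w z : w != [::] -> head z (rev w) = last z w.
  by case/lastP: w => // w c _; rewrite rev_rcons last_rcons.
have lr w z : w != [::] -> last z (rev w) = head z w.
  by case: w => // c w _; rewrite rev_cons last_rcons.
by rewrite hr ?lr ?h1 ?h2 //; case: (s1).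
Qed.

Lemma single_member v : single v = member [:: v].
Proof.
apply/idP/idP => [h|h]; last by rewrite /single (size_path_of_member h) ?inE.
have := member_path_of v; have := mem_path_of v; move: h; rewrite /single.
by case: (path_of v) => // a [] // _; rewrite inE => /eqP->.
Qed.

Lemma single_is_end v : single v -> is_end v.
Proof. by rewrite single_member; apply: is_end_head. Qed.

Lemma nonsingle_member e : is_end e -> ~~ single e -> exists A e', member (e :: A ++ [:: e']).
Proof.
case/end_member => s Ms; rewrite /single (size_path_of_member Ms) ?inE ?eqxx //.
by case/lastP: s Ms => // A e' Ms _; exists A, e'; rewrite cats1.
Qed.

Lemma outer_uniq x : uniq (outer x).
Proof. by rewrite filter_uniq // enum_uniq. Qed.

Lemma mem_outer x y : (y \in outer x) = adj x y && (y \notin path_of x).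
Proof. by rewrite mem_filter mem_enum andbT. Qed.

Lemma outer_sym x y : (y \in outer x) = (x \in outer y).
Proof. by rewrite !mem_outer adj_sym path_of_sym. Qed.

Lemma neighbors x : exists a b c, uniq [:: a; b; c] /\ forall y, adj x y = (y \in [:: a; b; c]).
Proof.
have h := cubG x; rewrite cardE in h.
have u := enum_uniq [set y | adj x y].
have m y : adj x y = (y \in enum [set y | adj x y]) by rewrite mem_enum inE.
case: (enum _) h u m => [|a [|b [|c [|]]]] // _ u m; by exists a, b, c.
Qed.

Lemma neighborsP x a b c : adj x a -> adj x b -> adj x c -> uniq [:: a; b; c] ->
  forall y, adj x y -> y = a \/ y = b \/ y = c.
Proof.
move=> xa xb xc u y xy; case: (neighbors x) => a' [b' [c' [u' h]]].
rewrite !h in xa xb xc xy; rewrite !inE in xa xb xc.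
have s : {subset [:: a; b; c] <= [:: a'; b'; c']} by move=> z; rewrite !inE => /or3P[]/eqP->.
have [_ e] := uniq_min_size u s (leqnn _).
by move: xy; rewrite -e !inE => /or3P[]/eqP->; auto.
Qed.

Lemma adj_member s1 x s2 y : member (s1 ++ x :: s2) -> y \in s1 ++ x :: s2 -> adj x y ->
  (s1 != [::] /\ y = last x s1) \/ (s2 != [::] /\ y = head x s2).
Proof.
move=> Ms ys xy; have us := member_uniq Ms; have cs := member_chordless Ms.
move: ys; rewrite mem_cat inE => /or3P[ys|/eqP e|ys].
- left; have := chordless_joined us cs ys (mem_head x s2); rewrite adj_sym xy => /esym/andP[/eqP e _].
  by case: (s1) ys e.
- by move: xy; rewrite e adj_irrefl.
- right; rewrite -cat_rcons in us cs.
  have := chordless_joined us cs (x := x) _ ys; rewrite mem_rcons mem_head xy => /(_ isT)/esym/andP[_ /eqP e].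
  by case: (s2) ys e.
Qed.

Lemma outer_size s1 x s2 : member (s1 ++ x :: s2) ->
  size (outer x) = 3 - (s1 != [::]) - (s2 != [::]).
Proof.
move=> Ms; have us := member_uniq Ms; have cs := member_chordless Ms.
case: (neighbors x) => a [b [c [u h]]].
have xs : x \in s1 ++ x :: s2 by rewrite mem_cat mem_head orbT.
pose T := [:: a; b; c].
have p1 : perm_eq (outer x) [seq y <- T | y \notin path_of x].
  by apply: uniq_perm; rewrite ?outer_uniq ?filter_uniq // => y; rewrite mem_outer mem_filter h andbC.
rewrite (perm_size p1) size_filter.
have -> : count (fun y => y \notin path_of x) T = 3 - count (fun y => y \in path_of x) T.
  by rewrite -(count_predC (mem (path_of x)) T : _ = 3) addKn.
rewrite -subnDA; congr subn.
pose I := (if s1 is _ :: _ then [:: last x s1] else [::]) ++ (if s2 is r :: _ then [:: r] else [::]).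
have -> : (s1 != [::]) + (s2 != [::]) = size I by rewrite /I; case: (s1) (s2) => [|? ?] [].
rewrite -size_filter; apply: perm_size; apply: uniq_perm; rewrite ?filter_uniq //.
  rewrite /I; case: (s1) (s2) us => [|l1 t1] [|r t2] //= us; rewrite andbT inE.
  apply/negP => /eqP e; have := mem_last l1 t1; rewrite e => h2.
  by case/andP: us => h1; rewrite cat_uniq /= !inE !negb_or; 
     move: h2; rewrite inE => /orP[/eqP er|rt]; [move: h1; rewrite er mem_cat !inE eqxx !orbT | rewrite rt /= !andbF ].
move=> y; rewrite mem_filter -/T -h (mem_path_of_member _ Ms xs); apply/andP/idP.
  case=> ys xy; case: (adj_member Ms ys xy) => [] [n ->]; rewrite /I.
    by case: (s1) n => //= l1 t1 _; rewrite inE eqxx.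
  by case: (s2) n => //= r t2 _; rewrite mem_cat inE eqxx orbT.
rewrite /I mem_cat => /orP[].
  case: (s1) us cs => [//|l1 t1] us cs /=; rewrite mem_seq1 => /eqP->; split.
    by have := mem_last l1 t1; rewrite -cat_cons mem_cat => ->.
  by rewrite adj_sym (chordless_joined us cs (mem_last _ _) (mem_head _ _)) !eqxx.
case: (s2) us cs => [//|r t2] us cs /=; rewrite mem_seq1 => /eqP->; split.
  by rewrite mem_cat !inE eqxx !orbT.
rewrite -cat_rcons in us cs.
by rewrite (chordless_joined us cs _ (mem_head _ _)) ?mem_rcons ?mem_head // last_rcons !eqxx.
Qed.

(** * Charges *)

(** These paths close up to a cycle through the end of a path of smaller rank, the cap. They are the
    only ones with an end of negative charge. *)
Definition capped x := [exists q, [&& is_end q, ~~ single q, rank q < rank x, adj q (head x (path_of x)),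
  adj q (last x (path_of x)) & 1 < size (path_of x)]].
Definition end_count x := count is_end (outer x).

(** What an end pays to an adjacent end of larger rank. The amounts leave the payer, once it has
    received 4 from each of its outer neighbours that are not ends, with charge 0. *)
Definition toll y : int := (if single y then (if end_count y == 2%N then - 2%:Z else 0)
  else (if end_count y == 2%N then - 1 else 2))%R.
Definition transfer x y : int :=
  (if is_end x then (if is_end y then (if (rank y < rank x)%N then toll y else - toll x) else 4)
   else (if is_end y then - 4%:Z else
     (if capped x then (if capped y then 0 else 4) else (if capped y then - 4%:Z else 0))))%R.

(** A path with k vertices starts with 4 (k - 3), so that the total charge compares the number of
    vertices with three times the number of paths. *)
Definition start_charge x : int := (if single x then - 8%:Z else if is_end x then - 2%:Z else 4)%R.
Definition charge x : int := (start_charge x + \sum_(y <- outer x) transfer x y)%R.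
Definition balance s : int := (\sum_(x <- s) charge x)%R.

Lemma transfer_anti x y : y \in outer x -> transfer x y = (- transfer y x)%R.
Proof.
rewrite mem_outer /transfer => /andP[_ yx].
have nr : rank x != rank y.
  by apply: contraNneq yx => /(rank_inj) e; rewrite path_of_sym -e mem_path_of.
case: (is_end x); case: (is_end y); rewrite ?opprK //.
  by case: (ltngtP (rank y) (rank x)) nr => //=; rewrite ?opprK.
by case: (capped x) (capped y) => [] [].
Qed.

Lemma sum_transfer : (\sum_x \sum_(y <- outer x) transfer x y = 0 :> int)%R.
Proof.
have h x : (\sum_(y <- outer x) transfer x y = \sum_(y | y \in outer x) transfer x y :> int)%R.
  by rewrite big_uniq // outer_uniq.
set S := (\sum_x _)%R.
have e : S = (\sum_x \sum_(y | y \in outer x) transfer x y)%R by apply: eq_bigr => x _.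
have : S = (- S)%R.
  rewrite {1}e (exchange_big_dep predT) //= e raddf_sum /=; apply: eq_bigr => y _.
  rewrite raddf_sum /=; apply: eq_big => [x|x]; first by rewrite outer_sym.
  by move/transfer_anti.
lia.
Qed.

Lemma sum_members (f : G -> int) : (\sum_x f x = \sum_(s <- F) \sum_(x <- s) f x)%R.
Proof.
rewrite -big_flatten /= [LHS](_ : _ = \sum_(x <- enum G) f x)%R; last by rewrite big_enum.
apply: perm_big; apply: uniq_perm; rewrite ?enum_uniq ?(fac_un facF) // => x.
by rewrite mem_enum (fac_full facF).
Qed.

Lemma member_F s : s \in F -> member s.
Proof. by rewrite /member => ->. Qed.

Lemma member_cases s : member s -> (exists v, s = [:: v] /\ single v) \/
  (exists e A e', s = e :: A ++ [:: e']).
Proof.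
case: s => [/(member_ne)//|e s Ms]; case/lastP: s Ms => [|A e'] Ms.
  by left; exists e; rewrite single_member.
by right; exists e, A, e'; rewrite cats1.
Qed.

Lemma nonsingle e A e' x : member (e :: A ++ [:: e']) -> x \in e :: A ++ [:: e'] -> single x = false.
Proof. by move=> Ms xs; rewrite /single (size_path_of_member Ms xs) /= size_cat /= addn1. Qed.

Lemma is_end_interior e A e' x : member (e :: A ++ [:: e']) -> x \in A -> ~~ is_end x.
Proof.
move=> Ms xA; case/splitPr: xA Ms => A1 A2 Ms.
have [s1 [l e1]] : exists s1 l, e :: A1 = s1 ++ [:: l].
  by exists (belast e A1), (last e A1); rewrite cats1 -lastI.
have [r [s2 e2]] : exists r s2, A2 ++ [:: e'] = r :: s2.
  by case: (A2) => [|r s2]; [exists e', [::] | exists r, (s2 ++ [:: e'])].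
apply: (@interior_mid s1 l x r s2).
by rewrite -e2 -[l :: _]cat1s catA -e1 /=; move: Ms; rewrite -catA.
Qed.

Lemma is_endE e A e' x : member (e :: A ++ [:: e']) -> x \in e :: A ++ [:: e'] ->
  is_end x = (x == e) || (x == e').
Proof.
move=> Ms; rewrite inE mem_cat mem_seq1 => /or3P[/eqP->|xA|/eqP->]; last 2 first.
- rewrite (negPf (is_end_interior Ms xA)); apply/esym/negbTE; apply: contraNN (is_end_interior Ms xA).
  case/orP => /eqP->; first exact: (is_end_head Ms).
  by apply: (@is_end_last _ (e :: A)).
- by rewrite eqxx orbT; apply: (@is_end_last _ (e :: A)).
- by rewrite eqxx; apply: (is_end_head Ms).
Qed.

Lemma sum_start_charge s : member s -> (\sum_(x <- s) start_charge x = (4 * size s)%:Z - 12%:Z)%R.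
Proof.
move=> Ms; case: (member_cases Ms) => [[v [-> sv]]|[e [A [e' es]]]].
  by rewrite big_seq1 /start_charge sv.
rewrite es in Ms *; have hE := is_endE Ms; have hs := nonsingle Ms.
rewrite big_cons big_cat big_seq1 /= /start_charge !hs ?inE ?mem_cat ?mem_head ?inE ?eqxx ?orbT //.
rewrite (is_end_head Ms) (@is_end_last _ (e :: A) Ms).
rewrite (_ : \sum_(x <- A) _ = (4 * size A)%:Z)%R; last first.
  rewrite big_seq (eq_bigr (fun=> 4%:Z)%R) => [|x xA]; last first.
    by rewrite hs ?(negPf (is_end_interior Ms xA)) // inE mem_cat xA orbT.
  rewrite -big_seq; elim: (A) => [|x B IH]; rewrite ?big_nil // big_cons IH /=; lia.
by rewrite size_cat /=; lia.
Qed.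

(** Transfers are antisymmetric, so the total charge is the one at the start. *)
Lemma sum_balance : (\sum_(s <- F) balance s = (4 * #|G|)%:Z - (12 * size F)%:Z)%R.
Proof.
have -> : (\sum_(s <- F) balance s = \sum_x charge x)%R by rewrite (sum_members charge).
rewrite /charge big_split /= sum_transfer addr0 (sum_members start_charge).
have -> : (\sum_(s <- F) \sum_(x <- s) start_charge x = \sum_(s <- F) ((4 * size s)%:Z - 12%:Z))%R.
  by rewrite big_seq [RHS]big_seq; apply: eq_bigr => s sF; apply: sum_start_charge (member_F sF).
have -> : #|G| = size (flatten F).
  rewrite cardE; apply: perm_size; apply: uniq_perm; rewrite ?enum_uniq ?(fac_un facF) // => x.
  by rewrite mem_enum (fac_full facF).
elim: (F) => [|s A IH]; first by rewrite big_nil.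
have e : size (flatten (s :: A)) = size s + size (flatten A) by rewrite /= size_cat.
rewrite big_cons IH e; move: (size (flatten A)) (size s) => n m; rewrite [size (s :: A)]/=. move: (size A) => a; clear; lia.
Qed.

Lemma balance_rev s : balance (rev s) = balance s.
Proof. by apply: perm_big; rewrite perm_rev. Qed.

Lemma balance_split e A e' : (balance (e :: A ++ [:: e']) = charge e + charge e' + \sum_(x <- A) charge x)%R.
Proof. by rewrite /balance big_cons big_cat big_seq1 /= [(\sum_(x <- A) _ + _)%R]addrC addrA. Qed.

Lemma outer_single v : single v -> exists a b c, outer v = [:: a; b; c].
Proof.
rewrite single_member => Ms; have := outer_size (s1 := [::]) Ms.
by case: (outer v) => [|a [|b [|c []]]] //= _; exists a, b, c.
Qed.

Lemma outer_end e s : member (e :: s) -> s != [::] -> exists a b, outer e = [:: a; b].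
Proof.
move=> Ms ns; have := outer_size (s1 := [::]) Ms.
by rewrite ns; case: (outer e) => [|a [|b []]] //= _; exists a, b.
Qed.

Lemma outer_interior x : ~~ is_end x -> exists a, outer x = [:: a].
Proof.
case/(interior_member) => s1 [l [r [s2]]]; rewrite -cat1s catA => Ms.
have := outer_size Ms; rewrite /=.
have -> : (s1 ++ [:: l] != [::]) = true by case: (s1).
by case: (outer x) => [|a []] //= _; exists a.
Qed.

(** * Ends, and the ends adjacent to them *)

Lemma uniq_cat3 s t r : uniq (s ++ t) -> uniq (s ++ r) -> uniq (t ++ r) -> uniq (s ++ t ++ r).
Proof.
rewrite !cat_uniq has_cat => /and3P[-> h1 ->] /and3P[_ h2 ->] /and3P[_ -> _].
by rewrite (negPf h1) (negPf h2).
Qed.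

Lemma uniq_cat4 s t r w : uniq (s ++ t) -> uniq (s ++ r) -> uniq (s ++ w) -> uniq (t ++ r ++ w) ->
  uniq (s ++ t ++ r ++ w).
Proof.
move=> h1 h2 h3 h4; apply: uniq_cat3 => //; apply: uniq_cat3 => //.
by move: h4; rewrite cat_uniq => /and3P[].
Qed.

Lemma uniq_membersC s t y : member s -> member t -> y \in t -> y \notin s -> uniq (s ++ t).
Proof. by move=> Ms Mt yt ys; rewrite uniq_catC; apply: (uniq_members Mt Ms yt). Qed.

Lemma notin_members s t x y : member s -> member t -> x \in s -> y \in t -> y \notin s -> x \notin t.
Proof.
move=> Ms Mt xs yt; apply: contraNN => xt.
by rewrite -(mem_path_of_member y Ms xs) (mem_path_of_member y Mt xt).
Qed.

Lemma outer_adj x y : y \in outer x -> adj x y.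
Proof. by rewrite mem_outer => /andP[]. Qed.

Lemma outer_rank x y : y \in outer x -> rank x != rank y.
Proof.
rewrite mem_outer => /andP[_]; apply: contraNneq => /(rank_inj) e.
by rewrite path_of_sym -e mem_path_of.
Qed.

Lemma outerI x y s : member s -> x \in s -> adj x y -> y \notin s -> y \in outer x.
Proof. by move=> Ms xs xy ys; rewrite mem_outer xy (mem_path_of_member _ Ms xs). Qed.

Lemma outer_notin x y s : member s -> x \in s -> y \in outer x -> y \notin s.
Proof. by move=> Ms xs; rewrite mem_outer (mem_path_of_member _ Ms xs) => /andP[]. Qed.

Lemma head_adj e s : member (e :: s) -> s != [::] -> adj e (head e s).
Proof. by move=> Ms; have := member_chordless Ms; case: (s) => // a t /= /andP[/andP[]]. Qed.

Lemma head_mem e s : s != [::] -> head e s \in s.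
Proof. by case: s => // a t _; rewrite mem_head. Qed.

Lemma end_neighbors e s a b : member (e :: s) -> s != [::] -> a \in outer e -> b \in outer e -> a != b ->
  forall y, adj e y -> y = head e s \/ y = a \/ y = b.
Proof.
move=> Ms ns ae be ab; have hs := head_mem e ns.
have out c : c \in outer e -> c != head e s.
  move=> ce; have := outer_notin Ms (mem_head _ _) ce; apply: contraNneq => ->.
  by rewrite inE hs orbT.
apply: (neighborsP (head_adj Ms ns) (outer_adj ae) (outer_adj be)).
by rewrite /= !inE negb_or ab !andbT eq_sym (out a) // eq_sym (out b).
Qed.

Lemma outer_pair e s a b y : member (e :: s) -> s != [::] -> a \in outer e -> b \in outer e -> a != b ->
  y \in outer e -> y = a \/ y = b.
Proof.
move=> Ms ns ae be ab ye; case: (end_neighbors Ms ns ae be ab (outer_adj ye)) => // h.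
by have := outer_notin Ms (mem_head _ _) ye; rewrite h inE (head_mem _ ns) orbT.
Qed.

(** By [merge_ends], the edge v y is not the only edge from v to the path of y. *)
Lemma single_end v y : single v -> is_end y -> y \in outer v ->
  ~~ single y /\ exists u, [/\ u \in outer v, u \in path_of y & u != y].
Proof.
move=> sv Ey yv; have [B MY] := end_member Ey.
have MV : member [:: v] by rewrite -single_member.
have vY : v \notin y :: B by rewrite -(mem_path_of_member _ MY (mem_head _ _)); move: yv; rewrite outer_sym mem_outer => /andP[].
have U : uniq ([:: v] ++ y :: B) by apply: (uniq_members MV MY (mem_head _ _)).
have [/hasP[u uB vu]|nh] := boolP (has (fun u => adj v u) B); last first.
  case: (merge_ends MV MY U (outer_adj yv)) => a b; rewrite !inE => /eqP-> /orP[/eqP->//|bB] ab.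
  by case/hasP: nh; exists b.
have uy : u != y by apply: contraTneq uB => ->; have := member_uniq MY; case/andP.
split.
  apply/negP => sy; move: (sy); rewrite single_member => My.
  case: (member_inj MY My (mem_head _ _) (mem_head _ _)) => [[e]|]; first by rewrite e in uB.
  by move/(congr1 size); case: (B) uB.
exists u; split=> //; last by rewrite (mem_path_of_member _ MY) ?inE ?uB ?eqxx ?orbT.
apply: (outerI MV); rewrite ?mem_seq1 //; apply: contraNneq vY => <-; by rewrite inE uB orbT.
Qed.

(** By [absorb_end], q has a second neighbour on the path of x, and q has just two outer neighbours. *)
Lemma captive_nb q x u : is_end q -> is_end x -> ~~ single q -> x \in outer q -> rank q < rank x ->
  u \in outer q -> u \in path_of x.
Proof.
move=> Eq Ex nq xq rqx uq.
have [A MP] := end_member Ex; have [B MQ] := end_member Eq.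
have nB : B != [::] by apply: contraNneq nq => nB; rewrite single_member -nB.
have xQ : x \notin q :: B := outer_notin MQ (mem_head _ _) xq.
have U : uniq ((x :: A) ++ q :: B) by apply: (uniq_members MP MQ (mem_head _ _)).
have sz : size B <= size A.
  have := rank_size (ltnW rqx).
  by rewrite (size_path_of_member MP (mem_head _ _)) (size_path_of_member MQ (mem_head _ _)).
have [/hasP[w wA wq]|nh] := boolP (has (fun w => adj w q) A); last first.
  case: (absorb_end MP MQ U _ sz) => [|w]; first by rewrite adj_sym; apply: outer_adj.
  rewrite inE => /orP[/eqP//|wA] wq; by case/hasP: nh; exists w.
have wq' : w \in outer q.
  rewrite outer_sym; apply: (outerI MP); rewrite ?inE ?wA ?orbT //.
  have := outer_notin MP (mem_head _ _) ; rewrite outer_sym in xq; by move/(_ _ xq); rewrite inE.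
have xw : x != w by apply: contraTneq wA => <-; have := member_uniq MP; case/andP.
rewrite (mem_path_of_member _ MP (mem_head _ _)) inE.
by case: (outer_pair MQ nB xq wq' xw uq) => ->; rewrite ?eqxx ?wA ?orbT.
Qed.

(** For a single q, ends on two different paths would require four neighbours by [single_end]. *)
Lemma captive_ends q x y : is_end q -> is_end x -> x \in outer q -> rank q < rank x ->
  y \in outer q -> is_end y -> y \in path_of x.
Proof.
move=> Eq Ex xq rqx yq Ey; have [sq|nq] := boolP (single q); last exact: (captive_nb Eq Ex nq xq).
have [_ [u [uq ux nux]]] := single_end sq Ex xq.
have [_ [w [wq wy nwy]]] := single_end sq Ey yq.
have [a [b [c outer_interior]]] := outer_single sq.
apply/negPn/negP => yx.
have s : {subset [:: x; u; y; w] <= outer q} by move=> z; rewrite !inE => /or4P[]/eqP->.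
have wx : w \notin path_of x by apply: contraNN yx => h; rewrite -(path_of_same h) (path_of_same wy) mem_path_of.
have un : uniq [:: x; u; y; w].
  have ne z : z \in path_of x -> (z != y) && (z != w).
    by move=> zx; apply/andP; split; apply: contraTneq zx => ->.
  have /andP[xy xw] := ne x (mem_path_of x); have /andP[uy uw] := ne u ux.
  by rewrite /= !inE !negb_or [x == u]eq_sym nux xy xw uy uw [y == w]eq_sym nwy.
by have := uniq_leq_size un s; rewrite outer_interior.
Qed.

Lemma end_count_captive q x A x' : member (x :: A ++ [:: x']) -> is_end q -> x \in outer q ->
  rank q < rank x ->
  end_count q = (adj q x').+1.
Proof.
move=> MP Eq xq rqx; have Ex := is_end_head MP.
have Ex' : is_end x' := @is_end_last x' (x :: A) MP.
have uP := member_uniq MP.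
have nxx : x != x' by move: uP => /=/andP[h _]; apply: contraNneq h => ->; rewrite mem_cat inE eqxx orbT.
rewrite /end_count -size_filter.
have sub y : y \in filter is_end (outer q) -> y = x \/ y = x' /\ adj q x'.
  rewrite mem_filter => /andP[Ey yq]; have := captive_ends Eq Ex xq rqx yq Ey.
  rewrite (mem_path_of_member _ MP (mem_head _ _)) => yP.
  move: Ey; rewrite (is_endE MP yP) => /orP[/eqP->|/eqP e]; first by left.
  by right; rewrite -e (outer_adj yq).
have xf : x \in filter is_end (outer q) by rewrite mem_filter Ex.
case ax : (adj q x').
  have xf' : x' \in filter is_end (outer q).
    rewrite mem_filter Ex' outer_sym /=.
    apply: (outerI MP); rewrite ?inE ?mem_cat ?inE ?eqxx ?orbT // 1?adj_sym //.
    have : q \in outer x by rewrite outer_sym.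
    by move/(outer_notin MP (mem_head _ _)); rewrite inE mem_cat inE.
  apply: (perm_size (s2 := [:: x; x'])); apply: uniq_perm.
  - by rewrite filter_uniq ?outer_uniq.
  - by rewrite /= mem_seq1 nxx.
  - move=> y; rewrite [RHS]inE mem_seq1; apply/idP/orP => [/sub[->|[-> _]]|[]/eqP-> //]; rewrite eqxx; auto.
apply: (perm_size (s2 := [:: x])); apply: uniq_perm => //; first by rewrite filter_uniq ?outer_uniq.
move=> y; rewrite mem_seq1; apply/idP/eqP => [/sub[->|[_ h]]//|-> //]; by rewrite h in ax.
Qed.

Lemma charge_single v : single v -> charge v = if end_count v == 0 then 4%R else 0%R.
Proof.
move=> sv; have Ev := single_is_end sv; have [a [b [c e]]] := outer_single sv.
have d y : y \in outer v -> transfer v y = (if is_end y then - toll v else 4)%R.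
  move=> yv; rewrite /transfer Ev; case Ey : (is_end y) => //.
  have [ny _] := single_end sv Ey yv.
  have : rank v < rank y.
    apply: size_rank; rewrite (eqP sv) ltn_neqAle eq_sym ny /=.
    by case: (path_of y) (mem_path_of y).
  by move/ltnW; rewrite ltnNge => ->.
have n2 : end_count v <= 2.
  have [/eqP->//|] := boolP (end_count v == 0); rewrite -lt0n -has_count => /hasP[x xv Ex].
  have [A [x' MP]] := nonsingle_member Ex (single_end sv Ex xv).1.
  rewrite (end_count_captive MP Ev xv) //; first by case: adj.
  apply: size_rank; rewrite (eqP sv) ltn_neqAle eq_sym (single_end sv Ex xv).1 /=.
  by case: (path_of x) (mem_path_of x).
have t : toll v = (if end_count v == 2%N then - 2%:Z else 0)%R by rewrite /toll sv.
rewrite /charge /start_charge sv e !big_cons big_nil !d ?e ?inE ?eqxx ?orbT // t.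
move: n2; rewrite /end_count e /=.
by case: (is_end a); case: (is_end b); case: (is_end c).
Qed.

Lemma charge_end e s : member (e :: s) -> s != [::] ->
  exists a b, [/\ outer e = [:: a; b], a != b & charge e = (- 2%:Z + transfer e a + transfer e b)%R].
Proof.
move=> Ms ns; have [a [b h]] := outer_end Ms ns; exists a, b.
have ab : a != b by have := outer_uniq e; rewrite h /= inE andbT.
have ne : ~~ single e by rewrite /single (size_path_of_member Ms (mem_head _ _)); case: (s) ns.
split=> //; rewrite /charge /start_charge (negPf ne) (is_end_head Ms) h !big_cons big_nil.
by rewrite addr0 addrA.
Qed.

Lemma charge_captive q x : is_end q -> is_end x -> ~~ single q -> x \in outer q ->
  rank q < rank x -> charge q = 0%R.
Proof.
move=> Eq Ex nq xq rqx.
have [B [q' MQ]] := nonsingle_member Eq nq.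
have nB : B ++ [:: q'] != [::] by case: (B).
have [a [b [h ab ->]]] := charge_end MQ nB.
have nx : ~~ single x.
  rewrite /single; apply: contraNN nq => /eqP sx; rewrite /single.
  have := rank_size (ltnW rqx); rewrite sx => hs; rewrite eqn_leq hs.
  by case: (path_of q) (mem_path_of q).
have [A [x' MP]] := nonsingle_member Ex nx.
have nc := end_count_captive MP Eq xq rqx.
have d y : y \in outer q -> transfer q y = (if is_end y then - toll q else 4)%R.
  move=> yq; rewrite /transfer Eq; case Ey : (is_end y) => //.
  have yx := captive_nb Eq Ex nq xq rqx yq.
  by rewrite (rank_same (path_of_same yx)) ltnNge (ltnW rqx).
have t : toll q = (if end_count q == 2%N then - 1 else 2)%R by rewrite /toll (negPf nq).
rewrite !d ?h ?inE ?eqxx ?orbT // t; move: nc; rewrite /end_count h /=.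
by case: (is_end a); case: (is_end b); case: adj.
Qed.

(** An interior vertex has one outer neighbour, which decides what is left of its 4. *)
Lemma charge_interior x y : ~~ is_end x -> y \in outer x ->
  charge x = (if is_end y then 0 else if capped x then (if capped y then 4 else 8) else (if capped y then 0 else 4))%R.
Proof.
move=> nx; have [a h] := outer_interior nx; rewrite h inE => /eqP->.
have ns : single x = false by apply: contraNF nx; apply: single_is_end.
rewrite /charge /start_charge ns (negPf nx) h big_cons big_nil /transfer (negPf nx).
by case: (is_end a); case: (capped x); case: (capped a).
Qed.

Lemma charge_interior_ge0 x : ~~ is_end x -> (0 <= charge x)%R.
Proof.
move=> nx; have [a h] := outer_interior nx.
rewrite (charge_interior nx (y := a)) ?h ?mem_head //.
by case: (is_end a); case: (capped x); case: (capped a).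
Qed.

(** What a free end receives from an outer neighbour y. *)
Definition gain y : int := (if is_end y then toll y else 4)%R.

(** A free end pays nobody: all adjacent ends have smaller rank. *)
Definition free_end e := all (fun y => is_end y ==> (rank y < rank e)) (outer e).

Lemma charge_free e s : member (e :: s) -> s != [::] -> free_end e ->
  exists a b, [/\ outer e = [:: a; b], a != b & charge e = (- 2%:Z + gain a + gain b)%R].
Proof.
move=> Ms ns fe; have [a [b [h ab ->]]] := charge_end Ms ns; exists a, b; split=> //.
have d y : y \in outer e -> transfer e y = gain y.
  move=> ye; rewrite /transfer (is_end_head Ms) /gain; case Ey : (is_end y) => //.
  by have := allP fe y ye; rewrite Ey /= => ->.
by rewrite !d // h !inE eqxx ?orbT.
Qed.

Lemma not_free e : ~~ free_end e -> exists x, [/\ x \in outer e, is_end x & rank e < rank x].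
Proof.
case/allPn => x xe; rewrite negb_imply -leqNgt => /andP[Ex le].
by exists x; split=> //; rewrite ltn_neqAle le (outer_rank xe).
Qed.

(** An instance of [join_three]: two singles are never adjacent to each other. *)
Lemma two_singles e A e' a b : member (e :: A ++ [:: e']) -> a \in outer e -> b \in outer e -> a != b ->
  single a -> single b -> False.
Proof.
move=> MP ae be ab sa sb.
have nA : A ++ [:: e'] != [::] by case: (A).
move: (sa) (sb); rewrite !(single_member) => Ma Mb.
have interior_in := outer_notin MP (mem_head _ _) ae; have bP := outer_notin MP (mem_head _ _) be.
have U : uniq ((e :: A ++ [:: e']) ++ [:: a] ++ [:: b]).
  apply: uniq_cat3; [exact: (uniq_membersC MP Ma (mem_head _ _)) | exact: (uniq_membersC MP Mb (mem_head _ _)) | ].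
  by rewrite /= mem_seq1 ab.
apply: (join_three MP Ma Mb U nA (outer_adj ae) (outer_adj be)).
  by move=> y /(end_neighbors MP nA ae be ab) []; auto; move=> ->; left; case: (A).
move=> x y; rewrite !inE => /eqP-> /eqP-> h.
have bo : b \in outer a by apply: (outerI Ma); rewrite ?inE // eq_sym.
by have [] := single_end sa (single_is_end sb) bo; rewrite sb.
Qed.

(** [join_three] applies if the third neighbour of v is an interior vertex of the path, and [drop_end]
    if it is not. *)
Lemma single_both_ends e A e' v b : member (e :: A ++ [:: e']) -> v \in outer e -> single v ->
  adj v e' ->
  b \in outer e -> b != v -> is_end b -> False.
Proof.
move=> MP ve sv ve' be bv Eb.
have nA : A ++ [:: e'] != [::] by case: (A).
have Ee := is_end_head MP; have Ee' : is_end e' := @is_end_last e' (e :: A) MP.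
move: (sv); rewrite single_member => Mv.
have [Z MZ] := end_member Eb.
have vP := outer_notin MP (mem_head _ _) ve; have bP := outer_notin MP (mem_head _ _) be.
have vZ : v \notin b :: Z.
  apply/negP => h; have [e1 _] : b :: Z = [:: v] by case: (member_inj MZ Mv h (mem_head _ _)).
  by rewrite e1 eqxx in bv.
have U : uniq ([:: v] ++ (e :: A ++ [:: e']) ++ b :: Z).
  apply: uniq_cat3; [exact: (uniq_members Mv MP (mem_head _ _) vP) | exact: (uniq_members Mv MZ (mem_head _ _) vZ) | ].
  exact: (uniq_membersC MP MZ (mem_head _ _) bP).
have [a nov] : exists w, forall y, adj v y -> y = e \/ y = e' \/ y = w.
  have [a [b' [c h]]] := outer_single sv.
  have e1 : e \in outer v by rewrite outer_sym.
  have e2 : e' \in outer v.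
    rewrite outer_sym; apply: (outerI MP); rewrite ?inE ?mem_cat ?inE ?eqxx ?orbT // 1?adj_sym //.
    by move: vP; rewrite inE mem_cat inE.
  have nee' : e != e'.
    by have := member_uniq MP => /=/andP[h1 _]; apply: contraNneq h1 => ->; rewrite mem_cat inE eqxx orbT.
  have [w we] : exists w, perm_eq (outer v) [:: e; e'; w].
    have [T pr] : exists T, perm_eq (outer v) (e :: e' :: T).
      exists (rem e' (rem e (outer v))).
      apply: (perm_trans (perm_to_rem e1)); rewrite perm_cons; apply: perm_to_rem.
      by rewrite (mem_rem_uniq _ (outer_uniq _)) inE eq_sym nee'.
    by have := perm_size pr; rewrite (congr1 size h); case: T pr => [|w [|z T]] pr //= _; exists w.
  exists w => y vy; have [yv|] := boolP (y \in outer v).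
    by move: yv; rewrite (perm_mem we) !inE => /or3P[]/eqP->; auto.
  rewrite mem_outer vy /= negbK (mem_path_of_member _ Mv (mem_head _ _)) inE => /eqP yv.
  by rewrite yv adj_irrefl in vy.
have vb : v != b by rewrite eq_sym.
have [aA|aA] := boolP (a \in A).
  apply: (join_three MP Mv MZ _ nA (outer_adj ve) (outer_adj be)).
  - by rewrite uniq_catCA.
  - by move=> y /(end_neighbors MP nA ve be vb) []; [by move=> ->; left; case: (A) | case; auto].
  - move=> x y; rewrite inE => /eqP-> yZ /nov.
    have yP : y \notin e :: A ++ [:: e'].
      by move: U; rewrite uniq_catCA cat_uniq => /and3P[_ /hasPn h _]; apply: h; rewrite mem_cat yZ orbT.
    by move: yP; rewrite inE mem_cat inE => h [|[|]] ey; subst y; move: h; rewrite ?aA ?eqxx ?orbT.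
apply: (drop_end Mv MP MZ U ve' (outer_adj be) (a := head e (A ++ [:: e']))).
- exact: (end_neighbors MP nA ve be vb).
- exact: head_mem.
- move=> x xA; rewrite adj_sym => /nov[|[|]] ex; subst x.
  + by have := member_uniq MP; rewrite /= mem_cat xA.
  + by have := member_uniq MP; rewrite /= cat_uniq /= orbF xA /= !andbF.
  + by rewrite xA in aA.
Qed.

Implicit Types (p : G) (A B : seq G).

(** * Ends of nonnegative charge *)

Definition caps e e' q := [&& is_end q, ~~ single q, rank q < rank e, adj q e & adj q e'].

(** By connectivity such a list contains every vertex. *)
Lemma closed_card s x : x \in s -> (forall a b, a \in s -> adj a b -> b \in s) -> #|G| <= size s.
Proof.
move=> xs h; have all_s y : y \in s.
  have /connectP[w pw ->] := conG.2 x y.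
  elim: w x xs pw => //= a w IH x xs /andP[xa pw]; apply: IH pw; exact: h xs xa.
rewrite cardE; apply: uniq_leq_size (enum_uniq G) _ => y _; exact: all_s.
Qed.

Lemma member_flip e A e' : member (e :: A ++ [:: e']) -> member (e' :: rev A ++ [:: e]).
Proof. by rewrite -member_rev rev_cons rev_cat /= -cats1. Qed.

Lemma mem_flip e A e' x : (x \in e' :: rev A ++ [:: e]) = (x \in e :: A ++ [:: e']).
Proof. by rewrite !inE !mem_cat mem_rev !mem_seq1; case: (x == e); case: (x == e'); case: (x \in A). Qed.

Lemma last_in e A e' : e' \in e :: A ++ [:: e'].
Proof. by rewrite inE mem_cat mem_head !orbT. Qed.

Lemma rank_member s x y : member s -> x \in s -> y \in s -> rank x = rank y.
Proof. by move=> Ms xs ys; apply: rank_same; apply: (path_of_eq Ms). Qed.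

Lemma ends_neq e A e' : member (e :: A ++ [:: e']) -> e != e'.
Proof.
move/(member_uniq) => /=/andP[h _]; apply: contraNneq h => ->.
by rewrite mem_cat mem_head orbT.
Qed.

Lemma caps_flip e A e' q : member (e :: A ++ [:: e']) -> caps e e' q -> caps e' e q.
Proof.
move=> Ms /and5P[h1 h2 h3 h4 h5]; apply/and5P; split=> //.
by rewrite -(rank_member Ms (mem_head _ _) (last_in _ _ _)).
Qed.

Lemma cappedP e A e' x : member (e :: A ++ [:: e']) -> x \in e :: A ++ [:: e'] ->
  reflect (exists q, caps e e' q) (capped x).
Proof.
move=> Ms xs; have rx := rank_member Ms xs (mem_head _ _).
have sz : 1 < size (path_of x) by rewrite (size_path_of_member Ms xs) /= size_cat addn1.
have hl : (head x (path_of x) = e /\ last x (path_of x) = e') \/ (head x (path_of x) = e' /\ last x (path_of x) = e).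
  case: (path_of_member Ms xs) => ->; first by left; rewrite /= last_cat.
  by right; rewrite rev_cons rev_cat /= last_rcons.
apply: (iffP existsP) => [[q /and5P[h1 h2 h3 h4 /andP[h5 _]]]|[q /and5P[h1 h2 h3 h4 h5]]]; exists q.
  by case: hl => [] [e1 e2]; apply/and5P; split; rewrite -?rx // -?e1 -?e2.
rewrite h1 h2 rx h3 sz /= andbT.
by case: hl => [] [-> ->]; rewrite h4 h5.
Qed.

Lemma capped_same e A e' x y : member (e :: A ++ [:: e']) -> x \in e :: A ++ [:: e'] ->
  y \in e :: A ++ [:: e'] -> capped x = capped y.
Proof. by move=> Ms xs ys; apply/(cappedP Ms xs)/(cappedP Ms ys). Qed.

Lemma gainE e A e' y : member (e :: A ++ [:: e']) -> y \in outer e -> is_end y -> rank y < rank e ->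
  gain y = (if single y then (if adj y e' then - 2%:Z else 0) else (if adj y e' then - 1 else 2))%R.
Proof.
move=> Ms ye Ey r; rewrite /gain Ey /toll.
rewrite (end_count_captive Ms Ey _ r); last by rewrite outer_sym.
by case: (single y); case: (adj y e').
Qed.

Lemma cat1_neq0 A e' : A ++ [:: e'] != [::].
Proof. by case: A. Qed.
Arguments cat1_neq0 {A e'}.

(** Each outer neighbour contributes 4, 2, 0 or -2 to the starting value -2. Two contributions are
    excluded together by [two_singles] and [single_both_ends], and the sum 0 is reached only as listed. *)
Lemma free_end_cases e A e' : member (e :: A ++ [:: e']) -> free_end e -> ~~ capped e ->
  exists a b, [/\ outer e = [:: a; b] \/ outer e = [:: b; a], a != b &
   [\/ (0 < charge e)%R,
       [/\ charge e = 0%R, single a, adj a e' & ~~ is_end b]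
     | [/\ charge e = 0%R, single a && ~~ adj a e', is_end b, ~~ single b && ~~ adj b e' & rank b < rank e]]].
Proof.
move=> Ms fe nc; have [a [b [h ab ef]]] := charge_free Ms cat1_neq0 fe.
have ae : a \in outer e by rewrite h mem_head.
have be : b \in outer e by rewrite h !inE eqxx orbT.
have key y : y \in outer e -> is_end y -> rank y < rank e /\ (~~ single y -> ~~ adj y e').
  move=> ye Ey; have r := allP fe y ye; rewrite Ey /= in r; split=> // ns.
  apply: contraNN nc => ad; apply/(cappedP Ms (mem_head _ _)); exists y; apply/and5P; split=> //.
  by rewrite adj_sym; apply: outer_adj ye.
have s2 v w : v \in outer e -> w \in outer e -> w != v -> single v -> adj v e' -> ~~ is_end w.
  by move=> ve we wv sv ad; apply/negP; apply: (single_both_ends Ms ve sv ad we wv).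
have ss : ~~ (single a && single b) by apply/negP => /andP[]; apply: (two_singles Ms ae be ab).
have ba : b != a by rewrite eq_sym.
have gE y : y \in outer e -> gain y = (if is_end y then (if single y then (if adj y e' then - 2%:Z else 0) else 2) else 4)%R.
  move=> ye; case Ey : (is_end y); last by rewrite /gain Ey.
  have [r1 r2] := key y ye Ey; rewrite (gainE Ms ye Ey r1).
  by case: (boolP (single y)) => // /r2/negPf->.
have sE y : single y -> is_end y := single_is_end (v := y).
rewrite !gE // in ef.
have [Ea|Na] := boolP (is_end a); have [Eb|Nb] := boolP (is_end b).
- have [ra _] := key a ae Ea; have [rb _] := key b be Eb.
  have na : single a -> ~~ adj a e' by move=> sa; apply/negP => /(s2 _ _ ae be ba sa); rewrite Eb.
  have nb : single b -> ~~ adj b e' by move=> sb; apply/negP => /(s2 _ _ be ae ab sb); rewrite Ea.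
  move: ef; rewrite Ea Eb; case: (boolP (single a)) ss => sa ss; case: (boolP (single b)) ss => //= sb _.
  + rewrite (negPf (na sa)) => ef; exists a, b; split; auto; constructor 3; split=> //.
    * by rewrite sa na.
    * by rewrite sb (key b be Eb).2.
  + rewrite (negPf (nb sb)) => ef; exists b, a; split; auto; constructor 3; split=> //.
    * by rewrite sb nb.
    * by rewrite sa (key a ae Ea).2.
  + by move=> ef; exists a, b; split; auto; constructor 1; rewrite ef.
- move: ef; rewrite Ea (negPf Nb); case: (boolP (single a)) => sa; last by move=> ef; exists a, b; split; auto; constructor 1; rewrite ef.
  case ad : (adj a e') => ef; exists a, b; (split; [by auto | by [] | ]); last by constructor 1; rewrite ef.
  by constructor 2; split=> //; rewrite ef.
- move: ef; rewrite Eb (negPf Na); case: (boolP (single b)) => sb; last by move=> ef; exists a, b; split; auto; constructor 1; rewrite ef.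
  case ad : (adj b e') => ef; exists b, a; (split; [by auto | by [] | ]); last by constructor 1; rewrite ef.
  by constructor 2; split=> //; rewrite ef.
- by move: ef; rewrite (negPf Na) (negPf Nb) => ef; exists a, b; split; auto; constructor 1; rewrite ef.
Qed.

Lemma charge_end_ge0 e A e' : member (e :: A ++ [:: e']) -> ~~ capped e -> (0 <= charge e)%R.
Proof.
move=> Ms nc; have [fe|nf] := boolP (free_end e).
  by have [a [b [_ _ []]]] := free_end_cases Ms fe nc; [move/Order.POrderTheory.ltW | case=> -> | case=> ->].
have [x [xe Ex r]] := not_free nf.
rewrite (charge_captive (is_end_head Ms) Ex _ xe r) //.
by rewrite (nonsingle Ms (mem_head _ _)).
Qed.

Lemma captive_ob q x y : is_end q -> is_end x -> ~~ single q -> x \in outer q -> rank q < rank x ->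
  y \in outer q -> rank y = rank x.
Proof.
by move=> Eq Ex nq xq r yq; apply: rank_same; apply: path_of_same; apply: (captive_nb Eq Ex nq xq r yq).
Qed.

(** * Capped paths *)

Section Cap.
Variables (p : G) (A : seq G) (p' q : G).
Hypothesis MP : member (p :: A ++ [:: p']).
Hypothesis cq : caps p p' q.

Lemma caps_outer : [/\ q \in outer p, q \in outer p', p \in outer q, p' \in outer q & free_end p].
Proof.
case/and5P: cq => Eq nq r qp qp'.
have qP : q \notin p :: A ++ [:: p'].
  by apply: contraTN r => qs; rewrite (rank_member MP qs (mem_head _ _)) ltnn.
have o1 : q \in outer p by apply: (outerI MP (mem_head _ _)); rewrite // adj_sym.
have o2 : q \in outer p' by apply: (outerI MP (last_in _ _ _)); rewrite // adj_sym.
split=> //; rewrite 1?outer_sym //.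
apply/negPn/negP => /(not_free)[x [xp Ex rx]].
have := captive_ob (is_end_head MP) Ex _ xp rx o1; rewrite (nonsingle MP (mem_head _ _)).
by move/(_ isT) => e; move: r; rewrite e ltnNge (ltnW rx).
Qed.

(** The cap pays -1, so the charge of p depends only on its second outer neighbour x. *)
Lemma caps_other : exists x, [/\ x \in outer p, x != q, forall y, y \in outer p -> y != q -> y = x,
  charge p = (- 3%:Z + gain x)%R & gain x = (if is_end x then (if single x then 0 else (if adj x p' then - 1 else 2)) else 4)%R].
Proof.
have [qp qp' pq pq' fp] := caps_outer; case/and5P: cq => Eq nq r aqp aqp'.
have [a [b [h ab ef]]] := charge_free MP cat1_neq0 fp.
have gq : gain q = (- 1)%R by rewrite (gainE MP qp Eq r) (negPf nq) aqp'.
have [x [xp xq ux ex]] : exists x, [/\ x \in outer p, x != q, forall y, y \in outer p -> y != q -> y = x & charge p = (- 3%:Z + gain x)%R].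
  move: qp; rewrite h !inE => /orP[]/eqP e.
    exists b; split; rewrite ?inE ?eqxx ?orbT // ?e 1?eq_sym //; last by rewrite ef -e gq; lia.
    by move=> y; rewrite !inE => /orP[]/eqP->; rewrite ?eqxx.
  exists a; split; rewrite ?inE ?eqxx ?orbT // ?e //; last by rewrite ef -e gq; lia.
  by move=> y; rewrite !inE => /orP[]/eqP->; rewrite ?eqxx.
exists x; split=> //; case Ex : (is_end x); last by rewrite /gain Ex.
have rx : rank x < rank p by have := allP fp x xp; rewrite Ex.
rewrite (gainE MP xp Ex rx); case: (boolP (single x)) => sx //; case ad : (adj x p') => //.
by case: (single_both_ends MP xp sx ad qp _ Eq); rewrite eq_sym.
Qed.

Lemma caps_charge_lb : (- 4%:Z <= charge p)%R.
Proof.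
have [x [_ _ _ -> ->]] := caps_other.
by case: (is_end x); case: (single x); case: (adj x p').
Qed.

End Cap.

Definition linked A B := has (fun u => has (adj u) B) A.

Lemma linkedP A B : reflect (exists u w, [/\ u \in A, w \in B & adj u w]) (linked A B).
Proof.
apply: (iffP hasP) => [[u uA /hasP[w wB uw]]|[u [w [uA wB uw]]]]; first by exists u, w.
by exists u => //; apply/hasP; exists w.
Qed.

Lemma size_le x y s t : member s -> member t -> x \in s -> y \in t -> rank x < rank y ->
  size s <= size t.
Proof.
by move=> Ms Mt xs yt r; rewrite -(size_path_of_member Ms xs) -(size_path_of_member Mt yt) rank_size // ltnW.
Qed.

Lemma caps_nb p A p' q B q' : member (p :: A ++ [:: p']) -> caps p p' q -> member (q :: B ++ [:: q']) ->
  forall y, adj q y -> y = head q (B ++ [:: q']) \/ y = p \/ y = p'.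
Proof.
move=> MP cq MQ; have [_ _ pq pq' _] := caps_outer MP cq.
exact: (end_neighbors MQ cat1_neq0 pq pq' (ends_neq MP)).
Qed.

(** Suppose that the interiors of P and Q are not linked, and let Z be the path of x. Then Z is shorter
    than Q by [open_cycle_long], there is an edge from Q to Z by [join_three], and the second vertex of Q
    is adjacent to p' by [open_cycle_two]. The exchanges [tri_long] and [tri_short] exclude what remains. *)
Lemma caps_other_linked p A p' q B q' x : member (p :: A ++ [:: p']) -> caps p p' q ->
  member (q :: B ++ [:: q']) ->
  x \in outer p -> x != q -> is_end x -> x \notin q :: B ++ [:: q'] -> linked A B.
Proof.
move=> MP cq MQ xp xq Ex xQ; apply/negPn/negP => /linkedP nl.
have nII u w : u \in A -> w \in B -> adj u w -> False by move=> uA wB uw; apply: nl; exists u, w.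
have [qp qp' pq pq' fp] := caps_outer MP cq.
have Nq := caps_nb MP cq MQ.
case/and5P: (cq) => Eq nq rq aqp aqp'.
have qx : q != x by rewrite eq_sym.
have Np := end_neighbors MP cat1_neq0 qp xp qx.
have [Z MZ] := end_member Ex.
have rx : rank x < rank p by have := allP fp x xp; rewrite Ex.
have xP := outer_notin MP (mem_head _ _) xp.
have qP := outer_notin MP (mem_head _ _) qp.
have U : uniq ((p :: A ++ [:: p']) ++ (q :: B ++ [:: q']) ++ x :: Z).
  apply: uniq_cat3; [exact: (uniq_membersC MP MQ (mem_head _ _) qP) | exact: (uniq_membersC MP MZ (mem_head _ _) xP)
   | exact: (uniq_membersC MQ MZ (mem_head _ _) xQ)].
have hA : head p (A ++ [:: p']) \in A ++ [:: p'] := head_mem _ cat1_neq0.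
have szQ : size (q :: B ++ [:: q']) <= size A + 2.
  by have := size_le MQ MP (mem_head _ _) (mem_head _ _) rq; rewrite /= !size_cat /=; clear; lia.
have szZ : size (x :: Z) <= size A + 2.
  by have := size_le MZ MP (mem_head _ _) (mem_head _ _) rx; rewrite /= !size_cat /=; clear; lia.
have p'q : adj p' q by rewrite adj_sym.
have px := outer_adj xp.
(* Z is the part of the path of x. *)
have short : size (x :: Z) < size (q :: B ++ [:: q']).
  rewrite ltnNge; apply/negP => h.
  exact: (open_cycle_long MP MQ MZ U p'q px Np hA Nq (head_mem _ cat1_neq0) h).
have [a [b [aQ bZ ab]]] : exists a b, [/\ a \in q :: B ++ [:: q'], b \in x :: Z & adj a b].
  apply/linkedP/negPn/negP => /linkedP h.
  apply: (join_three MP MQ MZ U cat1_neq0 _ px) => [|y|a b aQ bZ ab]; first by rewrite adj_sym.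
    by case/Np => [->|]; [left; case: (A) | auto].
  by apply: h; exists a, b.
have nQx : adj q x = false.
  apply/negbTE/negP => /Nq[|[|]] e.
  - by move: xQ; rewrite e inE head_mem ?orbT // cat1_neq0.
  - by move: xP; rewrite e mem_head.
  - by move: xP; rewrite e last_in.
have Eq' : is_end q' := @is_end_last q' (q :: B) MQ.
have single_case : Z = [::] -> adj q' x -> (forall u, u \in B -> adj u x -> False) -> False.
  move=> Z0 q'x HB; have sx : single x by rewrite single_member -Z0.
  have xq' : q' \in outer x.
    by rewrite outer_sym; apply: (outerI MQ (last_in _ _ _)).
  have [_ [u [ux uq uq']]] := single_end sx Eq' xq'.
  move: uq; rewrite (mem_path_of_member _ MQ (last_in _ _ _)) inE mem_cat mem_seq1 (negPf uq') orbF.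
  have xu := outer_adj ux; rewrite adj_sym in xu.
  by case/orP => [/eqP e|/HB/(_ xu)//]; rewrite e nQx in xu.
case: B MQ nII Nq xQ U szQ short aQ nl single_case => [|b0 B] MQ nII Nq xQ U szQ short aQ nl sc.
  have Z0 : Z = [::] by case: (Z) short.
  move: bZ aQ; rewrite Z0 /= !inE => /eqP eb /orP[]/eqP ea; subst; first by rewrite nQx in ab.
  by apply: sc.
have [w [wA wb]] : exists w, w \in A ++ [:: p'] /\ adj w b0.
  have [/hasP[w wA wb]|nh] := boolP (has (fun w => adj w b0) (A ++ [:: p'])); first by exists w.
  case: (open_cycle_two MP MQ MZ U p'q px Np hA Nq szQ szZ) => w wA wb.
  by case/hasP: nh; exists w.
have p'b : adj p' b0.
  move: wA; rewrite mem_cat mem_seq1 => /orP[wA|/eqP<-//].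
  by case: (nII w b0 wA (mem_head _ _) wb).
have b0P : b0 \notin p :: A ++ [:: p'].
  by move: U; rewrite cat_uniq => /and3P[_ /hasPn h _]; apply: h; rewrite !inE eqxx ?orbT.
have bp' : b0 \in outer p' := outerI MP (last_in _ _ _) p'b b0P.
have qb : q != b0 by have := member_uniq MQ; rewrite /= inE => /andP[/norP[]].
have Np' := end_neighbors (member_flip MP) cat1_neq0 bp' qp' (negbT (esym (etrans (esym (negPf qb)) (eq_sym _ _)))).
have bA u : u \in A -> adj u b0 -> False by move=> uA; apply: nII (uA) (mem_head _ _).
case: B MQ nII Nq xQ U szQ short aQ nl sc => [|b1 B] MQ nII Nq xQ U szQ short aQ nl sc; last first.
  have Np'' y : adj p' y -> y = b0 \/ y = q \/ y \in p :: A.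
    case/Np' => [->|[]]; auto.
    by right; right; have := head_mem p' (@cat1_neq0 (rev A) p); rewrite mem_cat mem_rev mem_seq1 inE => /orP[]->; rewrite ?orbT.
  have pq0 : adj p q by rewrite adj_sym.
  exact: (@tri_long p A p' q b0 (b1 :: B) q' x Z _ MP MQ MZ U isT p'b pq0 px Np hA Nq Np'' nII szQ szZ).
case: Z MZ U szZ short bZ sc => [|z2 Z] MZ U szZ short bZ sc; last first.
  have pq0 : adj p q by rewrite adj_sym.
  exact: (tri_short MP MQ MZ U p'b pq0 px Np hA Nq bA).
have b0q : adj b0 q by rewrite adj_sym (head_adj MQ).
have b0q' : adj b0 q' by have := member_chordless MQ => /= /andP[_ /andP[/andP[]]].
(* Now Q = q b0 q' and Z = x, and the edge from Q to x can only leave from q'. *)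
have nb0 : adj b0 x -> False.
  have b0p' : adj b0 p' by rewrite adj_sym.
  have ub : uniq [:: q; q'; p'].
    have out y : y \in [:: q; b0; q'] -> y != p'.
      move=> yQ; apply/eqP => e; have : y \notin p :: A ++ [:: p'].
        by move: U; rewrite cat_uniq => /and3P[_ /hasPn h2 _]; apply: h2; rewrite mem_cat yQ.
      by rewrite e last_in.
    have := member_uniq MQ; rewrite /= !inE => /andP[/norP[_ h1] _].
    by rewrite negb_or h1 !out // !inE eqxx ?orbT.
  case/(neighborsP b0q b0q' b0p' ub) => [e|[e|e]].
  - by move: xQ; rewrite e mem_head.
  - by move: xQ; rewrite e !inE eqxx !orbT.
  - by move: xP; rewrite e last_in.
move: bZ aQ; rewrite /= !inE => /eqP eb /or3P[]/eqP ea; subst; first by rewrite nQx in ab.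
  exact: nb0.
by apply: sc => // u; rewrite inE => /eqP->.
Qed.
Lemma captive_uncapped q B q' x : member (q :: B ++ [:: q']) -> x \in outer q -> is_end x ->
  rank q < rank x ->
  ~~ capped q.
Proof.
move=> MQ xq Ex r; apply/negP => /(cappedP MQ (mem_head _ _))[z cz].
have [zq _ _ _ _] := caps_outer MQ cz.
have := captive_ob (is_end_head MQ) Ex _ xq r zq.
rewrite (nonsingle MQ (mem_head _ _)) => /(_ isT) e.
by case/and5P: cz => _ _; rewrite e ltnNge (ltnW r).
Qed.

Lemma cap_uncapped p A p' q B q' : member (p :: A ++ [:: p']) -> caps p p' q ->
  member (q :: B ++ [:: q']) ->
  forall y, y \in q :: B ++ [:: q'] -> ~~ capped y.
Proof.
move=> MP cq MQ y yQ; rewrite (capped_same MQ yQ (mem_head _ _)).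
have [_ _ pq _ _] := caps_outer MP cq; case/and5P: cq => _ _ r _ _.
exact: (captive_uncapped MQ pq (is_end_head MP) r).
Qed.

Lemma caps_disj p A p' q B q' : member (p :: A ++ [:: p']) -> caps p p' q ->
  member (q :: B ++ [:: q']) ->
  uniq ((p :: A ++ [:: p']) ++ (q :: B ++ [:: q'])).
Proof.
move=> MP cq MQ; have [qp _ _ _ _] := caps_outer MP cq.
exact: (uniq_membersC MP MQ (mem_head _ _) (outer_notin MP (mem_head _ _) qp)).
Qed.

Lemma uniq_cat_out (s t : seq G) x : uniq (s ++ t) -> x \in s -> x \in t -> False.
Proof. by rewrite cat_uniq => /and3P[_ /hasPn h _] xs /h /=; rewrite xs. Qed.

Lemma caps_size p A p' q B q' : member (p :: A ++ [:: p']) -> caps p p' q ->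
  member (q :: B ++ [:: q']) ->
  size B <= size A.
Proof.
move=> MP cq MQ; case/and5P: cq => _ _ r _ _.
have := size_le MQ MP (mem_head _ _) (mem_head _ _) r.
by rewrite /= !size_cat /= !addn1 !ltnS.
Qed.

(** Without a link between the interiors, [caps_other_linked] shows that the second outer neighbour of p,
    if it is an end, is q', and likewise for p'. Both occur together only if Q has two vertices, by
    [cross]. *)
Lemma caps_cases p A p' q B q' : member (p :: A ++ [:: p']) -> caps p p' q ->
  member (q :: B ++ [:: q']) ->
  [\/ charge p = 1%R /\ charge p' = 1%R, linked A B,
    ~~ linked A B /\ (
    [/\ q' \in outer p, ~~ adj q' p', charge p = (- 1)%R, charge p' = 1%R &
        forall y, y \in outer p' -> y != q -> ~~ is_end y] \/
    [/\ q' \in outer p', ~~ adj q' p, charge p' = (- 1)%R, charge p = 1%R &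
        forall y, y \in outer p -> y != q -> ~~ is_end y])
  | [/\ B = [::], q' \in outer p & q' \in outer p']].
Proof.
move=> MP cq MQ.
have [lAB|nl] := boolP (linked A B); first by constructor 2.
have MP' := member_flip MP; have cq' := caps_flip MP cq.
have [x [xp xq ux fx gx]] := caps_other MP cq.
have [x' [xp' xq' ux' fx' gx']] := caps_other MP' cq'.
have U := caps_disj MP cq MQ.
have isq y : y \in q :: B ++ [:: q'] -> is_end y -> y != q -> y = q'.
  by move=> yQ; rewrite (is_endE MQ yQ) => /orP[] /eqP-> //; rewrite eqxx.
have Ex : is_end x -> x = q'.
  move=> Ex; have [xQ|xQ] := boolP (x \in q :: B ++ [:: q']); first exact: isq.
  by move: nl; rewrite (caps_other_linked MP cq MQ xp xq Ex xQ).
have Ex' : is_end x' -> x' = q'.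
  move=> Ex'; have [xQ|xQ] := boolP (x' \in q :: B ++ [:: q']); first exact: isq.
  have := caps_other_linked MP' cq' MQ xp' xq' Ex' xQ.
  case/linkedP => u [w [uA wB uw]]; case/negP: nl; apply/linkedP; exists u, w.
  by rewrite mem_rev in uA.
have nsq : single q' = false := nonsingle MQ (last_in _ _ _).
have Eq' : is_end q' := @is_end_last q' (q :: B) MQ.
have nqq : q' != q by rewrite eq_sym (ends_neq MQ).
case: (boolP (is_end x)) => hx; case: (boolP (is_end x')) => hx'.
- have e := Ex hx; have e' := Ex' hx'; subst x x'.
  case: (B =P [::]) => [B0|/eqP nB]; first by constructor 4.
  have sz := caps_size MP cq MQ.
  have nA : A != [::] by rewrite -size_eq0 -lt0n (leq_trans _ sz) // lt0n size_eq0.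
  case/and5P: (cq) => _ _ _ aqp aqp'.
  have Nq := caps_nb MP cq MQ.
  case: (cross MP MQ U nA nB _ (outer_adj xp) _ sz); first by rewrite adj_sym.
  move=> u w; rewrite mem_cat mem_seq1 inE => /orP[uA|/eqP->] /orP[/eqP->|wB] uw //.
  + rewrite adj_sym in uw; exfalso; case: (Nq _ uw) => [|[]] eu.
    * apply: (uniq_cat_out U (x := u)); first by rewrite inE mem_cat uA orbT.
      by rewrite eu inE head_mem ?orbT // cat1_neq0.
    * by have := member_uniq MP; rewrite /= mem_cat -eu uA.
    * by have := member_uniq MP; rewrite /= cat_uniq /= -eu uA !andbF.
  + by case/negP: nl; apply/linkedP; exists u, w.
  + exfalso; have wp' : w \in outer p'.
      apply: (outerI MP (last_in _ _ _) uw); apply/negP => wP.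
      by apply: (uniq_cat_out U wP); rewrite inE mem_cat wB orbT.
    have uQ := member_uniq MQ.
    have wq : w != q by apply: contraTneq wB => ->; move: uQ => /=; rewrite mem_cat negb_or => /andP[/andP[]].
    by move: wB uQ; rewrite (ux' w wp' wq) /= cat_uniq /= => ->; rewrite !andbF.
- have e := Ex hx; subst x; constructor 3; split=> //; left; split=> //.
  + apply/negP => ad; case/negP: hx'; rewrite -(ux' q') //.
    apply: (outerI MP (last_in _ _ _)); first by rewrite adj_sym.
    exact: (outer_notin MP (mem_head _ _) xp).
  + rewrite fx gx hx nsq; case: (boolP (adj q' p')) => // ad; case/negP: hx'; rewrite -(ux' q') //.
    apply: (outerI MP (last_in _ _ _)); first by rewrite adj_sym.
    exact: (outer_notin MP (mem_head _ _) xp).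
  + by rewrite fx' gx' (negPf hx').
  + by move=> y yp yq; rewrite (ux' y yp yq).
- have e := Ex' hx'; subst x'; constructor 3; split=> //; right; split=> //.
  + apply/negP => ad; case/negP: hx; rewrite -(ux q') //.
    apply: (outerI MP (mem_head _ _)); first by rewrite adj_sym.
    exact: (outer_notin MP (last_in _ _ _) xp').
  + rewrite fx' gx' hx' nsq; case: (boolP (adj q' p)) => // ad; case/negP: hx; rewrite -(ux q') //.
    apply: (outerI MP (mem_head _ _)); first by rewrite adj_sym.
    exact: (outer_notin MP (last_in _ _ _) xp').
  + by rewrite fx gx (negPf hx).
  + by move=> y yp yq; rewrite (ux y yp yq).
- by constructor 1; rewrite fx gx fx' gx' (negPf hx) (negPf hx').
Qed.

Lemma sum_int e A e' : member (e :: A ++ [:: e']) -> (0 <= \sum_(x <- A) charge x)%R.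
Proof.
move=> Ms; rewrite big_seq; apply: Num.Theory.sumr_ge0 => x xA.
exact: (charge_interior_ge0 (is_end_interior Ms xA)).
Qed.

Lemma sum_int1 e A e' u : member (e :: A ++ [:: e']) -> u \in A ->
  (charge u <= \sum_(x <- A) charge x)%R.
Proof.
move=> Ms uA; rewrite (big_rem u uA) /= Num.Theory.lerDl big_seq.
apply: Num.Theory.sumr_ge0 => x /mem_rem xA.
exact: (charge_interior_ge0 (is_end_interior Ms xA)).
Qed.

Lemma sum_int2 e A e' u w : member (e :: A ++ [:: e']) -> u \in A -> w \in A -> u != w ->
  (charge u + charge w <= \sum_(x <- A) charge x)%R.
Proof.
move=> Ms uA wA uw; rewrite (big_rem u uA) /= Num.Theory.lerD2l.
have uA' : uniq A by have := member_uniq Ms; rewrite /= cat_uniq => /andP[_ /andP[]].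
have wA' : w \in rem u A by rewrite (mem_rem_uniq _ uA') !inE eq_sym uw.
rewrite (big_rem w wA') /= Num.Theory.lerDl big_seq.
apply: Num.Theory.sumr_ge0 => x /mem_rem /mem_rem xA.
exact: (charge_interior_ge0 (is_end_interior Ms xA)).
Qed.

Lemma charge_linked p A p' q B q' u w : member (p :: A ++ [:: p']) -> caps p p' q ->
  member (q :: B ++ [:: q']) ->
  u \in A -> w \in B -> adj u w -> charge u = 8%R.
Proof.
move=> MP cq MQ uA wB uw; have U := caps_disj MP cq MQ.
have uP : u \in p :: A ++ [:: p'] by rewrite inE mem_cat uA orbT.
have wQ : w \in q :: B ++ [:: q'] by rewrite inE mem_cat wB orbT.
have wu : w \in outer u.
  by apply: (outerI MP uP uw); apply/negP => wP; apply: (uniq_cat_out U wP).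
rewrite (charge_interior (is_end_interior MP uA) wu) (negPf (is_end_interior MQ wB)).
rewrite (negPf (cap_uncapped MP cq MQ wQ)); have -> // : capped u.
by apply/(cappedP MP uP); exists q.
Qed.
Lemma interior_neighbors s1 l x r s2 y : member (s1 ++ l :: x :: r :: s2) -> y \in outer x ->
  forall z, adj x z -> z = l \/ z = r \/ z = y.
Proof.
move=> Ms yx; have us := member_uniq Ms; have cs := member_chordless Ms.
have xs : x \in s1 ++ l :: x :: r :: s2 by rewrite mem_cat !inE eqxx !orbT.
have cs' := chordless_catr cs.
have xl : adj x l by rewrite adj_sym; case/andP: cs' => /andP[].
have xr : adj x r by move: cs' => /= /andP[_ /andP[/andP[]]].
have yo := outer_notin Ms xs yx.
apply: (neighborsP xl xr (outer_adj yx)).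
move: us yo; rewrite cat_uniq mem_cat /= !inE !negb_or => /and3P[_ _ /and3P[/and3P[_ lr _] _ _]].
by case/and5P => _ yl _ yr _; rewrite lr [l == y]eq_sym yl [r == y]eq_sym yr.
Qed.

(** * Caps with two vertices, both adjacent to both ends *)

Section Hub.
Variables (p : G) (A : seq G) (p' q q' : G).
Hypothesis MP : member (p :: A ++ [:: p']).
Hypothesis MQ : member ([:: q; q']).
Hypothesis cq : caps p p' q.
Hypothesis hq : q' \in outer p.
Hypothesis hq' : q' \in outer p'.

Lemma hub_neighbors : [/\ forall y, adj p y -> y = head p (A ++ [:: p']) \/ y = q \/ y = q',
   forall y, adj p' y -> y = head p' (rev A ++ [:: p]) \/ y = q \/ y = q',
   forall y, adj q y -> y = q' \/ y = p \/ y = p' &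
   forall y, adj q' y -> y = q \/ y = p \/ y = p'].
Proof.
have MQ' : member (q :: [::] ++ [:: q']) by [].
have [qp qp' pq pq' _] := caps_outer MP cq.
have qq : q != q' := ends_neq MQ'.
have pp := ends_neq MP.
have o1 : p \in outer q' by rewrite outer_sym.
have o2 : p' \in outer q' by rewrite outer_sym.
split.
- exact: (end_neighbors MP cat1_neq0 qp hq qq).
- exact: (end_neighbors (member_flip MP) cat1_neq0 qp' hq' qq).
- exact: (end_neighbors MQ' cat1_neq0 pq pq' pp).
- exact: (end_neighbors (member_flip MQ') cat1_neq0 o1 o2 pp).
Qed.

Lemma hub_notin a y : a \in A -> y \in outer a -> y \notin [:: q; q'].
Proof.
move=> aA ya; have [_ _ Nq Nq'] := hub_neighbors.
have U := caps_disj MP cq (MQ : member (q :: [::] ++ [:: q'])).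
have interior_in : a \in p :: A ++ [:: p'] by rewrite inE mem_cat aA orbT.
have aQ : a \notin [:: q; q'] by apply/negP => /(uniq_cat_out U interior_in).
have ya' := outer_adj ya; rewrite adj_sym in ya'.
have uP := member_uniq MP.
apply/negP; rewrite !inE => /orP[]/eqP e; subst y.
- case: (Nq _ ya') => [e|[e|e]]; subst a; first by rewrite !inE eqxx orbT in aQ.
    by move: uP; rewrite /= mem_cat aA.
  by move: uP; rewrite /= cat_uniq /= aA !andbF.
- case: (Nq' _ ya') => [e|[e|e]]; subst a; first by rewrite !inE eqxx in aQ.
    by move: uP; rewrite /= mem_cat aA.
  by move: uP; rewrite /= cat_uniq /= aA !andbF.
Qed.

Lemma caps_capped x : x \in p :: A ++ [:: p'] -> capped x.
Proof. by move=> xP; apply/(cappedP MP xP); exists q. Qed.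

End Hub.

(** By [hub_merge]. *)
Lemma hub_outer_interior p a A p' q q' y : member (p :: a :: A ++ [:: p']) -> member [:: q; q'] ->
  caps p p' q ->
  q' \in outer p -> q' \in outer p' -> y \in outer a -> ~~ is_end y.
Proof.
move=> MP MQ cq hq hq' ya; apply/negP => Ey.
have MP0 : member (p :: (a :: A) ++ [:: p']) by [].
have [Np Np' Nq Nq'] := hub_neighbors MP0 MQ cq hq hq'.
have [Y MY] := end_member Ey.
have interior_in : a \in p :: a :: A ++ [:: p'] by rewrite !inE eqxx orbT.
have yP := outer_notin MP interior_in ya.
have yQ := hub_notin MP0 MQ cq hq hq' (mem_head a A) ya.
have [qp _ _ _ _] := caps_outer MP0 cq.
have U : uniq ((p :: a :: A ++ [:: p']) ++ [:: q; q'] ++ y :: Y).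
  apply: uniq_cat3; [exact: (caps_disj MP0 cq (MQ : member (q :: [::] ++ [:: q'])))
  | exact: (uniq_membersC MP MY (mem_head _ _) yP) | exact: (uniq_membersC MQ MY (mem_head _ _) yQ)].
have hA : head a (A ++ [:: p']) \in A ++ [:: p'] := head_mem _ cat1_neq0.
have MP1 : member ([::] ++ p :: a :: head a (A ++ [:: p']) :: behead (A ++ [:: p'])).
  by move: MP; rewrite /=; case: (A).
apply: (hub_merge MP MQ MY U (outer_adj qp) (outer_adj hq') (outer_adj ya) Np Nq Nq' (interior_neighbors MP1 ya) hA).
Qed.

Lemma capped_interior_ge4 x y : ~~ is_end x -> capped x -> y \in outer x -> ~~ is_end y ->
  (4 <= charge x)%R.
Proof.
by move=> nx cx yx ny; rewrite (charge_interior nx yx) (negPf ny) cx; case: (capped y).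
Qed.

Lemma interior_split x : ~~ is_end x -> exists Y1 r Y2 y', member (Y1 ++ r :: x :: Y2 ++ [:: y']).
Proof.
case/(interior_member) => s1 [l [r [s2 Ms]]]; exists s1, l.
have [Y2 [y' e]] : exists Y2 y', r :: s2 = Y2 ++ [:: y'].
  by exists (belast r s2), (last r s2); rewrite cats1 -lastI.
by exists Y2, y'; rewrite -e.
Qed.

(** By [small_hub], applied to the cap of the path of y. *)
Lemma hub_single_uncapped p a p' q q' y : member [:: p; a; p'] -> member [:: q; q'] -> caps p p' q ->
  q' \in outer p -> q' \in outer p' -> y \in outer a -> ~~ capped y.
Proof.
move=> MP MQ cq hq hq' ya; apply/negP => cy.
have MP0 : member (p :: [:: a] ++ [:: p']) by [].
have ny : ~~ is_end y := hub_outer_interior (A := [::]) MP MQ cq hq hq' ya.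
have [Np Np' Nq Nq'] := hub_neighbors MP0 MQ cq hq hq'.
have yP := outer_notin MP (_ : a \in [:: p; a; p']) ya.
have {}yP : y \notin [:: p; a; p'] by apply: yP; rewrite !inE eqxx orbT.
have yQ := hub_notin MP0 MQ cq hq hq' (mem_head a [::]) ya.
have [qp qp' _ _ _] := caps_outer MP0 cq.
have [Y1 [r [Y2 [y' MY]]]] := interior_split ny.
have [y0 [B eB]] : exists y0 B, Y1 ++ r :: y :: Y2 ++ [:: y'] = y0 :: B ++ [:: y'] /\ y0 = head r Y1.
  case: (Y1) => [|y0 T]; first by exists r, (y :: Y2).
  by exists y0, (T ++ r :: y :: Y2); rewrite /= -catA.
case: eB => eB es0.
have yY : y \in y0 :: B ++ [:: y'] by rewrite -eB mem_cat !inE eqxx !orbT.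
have MY' := MY; rewrite eB in MY'.
have [e ce] := elimT (cappedP MY' yY) cy.
have [eo1 eo2 _ _ _] := caps_outer MY' ce.
case/and5P: (ce) => Ee nse re ees ey'.
have [E0 [e' ME]] := nonsingle_member Ee nse.
have [e2 [E eE]] : exists e2 E, E0 ++ [:: e'] = e2 :: E.
  by case: (E0) => [|e2 T]; [exists e', [::] | exists e2, (T ++ [:: e'])].
rewrite eE in ME.
have oP z : z \in y0 :: B ++ [:: y'] -> z \notin [:: p; a; p'].
  by move=> zY; apply: contraNN yP => zP; rewrite -(mem_path_of_member _ MP zP) (mem_path_of_member _ MY' zY).
have oQ z : z \in y0 :: B ++ [:: y'] -> z \notin [:: q; q'].
  by move=> zY; apply: contraNN yQ => zP; rewrite -(mem_path_of_member _ MQ zP) (mem_path_of_member _ MY' zY).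
have y'Y := last_in y0 B y'.
have eP : e \notin [:: p; a; p'].
  apply/negP => eP; move: (oP _ y'Y) (oQ _ y'Y); rewrite !inE => h1 h2.
  have := is_endE MP0 eP; rewrite Ee => /esym /orP[]/eqP ee; subst e.
    by case: (Np _ ey') => [|[]] ez; move: h1 h2; rewrite ez /= eqxx ?orbT.
  by case: (Np' _ ey') => [|[]] ez; move: h1 h2; rewrite ez /= eqxx ?orbT.
have eQ : e \notin [:: q; q'].
  apply/negP => eQ; move: (oP _ y'Y) (oQ _ y'Y); rewrite !inE => h1 h2.
  move: eQ; rewrite !inE => /orP[]/eqP ee; subst e.
    by case: (Nq _ ey') => [|[]] ez; move: h1 h2; rewrite ez /= eqxx ?orbT.
  by case: (Nq' _ ey') => [|[]] ez; move: h1 h2; rewrite ez /= eqxx ?orbT.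
have U : uniq ([:: p; a; p'] ++ [:: q; q'] ++ (Y1 ++ r :: y :: Y2 ++ [:: y']) ++ e :: e2 :: E).
  rewrite eB; apply: uniq_cat4.
  - exact: (caps_disj MP0 cq (MQ : member (q :: [::] ++ [:: q']))).
  - exact: (uniq_membersC MP MY' yY yP).
  - exact: (uniq_membersC MP ME (mem_head _ _) eP).
  - apply: uniq_cat3.
    + exact: (uniq_membersC MQ MY' yY yQ).
    + exact: (uniq_membersC MQ ME (mem_head _ _) eQ).
    + exact: (uniq_membersC MY' ME (mem_head _ _) (outer_notin MY' (mem_head _ _) eo1)).
have ay : a \in outer y by rewrite outer_sym.
have hY : head y (Y2 ++ [:: y']) \in Y2 ++ [:: y'] := head_mem _ cat1_neq0.
have MY1 : member (Y1 ++ r :: y :: head y (Y2 ++ [:: y']) :: behead (Y2 ++ [:: y'])).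
  by move: MY; case: (Y2).
have ME' : member (e :: E0 ++ [:: e']) by rewrite eE.
apply: (small_hub MP MQ MY ME U (outer_adj qp) (outer_adj hq') (outer_adj ya) ey' _ Np Nq _ (interior_neighbors MY1 ay) hY).
- by rewrite -es0.
- exact: (interior_neighbors (s1 := [::]) MP ya).
- by move=> z /(caps_nb MY' ce ME'); rewrite -es0 eE.
- rewrite eB; exact: (size_le ME MY' (mem_head _ _) (mem_head _ _) re).
Qed.

Lemma hub_first p a A p' q q' : member (p :: (a :: A) ++ [:: p']) -> member [:: q; q'] -> caps p p' q ->
  q' \in outer p -> q' \in outer p' -> (4 <= charge a)%R.
Proof.
move=> MP MQ cq hq hq'; have na := is_end_interior MP (mem_head a A).
have [w ow] := outer_interior na; have wa : w \in outer a by rewrite ow mem_head.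
apply: (capped_interior_ge4 na _ wa (hub_outer_interior MP MQ cq hq hq' wa)).
by apply: (caps_capped MP cq); rewrite !inE eqxx orbT.
Qed.

(** The pair q q' may leave charge -8 at the two ends of P. The first and the last interior vertex make
    up for it: neither pays to an end, by [hub_outer_interior], and if they coincide that vertex even
    receives 4 from an uncapped path, by [hub_single_uncapped]. Without interior vertices the four
    vertices would form a component. *)
Lemma hub_charge p A p' q q' : 4 < #|G| -> member (p :: A ++ [:: p']) -> member [:: q; q'] ->
  caps p p' q ->
  q' \in outer p -> q' \in outer p' -> (8 <= \sum_(x <- A) charge x)%R.
Proof.
move=> n4 MP MQ cq hq hq'; have [Np Np' Nq Nq'] := hub_neighbors MP MQ cq hq hq'.
have EA x : x \in A -> ~~ is_end x by apply: is_end_interior MP.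
have cA x : x \in A -> capped x by move=> xA; apply: (caps_capped MP cq); rewrite inE mem_cat xA orbT.
have cq' := caps_flip MP cq.
case: A MP cq hq hq' Np Np' EA cA cq' => [|a A] MP cq hq hq' Np Np' EA cA cq'.
  have := @closed_card [:: p; p'; q; q'] p (mem_head _ _).
  move=> h; have : #|G| <= 4; last by rewrite leqNgt n4.
  apply: h => x y; rewrite !inE => /or4P[]/eqP->.
  - by move/Np => [->|[]->]; rewrite /= eqxx ?orbT.
  - by move/Np' => [->|[]->]; rewrite /= eqxx ?orbT.
  - by move/Nq => [->|[]->]; rewrite /= eqxx ?orbT.
  - by move/Nq' => [->|[]->]; rewrite /= eqxx ?orbT.
have fa := hub_first MP MQ cq hq hq'.
case/lastP: A MP cq hq hq' Np Np' EA cA cq' fa => [|A z] MP cq hq hq' Np Np' EA cA cq' fa.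
  have na := EA a (mem_head _ _); have [w ow] := outer_interior na.
  have wa : w \in outer a by rewrite ow mem_head.
  rewrite big_seq1 (charge_interior na wa) (cA a (mem_head _ _)).
  by rewrite (negPf (hub_outer_interior (A := [::]) MP MQ cq hq hq' wa)) (negPf (hub_single_uncapped MP MQ cq hq hq' wa)).
have zA : z \in a :: rcons A z by rewrite inE mem_rcons mem_head orbT.
have az : a != z.
  by have := member_uniq MP; rewrite /= mem_cat mem_rcons inE !negb_or => /and3P[_ /andP[/andP[]]].
have fz : (4 <= charge z)%R.
  have := member_flip MP; rewrite rev_cons rev_rcons /= => MF.
  exact: (hub_first MF MQ cq' hq' hq).
apply: Order.POrderTheory.le_trans (sum_int2 MP (mem_head _ _) zA az).
by move: fa fz; clear; lia.
Qed.

(** If y is not the only interior vertex, the first or the last one differs from y. *)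
Lemma hub_other p A p' q q' y : member (p :: A ++ [:: p']) -> member [:: q; q'] -> caps p p' q ->
  q' \in outer p -> q' \in outer p' -> y \in A -> A = [:: y] \/
  exists x, [/\ x \in A, x != y & (4 <= charge x)%R].
Proof.
move=> MP MQ cq hq hq'; case: A MP cq => [//|a A] MP cq yA.
have fa := hub_first MP MQ cq hq hq'.
have [ay|ay] := eqVneq a y; last by right; exists a; rewrite mem_head.
subst y; case/lastP: A MP cq yA => [|A z] MP cq yA; [by left | right; exists z].
split; first by rewrite inE mem_rcons mem_head orbT.
  apply: contraTneq (member_uniq MP) => ->.
  by rewrite /= [in _ && uniq _]mem_cat mem_rcons mem_head andbF.
have := member_flip MP; rewrite rev_cons rev_rcons /= => MF.
exact: (hub_first MF MQ (caps_flip MP cq) hq' hq).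
Qed.

Lemma caps_member p A p' q : member (p :: A ++ [:: p']) -> caps p p' q ->
  exists B q', member (q :: B ++ [:: q']).
Proof. by move=> _ /and5P[Eq nq _ _ _]; apply: (nonsingle_member Eq nq). Qed.

(** * At most a third of the vertices *)

(** On an uncapped path every vertex has nonnegative charge. On a capped path the cases of [caps_cases]
    give 1 + 1, a link worth 8 against at most -8 at the ends, -1 + 1, or [hub_charge]. *)
Lemma balance_ge0 s : 4 < #|G| -> member s -> (0 <= balance s)%R.
Proof.
move=> n4 Ms; case: (member_cases Ms) => [[v [-> sv]]|[e [A [e' es]]]].
  by rewrite /balance big_seq1 (charge_single sv); case: eqP.
subst s; rewrite balance_split.
have [/(cappedP Ms (mem_head _ _))[q cq]|nc] := boolP (capped e); last first.
  have f1 := charge_end_ge0 Ms nc.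
  have f2 : (0 <= charge e')%R.
    apply: (charge_end_ge0 (member_flip Ms)); apply: contraNN nc.
    by rewrite (capped_same Ms (last_in _ _ _) (mem_head _ _)).
  have := sum_int Ms; move: f1 f2; move: (charge e) (charge e') (\sum_(x <- A) charge x)%R; clear; lia.
have sA := sum_int Ms.
have [B [q' MQ]] := caps_member Ms cq.
case: (caps_cases Ms cq MQ) => [[-> ->]|/linkedP[u [w [uA wB uw]]]|[_ [[_ _ -> -> _]|[_ _ -> -> _]]]|[eB h1 h2]].
- by move: sA; move: (\sum_(x <- A) charge x)%R; clear; lia.
- have := sum_int1 Ms uA; rewrite (charge_linked Ms cq MQ uA wB uw).
  have := caps_charge_lb Ms cq; have := caps_charge_lb (member_flip Ms) (caps_flip Ms cq).
  move: (charge e) (charge e') (\sum_(x <- A) charge x)%R; clear; lia.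
- by move: sA; move: (\sum_(x <- A) charge x)%R; clear; lia.
- by move: sA; move: (\sum_(x <- A) charge x)%R; clear; lia.
- subst B; have := hub_charge n4 Ms MQ cq h1 h2.
  have := caps_charge_lb Ms cq; have := caps_charge_lb (member_flip Ms) (caps_flip Ms cq).
  move: (charge e) (charge e') (\sum_(x <- A) charge x)%R; clear; lia.
Qed.

Lemma three_members : 4 < #|G| -> 3 * size F <= #|G|.
Proof.
move=> n4; have := sum_balance.
have : (0 <= \sum_(s <- F) balance s)%R.
  rewrite big_seq; apply: Num.Theory.sumr_ge0 => s sF; exact: (balance_ge0 n4 (member_F sF)).
by move: (\sum_(s <- F) balance s)%R => S; move: (size F) (#|G|) ; clear; lia.
Qed.

Lemma balance_tight : #|G| = 3 * size F -> 4 < #|G| -> forall s, member s -> balance s = 0%R.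
Proof.
move=> e n4 s Ms; have Hge t := @balance_ge0 t n4.
have [t tF ht] : exists2 t, t \in F & balance t = balance s.
  by case/orP: Ms => h; [exists s | exists (rev s) => //; rewrite balance_rev].
have := sum_balance; rewrite (big_rem t tF) /= ht.
have : (0 <= \sum_(s <- rem t F) balance s)%R.
  rewrite big_seq; apply: Num.Theory.sumr_ge0 => r /mem_rem rF; exact: (Hge _ (member_F rF)).
have := Hge s Ms; rewrite e.
by move: (\sum_(s <- _) balance s)%R (balance s) (size F); clear; lia.
Qed.
Lemma card_sum : #|G| = \sum_(s <- F) size s.
Proof.
rewrite cardE -(big_map size predT id) /= /=.
have -> : \sum_(i <- [seq size i | i <- F]) i = size (flatten F) by rewrite size_flatten sumnE.
apply: perm_size; apply: uniq_perm; rewrite ?enum_uniq ?(fac_un facF) // => x.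
by rewrite mem_enum (fac_full facF).
Qed.

Lemma card_members k t : t \in F -> (forall s, s \in F -> size s <= k) ->
  #|G| + k <= k * size F + size t.
Proof.
move=> tF H; rewrite card_sum (big_rem t tF) /= (perm_size (perm_to_rem tF)) /=.
have h : \sum_(s <- rem t F) size s <= k * size (rem t F).
  have : forall s, s \in rem t F -> size s <= k by move=> s /mem_rem; apply: H.
  elim: (rem t F) => [|s L IH] h; first by rewrite big_nil.
  rewrite big_cons /= mulnS leq_add ?h ?mem_head ?IH // => r rL; apply: h; by rewrite inE rL orbT.
by move: h; move: (\sum_(s <- _) _) (size (rem t F)) (size t); clear; lia.
Qed.

Lemma member_size_F s : member s -> exists2 t, t \in F & size t = size s.
Proof. by case/orP => h; [exists s | exists (rev s); rewrite ?size_rev]. Qed.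

Lemma interior_in_split e A e' y : member (e :: A ++ [:: e']) -> y \in A ->
  exists C D, A = C ++ y :: D /\
  exists h1 h2, [/\ h1 \in e :: C, h2 \in D ++ [:: e'] & forall z, z \in outer y ->
    forall x, adj y x -> x = h1 \/ x = h2 \/ x = z].
Proof.
move=> Ms yA; case/splitPr: yA Ms => C D Ms; exists C, D; split=> //.
exists (last e C), (head e' (D ++ [:: e'])); split; [exact: mem_last | by rewrite head_mem ?cat1_neq0 | ].
move=> z zy.
have MY : member (belast e C ++ last e C :: y :: head e' (D ++ [:: e']) :: behead (D ++ [:: e'])).
  rewrite -cat_rcons -lastI (_ : _ ++ _ = e :: (C ++ y :: D) ++ [:: e']) //= -catA /=.
  by case: (D).
exact: (interior_neighbors MY zy).
Qed.

(** * The equality case *)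

Section Tight.
Hypothesis n6 : 6 < #|G|.
Hypothesis cardG : #|G| = 3 * size F.

Let n4 : 4 < #|G| := ltnW (ltnW n6).

Lemma balance0 s : member s -> balance s = 0%R.
Proof. exact: (balance_tight cardG n4). Qed.

Lemma balance0_split e A e' : member (e :: A ++ [:: e']) ->
  (charge e + charge e' + \sum_(x <- A) charge x = 0)%R.
Proof. by move=> Ms; rewrite -balance_split balance0. Qed.

Lemma uncapped_charge0 e A e' : member (e :: A ++ [:: e']) -> ~~ capped e ->
  [/\ charge e = 0%R, charge e' = 0%R & forall a, a \in A -> charge a = 0%R].
Proof.
move=> Ms nc; have f1 := charge_end_ge0 Ms nc.
have f2 : (0 <= charge e')%R.
  apply: (charge_end_ge0 (member_flip Ms)); apply: contraNN nc.
  by rewrite (capped_same Ms (last_in _ _ _) (mem_head _ _)).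
have f3 := sum_int Ms; have h := balance0_split Ms.
split; [by move: f1 f2 f3 h; move: (charge e) (charge e') (\sum_(x <- A) charge x)%R; clear; lia | by move: f1 f2 f3 h; move: (charge e) (charge e') (\sum_(x <- A) charge x)%R; clear; lia | ].
move=> a aA; have := sum_int1 Ms aA; have := charge_interior_ge0 (is_end_interior Ms aA).
by move: f1 f2 h; move: (charge e) (charge e') (charge a) (\sum_(x <- A) charge x)%R; clear; lia.
Qed.

(** In all other cases of [caps_cases] the positive charge of y would make the balance positive, and for
    the same reason a path with a second interior vertex of charge 4 leaves no room for 8 at y. *)
Lemma capped_charge_pos e A e' y z : member (e :: A ++ [:: e']) -> y \in A -> (4 <= charge y)%R ->
  z \in outer y ->
  forall q B q', caps e e' q -> member (q :: B ++ [:: q']) -> z \notin q :: B ++ [:: q'] ->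
  [/\ B = [::], q' \in outer e, q' \in outer e' & charge y = 8%R -> A = [:: y]].
Proof.
move=> Ms yA fy zy q B q' cq MQ zQ; have h := balance0_split Ms.
have sy := sum_int1 Ms yA.
case: (caps_cases Ms cq MQ) => [[e1 e2]|/linkedP[u [w [uA wB uw]]]|[_ [[_ _ e1 e2 _]|[_ _ e1 e2 _]]]|[eB h1 h2]].
- by exfalso; move: h sy fy; rewrite e1 e2; move: (charge y) (\sum_(x <- A) charge x)%R; clear; lia.
- exfalso; have nu : u != y.
    apply: contraNneq zQ => eu; subst u.
    have wQ : w \in q :: B ++ [:: q'] by rewrite inE mem_cat wB orbT.
    have wy : w \in outer y.
      have yP : y \in e :: A ++ [:: e'] by rewrite inE mem_cat yA orbT.
      apply: (outerI Ms yP uw); apply/negP => wP.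
      exact: (uniq_cat_out (caps_disj Ms cq MQ) wP wQ).
    have [a oa] := outer_interior (is_end_interior Ms yA).
    by move: zy wy; rewrite oa !inE => /eqP-> /eqP<-.
  have := sum_int2 Ms uA yA nu; rewrite (charge_linked Ms cq MQ uA wB uw).
  have := caps_charge_lb Ms cq; have := caps_charge_lb (member_flip Ms) (caps_flip Ms cq).
  by move: h fy; move: (charge e) (charge e') (charge y) (\sum_(x <- A) charge x)%R; clear; lia.
- by exfalso; move: h sy fy; rewrite e1 e2; move: (charge y) (\sum_(x <- A) charge x)%R; clear; lia.
- by exfalso; move: h sy fy; rewrite e1 e2; move: (charge y) (\sum_(x <- A) charge x)%R; clear; lia.
split=> // fy8; subst B.
case: (hub_other Ms MQ cq h1 h2 yA) => [//|[x [xA xy fx]]]; exfalso.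
have := sum_int2 Ms xA yA xy; rewrite fy8.
have := caps_charge_lb Ms cq; have := caps_charge_lb (member_flip Ms) (caps_flip Ms cq).
by move: h fx; move: (charge e) (charge e') (charge x) (\sum_(x <- A) charge x)%R; clear; lia.
Qed.

Lemma outer_interior_eq x y z : ~~ is_end x -> y \in outer x -> z \in outer x -> y = z.
Proof. by move=> nx; have [a ->] := outer_interior nx; rewrite !inE => /eqP-> /eqP->. Qed.

Lemma interior_sides Y1 y Y2 : member (Y1 ++ y :: Y2) -> ~~ is_end y -> Y1 != [::] /\ Y2 != [::].
Proof.
move=> MY ny; split; apply: contraNneq ny => e; subst; first exact: (is_end_head MY).
exact: (is_end_last MY).
Qed.

(** The vertex b is not the last one of the path, which contains y after it. *)
Lemma left_end W1 b W2 y Y2 : member ((W1 ++ b :: W2) ++ y :: Y2) -> is_end b -> W1 = [::].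
Proof.
move=> MY Eb; case/lastP: W1 MY => // W1 l MY; exfalso; move: Eb; apply/negP.
have [r [T e]] : exists r T, W2 ++ y :: Y2 = r :: T.
  by case: (W2) => [|r T]; [exists y, Y2 | exists r, (T ++ y :: Y2)].
apply: (@interior_mid W1 l b r T).
by move: MY; rewrite -catA /= e -cats1 -catA.
Qed.

(** * A longest path next to an interior vertex *)

(** A longest path P whose end e is adjacent to an interior vertex y of another path Y. The list R is a
    member without neighbours on Y, and g a vertex of R adjacent to both ends of P; the vertices of P and R
    can be recut into a path X e that reaches e through R, and a path X'. *)
Section Detour.
Variables (e : G) (A : seq G) (e' : G) (R : seq G) (g : G) (X X' : seq G) (y : G).
Hypothesis MP : member (e :: A ++ [:: e']).
Hypothesis maxP : forall s, member s -> size s <= size (e :: A ++ [:: e']).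
Hypothesis MR : member R.
Hypothesis URP : uniq ((e :: A ++ [:: e']) ++ R).
Hypothesis gR : g \in R.
Hypothesis ge : adj e g.
Hypothesis ge' : adj e' g.
Hypothesis HR : forall a b, a \in R -> adj a b -> b \in R \/ b \in e :: A ++ [:: e'].
Hypothesis pX : perm_eq (X ++ e :: X') ((e :: A ++ [:: e']) ++ R).
Hypothesis XR : {subset X <= R}.
Hypothesis cX : uniq (X ++ [:: e]) -> chordless (X ++ [:: e]).
Hypothesis cX' : chordless X'.
Hypothesis ye : y \in outer e.
Hypothesis yR : y \notin R.
Hypothesis ny : ~~ is_end y.
Hypothesis Hw : forall w, w \in outer e' -> w \notin R -> ~~ is_end w.
Hypothesis HII : forall a b, a \in A -> b \in path_of y -> adj a b -> is_end b.

Let P := e :: A ++ [:: e'].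

Lemma brk_common : g \notin P.
Proof. by apply/negP => gP; apply: (uniq_cat_out URP gP gR). Qed.

Lemma brk_near_end z : z \in outer e -> z = g \/ z = y.
Proof.
have go : g \in outer e := outerI MP (mem_head _ _) ge brk_common.
have gy : g != y by apply: contraTneq gR => ->.
exact: (outer_pair MP cat1_neq0 go ye gy).
Qed.

Lemma brk_far_end w z : w \in outer e' -> w \notin R -> z \in outer e' -> z = g \/ z = w.
Proof.
move=> wo wR; have go : g \in outer e' := outerI MP (last_in _ _ _) ge' brk_common.
have gw : g != w by apply: contraTneq gR => ->.
exact: (outer_pair (member_flip MP) cat1_neq0 go wo gw).
Qed.

Lemma brk_notin Y1 Y2 z : member (Y1 ++ y :: Y2) -> z \in Y1 ++ y :: Y2 -> (z \notin P) /\ (z \notin R).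
Proof.
move=> MY zY; have yY : y \in Y1 ++ y :: Y2 by rewrite mem_cat mem_head orbT.
have yP := outer_notin MP (mem_head _ _) ye.
split; [apply: contraNN yP => zP | apply: contraNN yR => zP].
  by rewrite -(mem_path_of_member y MP zP) (mem_path_of_member y MY zY).
by rewrite -(mem_path_of_member y MR zP) (mem_path_of_member y MY zY).
Qed.

(** By [blocked]; the end f' of P is assumed to have no neighbour on the part in question, so the
    blocking edge leaves from the interior of P. *)
Lemma blocked_side f B f' z Y1 Y2 : member (f :: B ++ [:: f']) -> size P = size (f :: B ++ [:: f']) ->
  member (Y1 ++ z :: Y2) ->
  z \in outer f -> ~~ is_end z -> (forall b, b \in Y1 -> adj f b -> False) ->
  (forall b, b \in Y1 ++ [:: z] -> adj f' b -> False) ->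
  exists a b, [/\ a \in B, b \in Y1 & adj a b].
Proof.
move=> Mf szf MY zf nz H H'.
have zY : z \in Y1 ++ z :: Y2 by rewrite mem_cat mem_head orbT.
have fz : f \in outer z by rewrite outer_sym.
have zP := outer_notin Mf (mem_head _ _) zf.
apply/(linkedP B Y1); apply/negPn/negP => /linkedP nl.
apply: (blocked Mf MY (uniq_membersC Mf MY zY zP) (outer_adj zf)); first by rewrite -szf maxP.
have Bz a : a \in B -> adj a z -> False.
  move=> aB az; have interior_in : a \in f :: B ++ [:: f'] by rewrite inE mem_cat aB orbT.
  have ao : a \in outer z by rewrite outer_sym; apply: (outerI Mf interior_in az zP).
  by have := member_uniq Mf; rewrite /= mem_cat -(outer_interior_eq nz ao fz) aB.
move=> a b; rewrite inE mem_cat mem_seq1 [b \in _]mem_cat mem_seq1.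
case/or3P => [/eqP->|aB|/eqP->] /orP[bY|/eqP->] ab //.
- by case: (H b bY ab).
- by case: nl; exists a, b.
- by case: (Bz a aB ab).
- by case: (H' b _ ab); rewrite mem_cat bY.
- by case: (H' z _ ab); rewrite mem_cat mem_head orbT.
Qed.

(** If the far end e' has a neighbour b' before y, then [blocked_side] is used from e' at b' instead of
    from e at y. *)
Lemma brk_head Y1 Y2 : member (Y1 ++ y :: Y2) -> exists2 a, a \in A & adj a (head y Y1).
Proof.
move=> MY; have uY := member_uniq MY.
have yP := outer_notin MP (mem_head _ _) ye.
have yY : y \in Y1 ++ y :: Y2 by rewrite mem_cat mem_head orbT.
have out z := @brk_notin Y1 Y2 z MY.
have yn1 : y \notin Y1 by apply/negP => yy; apply: (uniq_cat_out uY yy (mem_head _ _)).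
have inY z : z \in Y1 -> z \in Y1 ++ y :: Y2 by move=> zY; rewrite mem_cat zY.
have ne b : b \in Y1 -> adj e b -> False.
  move=> bY eb; have [bP bR] := out b (inY b bY).
  case: (brk_near_end (outerI MP (mem_head _ _) eb bP)) => eb'; subst b; last by rewrite bY in yn1.
  by rewrite gR in bR.
suff [a [b [aA bY ab]]] : exists a b, [/\ a \in A, b \in Y1 & adj a b].
  have Eb : is_end b by apply: (HII aA) ab; rewrite (mem_path_of_member _ MY yY) inY.
  case/splitPr: bY MY {uY yY out yn1 inY ne} => W1 W2 MY.
  by exists a => //; rewrite (left_end MY Eb).
have [/hasP[b' bY e'b]|nh] := boolP (has (adj e') Y1); last first.
  apply: (blocked_side MP erefl MY ye ny ne) => b; rewrite mem_cat mem_seq1 => /orP[bY|/eqP->] e'b.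
    by case/hasP: nh; exists b.
  have e'o : e' \in outer y by rewrite outer_sym; apply: (outerI MP (last_in _ _ _) e'b yP).
  have eo : e \in outer y by rewrite outer_sym.
  by have := ends_neq MP; rewrite (outer_interior_eq ny e'o eo) eqxx.
have [bP bR] := out b' (inY b' bY).
have bo : b' \in outer e' := outerI MP (last_in _ _ _) e'b bP.
have nb := Hw bo bR.
case/splitPr: bY MY uY yn1 inY ne {out yY} => W1 W2; rewrite -[_ ++ y :: _]catA /= => MY uY yn1 inY ne.
case: (@blocked_side e' (rev A) e b' W1 (W2 ++ y :: Y2)) => //.
- exact: member_flip.
- by rewrite /P /= !size_cat size_rev.
- move=> b bW e'b0; have [bP' bR'] : b \notin P /\ b \notin R.
    by apply: (@brk_notin (W1 ++ b' :: W2) Y2 b); rewrite -?catA //= mem_cat bW.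
  have bo' := outerI MP (last_in _ _ _) e'b0 bP'.
  case: (brk_far_end bo bR bo') => eb; subst b; first by rewrite gR in bR'.
  by apply: (uniq_cat_out uY bW (mem_head _ _)).
- move=> b bW eb; apply: (ne b) => //; move: bW; rewrite !mem_cat !inE => /orP[->|->] //; by rewrite orbT.
move=> a [b [aA bW ab]]; exists a, b; split=> //; first by rewrite mem_rev in aA.
by rewrite mem_cat bW.
Qed.

Lemma brk_detour v Y1 Y2 y1 : member (Y1 ++ y :: Y2) -> single v -> v \notin P -> v \notin R ->
  v \notin Y1 ++ y :: Y2 ->
  head v Y1 = y1 -> y1 \in Y1 -> adj v y1 -> (forall u, u \in Y1 -> adj u v -> u = y1) -> False.
Proof.
move=> MY sv vP vR vY h1 iY v1 Hv; have yY : y \in Y1 ++ y :: Y2 by rewrite mem_cat mem_head orbT.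
have yP := outer_notin MP (mem_head _ _) ye.
have uY := member_uniq MY.
have out z := @brk_notin Y1 Y2 z MY.
move: (sv); rewrite single_member => Mv.
have U : uniq (P ++ R ++ [:: v] ++ (Y1 ++ y :: Y2)).
  apply: uniq_cat4 => //.
  - exact: (uniq_membersC MP Mv (mem_head _ _) vP).
  - exact: (uniq_membersC MP MY yY yP).
  - apply: uniq_cat3; [exact: (uniq_membersC MR Mv (mem_head _ _) vR) | exact: (uniq_membersC MR MY yY yR) | ].
    exact: (uniq_members Mv MY (mem_head _ _) vY).
apply: (unblock MP MR Mv MY U pX cX cX' (outer_adj ye) h1 v1 Hv _ iY).
move=> a b; rewrite mem_cat mem_seq1 => /orP[/XR aR|/eqP->] bY ab.
  have [bP bR] : b \notin P /\ b \notin R by apply: out; rewrite mem_cat bY orbT.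
  by case: (HR aR ab) => h; [rewrite h in bR | move: bP; rewrite /P h].
split=> //; have [bP bR] : b \notin P /\ b \notin R by apply: out; rewrite mem_cat bY orbT.
by case: (brk_near_end (outerI MP (mem_head _ _) ab bP)) => // eb; subst b; rewrite gR in bR.
Qed.

(** Both ends of Y are adjacent to interior vertices of P by [brk_head]. As Y has balance 0, it is
    uncapped, and each of its ends needs a single to reach charge 0 ([free_end_cases]); in fact one single
    v is adjacent to both ends. On at least one side of y there is no further neighbour of v, and that
    side can be handed to v ([brk_detour]). *)
Lemma longest_end_interior : False.
Proof.
have [Y1 [r [T [y2' MY0]]]] := interior_split ny.
have [Y1' [Y2 [eY1 MY]]] : exists Z1 Z2, Z1 = Y1 ++ [:: r] /\ member (Z1 ++ y :: Z2).
  by exists (Y1 ++ [:: r]), (T ++ [:: y2']); split=> //; rewrite -catA.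
move: {Y1 r T y2' MY0 eY1} Y1' MY => Y1 MY.
have [n1 n2] := interior_sides MY ny.
have MYr : member (rev Y2 ++ y :: rev Y1) by rewrite -cat_rcons -rev_cons -rev_cat member_rev.
have [a1 a1A h1] := brk_head MY; have [a2 a2A h2] := brk_head MYr.
have [y1 [C [y2 [eY hy1 hy2]]]] : exists y1 C y2, [/\ Y1 ++ y :: Y2 = y1 :: C ++ [:: y2],
   y1 = head y Y1 & y2 = head y (rev Y2)].
  case: (Y1) n1 => // y1 W _; case/lastP: (Y2) n2 => // Z y2 _.
  by exists y1, (W ++ y :: Z), y2; rewrite rev_rcons /= -catA /= cats1.
rewrite -hy1 in h1; rewrite -hy2 in h2.
have MC : member (y1 :: C ++ [:: y2]) by rewrite -eY.
have out z : z \in y1 :: C ++ [:: y2] -> (z \notin P) /\ (z \notin R).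
  by rewrite -eY; apply: brk_notin.
have [y1P y1R] := out y1 (mem_head _ _); have [y2P y2R] := out y2 (last_in _ _ _).
have interior_in a : a \in A -> a \in P by move=> aA; rewrite inE mem_cat aA orbT.
have nEa a : a \in A -> ~~ is_end a := fun aA => is_end_interior MP aA.
have o1 : a1 \in outer y1 by rewrite outer_sym; apply: (outerI MP (interior_in a1 a1A) h1 y1P).
have o2 : a2 \in outer y2 by rewrite outer_sym; apply: (outerI MP (interior_in a2 a2A) h2 y2P).
have hz := balance0_split MC.
(* With a cap, a1 and a2 would be the second outer neighbours of the ends of Y: charge 1 at both. *)
have nc : ~~ capped y1.
  apply/negP => /(cappedP MC (mem_head _ _))[q cq].
  have f z A0 z' a : member (z :: A0 ++ [:: z']) -> caps z z' q -> a \in outer z -> ~~ is_end a ->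
  charge z = 1%R.
    move=> Mz cz ao na; have [x [_ _ ux -> gx]] := caps_other Mz cz.
    have aq : a != q by apply: contraNneq na => ->; case/and5P: cz.
    by move: gx; rewrite -(ux a ao aq) (negPf na) => ->.
  have f1 := f _ _ _ _ MC cq o1 (nEa _ a1A).
  have f2 := f _ _ _ _ (member_flip MC) (caps_flip MC cq) o2 (nEa _ a2A).
  have := sum_int MC; move: hz; rewrite f1 f2.
  by move: (\sum_(x <- C) charge x)%R; clear; lia.
have [fy1 _ _] := uncapped_charge0 MC nc.
have Ey1 : is_end y1 := is_end_head MC.
have fr : free_end y1.
  apply/negPn/negP => /(not_free)[x [xo Ex rx]].
  have ns : ~~ single y1 by rewrite (nonsingle MC (mem_head _ _)).
  have ax := captive_nb Ey1 Ex ns xo rx o1.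
  have xP : x \in P by move: ax; rewrite path_of_sym (mem_path_of_member _ MP (interior_in _ a1A)).
  have yx : y1 \in outer x by rewrite outer_sym.
  move: Ex; rewrite (is_endE MP xP) => /orP[]/eqP ex; subst x.
    case: (brk_near_end yx) => ey; first by rewrite ey gR in y1R.
    by rewrite ey (negPf ny) in Ey1.
  by have := Hw yx y1R; rewrite Ey1.
have [v [vo sv vy2]] : exists v, [/\ v \in outer y1, single v & adj v y2].
  have [a [b [ho ab]]] := free_end_cases MC fr nc.
  have ao : a \in outer y1 by case: ho => ->; rewrite !inE eqxx ?orbT.
  case=> [h|[_ sa aa _]|[_ /andP[sa _] Eb _ _]].
  - by rewrite fy1 in h.
  - by exists a.
  - have : is_end a1 by case: ho o1 => ->; rewrite !inE => /orP[]/eqP-> //; apply: (single_is_end sa).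
    by rewrite (negPf (nEa _ a1A)).
have vP : v \notin P by apply/negP => vP; move: sv; rewrite (nonsingle MP vP).
have vR : v \notin R.
  apply/negP => vR; have := outer_adj vo; rewrite adj_sym => /(HR vR)[] h; first by rewrite h in y1R.
  by move: y1P; rewrite /P h.
have vC := outer_notin MC (mem_head _ _) vo.
have vY : v \notin Y1 ++ y :: Y2 by rewrite eY.
have y12 : y1 != y2 := ends_neq MC.
have vy1 : adj v y1 by rewrite adj_sym (outer_adj vo).
have uY := member_uniq MY.
have hd (W : seq G) (x x' : G) : W != [::] -> head x W = head x' W by case: W.
have y1Y : y1 \in Y1 by rewrite hy1 head_mem.
have nr2 : rev Y2 != [::] by rewrite -size_eq0 size_rev size_eq0.
have y2Y : y2 \in Y2 by rewrite -mem_rev hy2 head_mem.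
have [c Nv] : exists c, forall z, adj v z -> z = y1 \/ z = y2 \/ z = c.
  case: (neighbors v) => a [b [c [u h]]]; move: vy1 vy2; rewrite !h !inE.
  move=> /or3P[]/eqP e1 /or3P[]/eqP e2;
   try (by move: y12; rewrite e1 e2 eqxx);
   [exists c | exists b | exists c | exists a | exists b | exists a] => z;
   rewrite h !inE e1 e2 => /or3P[]/eqP->; auto.
have d12 x : x \in Y1 -> x \in Y2 -> False.
  by move=> x1 x2; apply: (uniq_cat_out uY x1); rewrite inE x2 orbT.
(* The third neighbour c of v lies on at most one side of y. *)
have [c1|c1] := boolP (c \in Y1).
  apply: (brk_detour (v := v) (Y1 := rev Y2) (Y2 := rev Y1) (y1 := y2) MYr) => //.
  - by rewrite -cat_rcons -rev_cons -rev_cat mem_rev.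
  - by rewrite hy2; apply: hd.
  - by rewrite mem_rev.
  - move=> u; rewrite mem_rev => uY2; rewrite adj_sym => /Nv[|[|]] // eu; subst u; first by case: (d12 y1).
    by case: (d12 c).
have Hv1 u : u \in Y1 -> adj u v -> u = y1.
  move=> uY1; rewrite adj_sym => /Nv[|[|]] // eu; subst u; first by case: (d12 y2).
  by rewrite uY1 in c1.
apply: (brk_detour (v := v) MY sv vP vR vY _ y1Y vy1 Hv1); by rewrite hy1; apply: hd.
Qed.

End Detour.

(** * A longest path without a cap *)

Section Longest.
Variables (p : G) (A : seq G) (p' : G).
Hypothesis MP : member (p :: A ++ [:: p']).
Hypothesis maxP : forall x, rank x <= rank p.

Let P := p :: A ++ [:: p'].

Lemma max_size s : member s -> size s <= size (p :: A ++ [:: p']).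
Proof.
move=> Ms; have := member_ne Ms; case: s Ms => // x s Ms _.
rewrite -(size_path_of_member Ms (mem_head _ _)) -(size_path_of_member MP (mem_head _ _)).
exact: rank_size (maxP x).
Qed.

Lemma max_rank x : x \notin P -> rank x < rank p.
Proof.
move=> xP; rewrite ltn_neqAle maxP andbT; apply: contraNneq xP => /(rank_inj) e.
by rewrite -(mem_path_of_member x MP (mem_head _ _)) -e mem_path_of.
Qed.

Lemma max_captive x q : rank q < rank x -> q \notin P.
Proof.
move=> r; apply: contraTN r => qP; rewrite -leqNgt (rank_member MP qP (mem_head _ _)); exact: maxP.
Qed.

Lemma max_free : free_end p.
Proof. by apply/allP => y yp; apply/implyP => _; rewrite max_rank // (outer_notin MP (mem_head _ _) yp). Qed.

Lemma max_int : A != [::].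
Proof.
apply/eqP => A0; have [t tF _] := member_size_F MP.
have h : forall s, s \in F -> size s <= 2.
  by move=> s sF; have := max_size (member_F sF); rewrite A0.
by have := card_members tF h; have := h t tF; move: n6; rewrite cardG; clear; lia.
Qed.

(** The average size is three, which here is also the largest. *)
Lemma all_size3 s : size A = 1 -> member s -> size s = 3.
Proof.
move=> A1 Ms; have [t tF <-] := member_size_F Ms.
have h : forall s, s \in F -> size s <= 3.
  by move=> r rF; have := max_size (member_F rF); rewrite /= size_cat A1.
have h1 := card_members tF h; rewrite cardG leq_add2l in h1.
by apply/eqP; rewrite eqn_leq h1 andbT; apply: h.
Qed.

Lemma interior_in a : a \in A -> a \in P.
Proof. by move=> aA; rewrite inE mem_cat aA orbT. Qed.

Section Uncapped.
Hypothesis nc : ~~ capped p.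

(** The vertex a keeps charge 0 only if it pays 4 to b. Hence the path of b is capped, b has charge 8,
    and [capped_charge_pos] gives its shape. *)
Lemma uncapped_interior a b : a \in A -> b \in outer a -> ~~ is_end b -> exists o o' e e',
  [/\ member [:: o; b; o'], member [:: e; e'], caps o o' e, e' \in outer o & e' \in outer o'].
Proof.
move=> aA ba nb; have [_ _ fA] := uncapped_charge0 MP nc.
have ca : ~~ capped a by rewrite (capped_same MP (interior_in aA) (mem_head _ _)).
have na := is_end_interior MP aA.
have cb : capped b.
  by have := fA a aA; rewrite (charge_interior na ba) (negPf nb) (negPf ca); case: (capped b).
have ab : a \in outer b by rewrite outer_sym.
have [Y1 [r [Y2 [o' MY]]]] := interior_split nb.
have [o [C [eY bC]]] : exists o C, Y1 ++ r :: b :: Y2 ++ [:: o'] = o :: C ++ [:: o'] /\ b \in C.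
  case: (Y1) => [|z T]; first by exists r, (b :: Y2); rewrite mem_head.
  by exists z, (T ++ r :: b :: Y2); rewrite /= -catA mem_cat !inE eqxx !orbT.
rewrite eY in MY; have bY : b \in o :: C ++ [:: o'] by rewrite inE mem_cat bC orbT.
have [e ce] := elimT (cappedP MY bY) cb.
have [B [e' ME]] := caps_member MY ce.
have aE : a \notin e :: B ++ [:: e'].
  have eP : e \notin P by case/and5P: (ce) => _ _ r1 _ _; apply: max_captive r1.
  apply/negP => aE; move/negP: eP; apply.
  by rewrite -(mem_path_of_member e MP (interior_in aA)) (mem_path_of_member e ME aE) mem_head.
have fb : charge b = 8%R by rewrite (charge_interior nb ab) (negPf na) cb (negPf ca).
have [] := capped_charge_pos MY bC _ ab ce ME aE; first by rewrite fb.
move=> B0 h1 h2 /(_ fb) eC; subst.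
by exists o, o', e, e'.
Qed.

(** P and v form a cycle. If v has a third neighbour on P, then v is a detour in the sense of
    [longest_end_interior], since the second outer neighbour of p is not an end. Otherwise the cycle is
    chordless and can be cut beside the first interior vertex of P. *)
Lemma single_both_ends_impossible v : v \in outer p -> single v -> adj v p' -> False.
Proof.
move=> vp sv vp'; have MV := sv; rewrite single_member in MV.
have [x [xp xv]] : exists x, x \in outer p /\ x != v.
  have [a [b h]] := outer_end MP cat1_neq0; have := outer_uniq p; rewrite h /= inE andbT => ab.
  by move: vp; rewrite h !inE => /orP[]/eqP->; [exists b | exists a]; rewrite ?inE ?eqxx ?orbT // eq_sym.
have nx : ~~ is_end x by apply/negP; apply: (single_both_ends MP vp sv vp' xp xv).
have vP := outer_notin MP (mem_head _ _) vp; have xP := outer_notin MP (mem_head _ _) xp.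
have vx : v != x by rewrite eq_sym.
have Np := end_neighbors MP cat1_neq0 vp xp vx.
have pv := outer_adj vp; have vp0 : adj v p by rewrite adj_sym.
have p'v : adj p' v by rewrite adj_sym.
have vp'o : v \in outer p' := outerI MP (last_in _ _ _) p'v vP.
have p'p : p != p' := ends_neq MP.
have Uv : uniq ([:: v] ++ P) := uniq_members MV MP (mem_head _ _) vP.
have [/hasP[u uA uv]|nch] := boolP (has (adj v) A).
  have Nv := neighborsP vp0 vp' uv.
  have unu : uniq [:: p; p'; u].
    rewrite /= !inE !negb_or p'p; apply/and3P; split=> //; apply/eqP => e; subst u.
      by have := member_uniq MP; rewrite /= mem_cat uA.
    by have := member_uniq MP; rewrite /= cat_uniq /= uA /= !andbF.
  apply: (longest_end_interior (R := [:: v]) (g := v) (X := [:: v]) (X' := A ++ [:: p']) (y := x) MP) => //.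
  - exact: max_size.
  - by rewrite uniq_catC.
  - by rewrite mem_head.
  - by move=> a b; rewrite inE => /eqP-> /(Nv unu)[|[|]]->; right; rewrite ?mem_head ?last_in // interior_in.
  - by rewrite perm_catC.
  - by move=> _ /=; rewrite vp0.
  - exact: (@chordless_catr _ [:: p] _ (member_chordless MP)).
  - by rewrite inE.
  - move=> w wp'; rewrite inE => wv; apply/negP.
    by apply: (single_both_ends (member_flip MP) vp'o sv vp0 wp' wv).
  - move=> a b aA bx ab; apply/negPn/negP => nb.
    have bP : b \notin P.
      by apply: contraNN xP => bP; rewrite -(mem_path_of_member x MP bP) (path_of_same bx) mem_path_of.
    have bo := outerI MP (interior_in aA) ab bP.
    have [o [o' [e [e' [MY _ _ _ _]]]]] := uncapped_interior aA bo nb.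
    have bY : b \in [:: o; b; o'] by rewrite !inE eqxx orbT.
    have MY' : member (o :: [:: b] ++ [:: o']) by [].
    have xY : x \in o :: [:: b] ++ [:: o'] by rewrite -(mem_path_of_member x MY bY) (path_of_same bx) mem_path_of.
    have eb : x = b.
      by move: xY (is_endE MY' xY); rewrite (negPf nx) !inE => /or3P[]/eqP-> //; rewrite eqxx ?orbT.
    subst x; have po : p \in outer b by rewrite outer_sym.
    have ao : a \in outer b by rewrite outer_sym.
    have := member_uniq MP; rewrite /= mem_cat -(outer_interior_eq nb ao po) aA //.
have nA := max_int.
have noA z : z \in A -> adj z v -> False.
  by move=> zA zv; case/hasP: nch; exists z; rewrite // adj_sym.
have [a [A1 eA]] : exists a A1, A = a :: A1 by case: (A) nA => // a A1 _; exists a, A1.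
have EP : P = p :: a :: A1 ++ [:: p'] by rewrite /P eA.
have MP1 : member (p :: a :: A1 ++ [:: p']) by rewrite -EP.
have xP1 : x \notin p :: a :: A1 ++ [:: p'] by rewrite -EP.
rewrite eA /= in Np.
have aA : a \in A by rewrite eA mem_head.
have aP1 : a \in P := interior_in aA.
have na := is_end_interior MP aA.
have [y oy] := outer_interior na; have yo : y \in outer a by rewrite oy mem_head.
have MP0 : member ([::] ++ p :: a :: head p' (A1 ++ [:: p']) :: behead (A1 ++ [:: p'])).
  by move: MP1; case: (A1).
have Na := interior_neighbors MP0 yo.
have hh : head p' (A1 ++ [:: p']) \in A1 ++ [:: p'] := head_mem _ cat1_neq0.
have noA1 z : z \in A1 -> adj z v -> False by move=> zA; apply: noA; rewrite eA inE zA orbT.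
have yP := outer_notin MP aP1 yo.
have yv : y != v.
  by apply/eqP => e; apply: (noA a aA); rewrite -e; apply: (outer_adj yo).
have [Ey|nEy] := boolP (is_end y).
  have [Y MY] := end_member Ey.
  have vY : v \notin y :: Y.
    apply: contraNN yv => vY; have := mem_path_of_member y MV (mem_head _ _).
    by rewrite (mem_path_of_member y MY vY) mem_head inE => /esym.
  have U : uniq ([:: v] ++ P ++ (y :: Y)).
    apply: uniq_cat3 => //; [exact: (uniq_members MV MY (mem_head _ _) vY) | exact: (uniq_membersC MP MY (mem_head _ _) yP)].
  rewrite EP in U; exact: (cycle_end MV MP1 MY U vp0 vp' (outer_adj yo) noA1 Np xP1 Na hh).
have [o [o' [e [e' [MY ME ce h1 h2]]]]] := uncapped_interior aA yo nEy.
have MY' : member (o :: [:: y] ++ [:: o']) by [].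
have [Ns _ Ne Ne'] := hub_neighbors MY' ME ce h1 h2.
have yY : y \in [:: o; y; o'] by rewrite !inE eqxx orbT.
have [eo _ _ _ _] := caps_outer MY' ce.
have eP : e \notin P.
  case/and5P: (ce) => _ _ r1 _ _; apply: contraTN r1 => eP.
  by rewrite -leqNgt (rank_member MP eP (mem_head _ _)) maxP.
have nontriv t w : member t -> w \in t -> size t != 1 -> v \notin t.
  move=> Mt weight st; apply: contraNN st => vt.
  by move: sv; rewrite /single (size_path_of_member Mt vt).
have vY := nontriv _ _ MY yY isT; have vE := nontriv _ _ ME (mem_head _ _) isT.
have eY := outer_notin MY' (mem_head _ _) eo.
have U : uniq ([:: v] ++ P ++ [:: o; y; o'] ++ [:: e; e']).
  apply: uniq_cat4 => //.
  - exact: (uniq_members MV MY (mem_head _ _) vY).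
  - exact: (uniq_members MV ME (mem_head _ _) vE).
  - apply: uniq_cat3; [exact: (uniq_membersC MP MY yY yP) | exact: (uniq_membersC MP ME (mem_head _ _) eP) | ].
    exact: (uniq_membersC MY ME (mem_head _ _) eY).
rewrite EP in U; exact: (cycle_hub (C := [::]) MV MP1 MY ME U vp0 vp' (outer_adj yo) (outer_adj eo) (outer_adj h2) noA1 Np xP1 Na hh Ns Ne Ne').
Qed.

(** The two orders of u and x along P are [split_far] and [split_near]. *)
Lemma split_core v A0 tp z C0 tz L R u x w :
  member [:: v] -> member (p :: A0 ++ tp) -> member (z :: C0 ++ tz) -> all member L ->
  uniq ([:: v] ++ (p :: A0 ++ tp) ++ (z :: C0 ++ tz) ++ flatten L) ->
  perm_eq (flatten R) (tp ++ tz ++ flatten L) -> all (@chordless G) R -> size R <= size L ->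
  adj v p -> adj v w -> adj z x -> adj v u -> adj z p ->
  (forall y, adj v y -> y = p \/ y = u \/ y = w) -> u \in A0 -> x \in A0 -> u != x -> w \in C0 ->
  (forall a b, a \in p :: A0 -> b \in z :: C0 -> adj a b -> b = z /\ (a = p \/ a = x)) -> False.
Proof.
move=> MV M0 MZ ML U pR cR sR vp vw zx vu zp Nv uA xA ux wC H.
have sp y B : y \in B -> exists B1 B2, B = B1 ++ y :: B2 by case/splitPr => B1 B2; exists B1, B2.
have [Z1 [Z2 eC]] := sp w C0 wC; have eCt : C0 ++ tz = Z1 ++ w :: Z2 ++ tz by rewrite eC -catA.
rewrite eCt in MZ U; rewrite eC in H.
have [P1 [P2 eA]] := sp x A0 xA; have eAt : A0 ++ tp = P1 ++ x :: P2 ++ tp by rewrite eA -catA.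
rewrite eAt in M0 U; rewrite eA in H uA.
have [uP|uP] := boolP (u \in P2).
  exact: (split_far MV M0 MZ ML U pR cR sR vp vw zx Nv uP H).
rewrite mem_cat inE (negPf ux) (negPf uP) /= orbF in uA.
have [P3 [P4 eP]] := sp u P1 uA.
have eP1 : P1 ++ x :: P2 = P3 ++ u :: (P4 ++ x :: P2) by rewrite eP -catA.
have eP1t : P1 ++ x :: P2 ++ tp = P3 ++ u :: (P4 ++ x :: P2) ++ tp by rewrite eP -!catA.
rewrite eP1t in M0 U; rewrite eP1 in H.
have xP : x \in P4 ++ x :: P2 by rewrite mem_cat mem_head orbT.
exact: (split_near MV M0 MZ ML U pR cR sR vu vw zp Nv xP H).
Qed.

(** The second way for an end e to have charge 0 in [free_end_cases]. *)
Definition single_and_captive e e' v z := [/\ forall y, y \in outer e -> y = v \/ y = z, v \in outer e, z \in outer e,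
  single v && ~~ adj v e' & [/\ is_end z, ~~ single z, ~~ adj z e' & rank z < rank e]].

(** The single v has a second neighbour on P by [single_end] and one on Z by [join_three]; the captive
    z has a second neighbour on P by [captive_nb]. *)
Lemma single_and_captive_nb e B e' v z C z' : member (e :: B ++ [:: e']) ->
  single_and_captive e e' v z -> member (z :: C ++ [:: z']) ->
  exists u x w, [/\ [/\ u \in B, x \in B, u != x & w \in C], [/\ adj v u, adj v w & adj z x],
    forall y, adj v y -> y = e \/ y = u \/ y = w &
    forall y, adj z y -> y = head z (C ++ [:: z']) \/ y = e \/ y = x].
Proof.
move=> Ms [Oe ve ze /andP[sv nve'] [Ez nz nze' rz]] MZ.
have Ee := is_end_head Ms; have Ee' : is_end e' := @is_end_last e' (e :: B) Ms.
have vz : v != z by apply: contraNneq nz => <-.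
have MV := sv; rewrite single_member in MV.
have vP := outer_notin Ms (mem_head _ _) ve; have zP := outer_notin Ms (mem_head _ _) ze.
have vZ : v \notin z :: C ++ [:: z'] by apply/negP => h; move: sv; rewrite (nonsingle MZ h).
have ev : e \in outer v by rewrite outer_sym.
have ez : e \in outer z by rewrite outer_sym.
have Ne := end_neighbors Ms cat1_neq0 ve ze vz.
have onlyZ b : b \in z :: C ++ [:: z'] -> adj z b -> b = head z (C ++ [:: z']).
  by move=> bZ zb; case: (adj_member (s1 := [::]) MZ bZ zb) => [[]|[_ ->]].
have mid g A0 g' y : member (g :: A0 ++ [:: g']) -> y \in g :: A0 ++ [:: g'] -> y != g -> y != g' -> y \in A0.
  by move=> _; rewrite inE mem_cat mem_seq1 => /or3P[/eqP->|//|/eqP->]; rewrite eqxx.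
have [x [xB zx]] : exists x, x \in B /\ adj z x.
  have [c [d [h]]] : exists c d, outer z = [:: c; d] /\ c != d.
    have [c [d h]] := outer_end MZ cat1_neq0; exists c, d; split=> //.
    by have := outer_uniq z; rewrite h /= inE andbT.
  move=> cd; have [x [xz xe]] : exists x, x \in outer z /\ x != e.
    move: ez; rewrite h !inE => /orP[]/eqP->; [exists d | exists c]; rewrite ?inE ?eqxx ?orbT //; by rewrite eq_sym.
  exists x; split; last exact: outer_adj xz.
  apply: (mid e _ e' x Ms) => //.
    by rewrite -(mem_path_of_member x Ms (mem_head _ _)); apply: (captive_nb Ez Ee nz ez rz xz).
  by apply: contraNneq nze' => <-; apply: outer_adj xz.
have [u [uB vu]] : exists u, u \in B /\ adj v u.
  have [_ [u [uv uP ue]]] := single_end sv Ee ev.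
  exists u; split; last exact: outer_adj uv.
  rewrite (mem_path_of_member u Ms (mem_head _ _)) in uP; apply: (mid e _ e' u Ms) => //.
  by apply: contraNneq nve' => <-; apply: outer_adj uv.
have uP : u \in e :: B ++ [:: e'] by rewrite inE mem_cat uB orbT.
have xP : x \in e :: B ++ [:: e'] by rewrite inE mem_cat xB orbT.
have Nz : forall y, adj z y -> y = head z (C ++ [:: z']) \/ y = e \/ y = x.
  have xz : x \in outer z by rewrite outer_sym; apply: (outerI Ms xP _ zP); rewrite adj_sym.
  apply: (end_neighbors MZ cat1_neq0 ez xz); apply: contraTneq (member_uniq Ms) => ->.
  by rewrite /= mem_cat xB.
have ux : u != x.
  apply: contraNneq vz => eu; subst x; have nu := is_end_interior Ms uB.
  have ov : v \in outer u by apply: (outerI Ms uP _ vP); rewrite adj_sym.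
  have oz : z \in outer u by apply: (outerI Ms uP _ zP); rewrite adj_sym.
  by rewrite (outer_interior_eq nu ov oz).
have [w [wZ vw]] : exists w, w \in z :: C ++ [:: z'] /\ adj v w.
  have [/hasP[w wZ vw]|nh] := boolP (has (adj v) (z :: C ++ [:: z'])); first by exists w.
  case: (join_three Ms MV MZ _ cat1_neq0 (outer_adj ve) (outer_adj ze)).
  - apply: uniq_cat3; [exact: (uniq_membersC Ms MV (mem_head _ _) vP) | exact: (uniq_membersC Ms MZ (mem_head _ _) zP) | ].
    exact: (uniq_members MV MZ (mem_head _ _) vZ).
  - by move=> y /Ne [->|]; [left; case: (B) | auto].
  - by move=> a b; rewrite inE => /eqP-> bZ vb; case/hasP: nh; exists b.
have wP : w \notin e :: B ++ [:: e'] by apply: (notin_members MZ Ms wZ (mem_head _ _)); exact: (notin_members Ms MZ (mem_head _ _) (mem_head _ _) zP).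
have eu : e != u by apply: contraTneq (member_uniq Ms) => ->; rewrite /= mem_cat uB.
have we : w != e by apply: contraNneq wP => ->; rewrite mem_head.
have wu : w != u by apply: contraNneq wP => ->.
have Nv : forall y, adj v y -> y = e \/ y = u \/ y = w.
  apply: (neighborsP (outer_adj ev) vu vw); by rewrite /= !inE negb_or eu [e == w]eq_sym we [u == w]eq_sym wu.
have wz : w != z.
  apply: contraTneq vw => ->; rewrite adj_sym; apply/negP => /Nz[|[|]] e1.
  - by move: vZ; rewrite e1 inE head_mem ?orbT // cat1_neq0.
  - by move: vP; rewrite e1 mem_head.
  - by move: vP; rewrite e1 xP.
have wz' : w != z'.
  apply: contraTneq vw => e1; subst w; apply/negP => vz'.
  have Ez' : is_end z' := @is_end_last z' (z :: C) MZ.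
  have z'v : z' \in outer v by apply: (outerI MV (mem_head _ _) vz'); rewrite inE; apply: contraNneq vZ => <-; apply: last_in.
  have [_ [t2 [tv tz tn]]] := single_end sv Ez' z'v.
  rewrite (mem_path_of_member _ MZ (last_in _ _ _)) in tz.
  case: (Nv t2 (outer_adj tv)) => [e1|[e1|e1]]; subst t2.
  - by move: (notin_members Ms MZ (mem_head _ _) (mem_head _ _) zP); rewrite tz.
  - by move: (notin_members Ms MZ uP (mem_head _ _) zP); rewrite tz.
  - by rewrite eqxx in tn.
exists u, x, w; split=> //; split=> //.
exact: (mid z _ z' w MZ).
Qed.

(** Both P and Z have charge 0 at every vertex, which leaves few edges between them, and [split_core]
    applies. The only obstacle is an edge from p' to the far end z' of Z; then z' is also the captive at
    p', and p', z' are cut off and put behind the single v2 at p'. *)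
Lemma single_and_captive_impossible v z v2 z2 : single_and_captive p p' v z ->
  single_and_captive p' p v2 z2 -> False.
Proof.
move=> bz bz2; have [_ _ fA] := uncapped_charge0 MP nc.
case: (bz) => Op vp zp /andP[sv nvp'] [Ez nz nzp' rz].
case: (bz2) => Op' v2p' z2p' /andP[sv2 nv2p] [Ez2 nz2 nz2p rz2].
have [C [z' MZ]] := nonsingle_member Ez nz.
have [u [x [w [[uA xA ux wC] [vu vw zx] Nv Nz]]]] := single_and_captive_nb MP bz MZ.
have Ep := is_end_head MP; have Ep' : is_end p' := @is_end_last p' (p :: A) MP.
have MV := sv; rewrite single_member in MV.
have MV2 := sv2; rewrite single_member in MV2.
have vP := outer_notin MP (mem_head _ _) vp; have zP := outer_notin MP (mem_head _ _) zp.
have nsZ g : g \in z :: C ++ [:: z'] -> single g = false by apply: (nonsingle MZ).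
have pz : p \in outer z by rewrite outer_sym.
have rzp : rank z < rank p by [].
have ncz b : b \in z :: C ++ [:: z'] -> ~~ capped b.
  move=> bZ; rewrite (capped_same MZ bZ (mem_head _ _)).
  exact: (captive_uncapped MZ pz Ep rzp).
have zout b : b \in z :: C ++ [:: z'] -> b \notin P.
  by move=> bZ; apply: (notin_members MZ MP bZ (mem_head _ _)); apply: (notin_members MP MZ (mem_head _ _) (mem_head _ _) zP).
have PZ a b : a \in P -> b \in z :: C ++ [:: z'] -> adj a b -> b \in outer a.
  by move=> aP0 bZ ab; apply: (outerI MP aP0 ab); apply: zout.
have Ez' : is_end z' := @is_end_last z' (z :: C) MZ.
have z'Z := last_in z C z'.
have zz' := ends_neq MZ.
have pE b : b \in z :: C ++ [:: z'] -> adj p b -> b = z.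
  move=> bZ pb; case: (Op b (PZ p b (mem_head _ _) bZ pb)) => // e1; subst b.
  by move: sv; rewrite nsZ.
have p'E b : b \in z :: C ++ [:: z'] -> adj p' b -> b = z'.
  move=> bZ pb; case: (Op' b (PZ p' b (last_in _ _ _) bZ pb)) => e1; subst b.
    by move: sv2; rewrite nsZ.
  move: Ez2; rewrite (is_endE MZ bZ) => /orP[]/eqP e1 //; subst z2.
  by case/negP: nzp'; rewrite adj_sym.
have AE a b : a \in A -> b \in z :: C ++ [:: z'] -> adj a b -> (b = z /\ a = x) \/ b = z'.
  move=> aA bZ ab; have bo := PZ a b (interior_in aA) bZ ab.
  have Eb : is_end b.
    apply/negPn/negP => nb; have := fA a aA.
    rewrite (charge_interior (is_end_interior MP aA) bo) (negPf nb) (negPf (ncz b bZ)).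
    by rewrite (capped_same MP (interior_in aA) (mem_head _ _)) (negPf nc).
  move: Eb; rewrite (is_endE MZ bZ) => /orP[]/eqP e1; subst b; last by right.
  left; split=> //; rewrite adj_sym in ab; case: (Nz a ab) => [|[|]] // e1; subst a.
    have hZ : head z (C ++ [:: z']) \in z :: C ++ [:: z'] by rewrite inE head_mem ?orbT // cat1_neq0.
    by have := zout _ hZ; rewrite interior_in.
  by have := member_uniq MP; rewrite /= mem_cat aA.
have far a : a \in A -> adj a z' -> adj p' z'.
  move=> aA az'; have ao : a \in outer z' by rewrite outer_sym; apply: PZ => //; apply: interior_in.
  have na := is_end_interior MP aA.
  have [fr|nf] := boolP (free_end z'); last first.
    have [g [tz Et rt]] := not_free nf.
    have at_ := captive_nb Ez' Et (negbT (nsZ z' z'Z)) tz rt ao.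
    have tP : g \in P by move: at_; rewrite path_of_sym (mem_path_of_member _ MP (interior_in aA)).
    move: Et; rewrite (is_endE MP tP) => /orP[]/eqP e1; subst g; last by rewrite adj_sym (outer_adj tz).
    have := pE z' z'Z; rewrite adj_sym (outer_adj tz) => /(_ isT) e1.
    by rewrite e1 eqxx in zz'.
  have MZ' := member_flip MZ.
  have [fz _ _] := uncapped_charge0 MZ' (ncz z' z'Z).
  have [c [d [ho cd]]] := free_end_cases MZ' fr (ncz z' z'Z).
  have co : c \in outer z' by case: ho => ->; rewrite !inE eqxx ?orbT.
  case=> [h|[_ sc cz _]|[_ /andP[sc _] Ed _ _]].
  - by rewrite fz in h.
  - have cZ : c \notin z :: C ++ [:: z'] by apply/negP => h; move: sc; rewrite nsZ.
    rewrite adj_sym in cz; case: (Nz c cz) => [|[|]] e1; subst c.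
    + by move: cZ; rewrite inE head_mem ?orbT // cat1_neq0.
    + by move: sc; rewrite (nonsingle MP (mem_head _ _)).
    + by move: sc; rewrite (nonsingle MP (interior_in xA)).
  - have : is_end a by case: ho ao => ->; rewrite !inE => /orP[]/eqP-> //; apply: (single_is_end sc).
    by rewrite (negPf na).
have pv := outer_adj vp; have vp0 : adj v p by rewrite adj_sym.
have zp0 : adj z p by rewrite adj_sym (outer_adj zp).
have vZ : v \notin z :: C ++ [:: z'] by apply/negP => h; move: sv; rewrite nsZ.
have [pz'|npz'] := boolP (adj p' z'); last first.
  have U : uniq ([:: v] ++ (p :: (A ++ [:: p']) ++ [::]) ++ (z :: (C ++ [:: z']) ++ [::]) ++ flatten [::]).
    rewrite !cats0; apply: uniq_cat3; [exact: (uniq_members MV MP (mem_head _ _) vP)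
     | exact: (uniq_members MV MZ (mem_head _ _) vZ) | exact: (uniq_membersC MP MZ (mem_head _ _) zP)].
  apply: (@split_core v (A ++ [:: p']) [::] z (C ++ [:: z']) [::] [::] [::] u x w) => //; rewrite ?cats0 //.
  - by rewrite mem_cat uA.
  - by rewrite mem_cat xA.
  - by rewrite mem_cat wC.
  - move=> a b aP0 bZ ab; move: aP0; rewrite inE mem_cat mem_seq1 => /or3P[/eqP ea|aA|/eqP ea]; try subst a.
    + by split; [apply: pE | left].
    + case: (AE a b aA bZ ab) => [[-> ->]|e1]; first by auto.
      by subst b; move: npz'; rewrite (far a aA ab).
    + by have e1 := p'E b bZ ab; subst b; rewrite ab in npz'.
have ez2 : z2 = z'.
  case: (Op' z' (PZ p' z' (last_in _ _ _) z'Z pz')) => // e1.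
  by move: sv2; rewrite -e1 nsZ.
subst z2.
have [u2 [x2 [w2 [[u2A x2A _ w2C] [v2u2 v2w2 _] Nv2 _]]]] := single_and_captive_nb (member_flip MP) bz2 (member_flip MZ).
have v2P := outer_notin MP (last_in _ _ _) v2p'.
have v2Z : v2 \notin z :: C ++ [:: z'] by apply/negP => h; move: sv2; rewrite nsZ.
have vv2 : v2 != v by apply: contraNneq nvp' => <-; rewrite adj_sym (outer_adj v2p').
have nv2z' : ~~ adj v2 z'.
  apply/negP => /Nv2[|[|]] e1.
  - by have := zout z' z'Z; rewrite e1 last_in.
  - by have := zout z' z'Z; rewrite e1 interior_in // -mem_rev.
  - by move: (is_end_interior (member_flip MZ) w2C); rewrite -e1 Ez'.
have U : uniq ([:: v] ++ (p :: A ++ [:: p']) ++ (z :: C ++ [:: z']) ++ flatten [:: [:: v2]]).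
  rewrite [flatten _]/=; apply: uniq_cat4.
  - exact: (uniq_members MV MP (mem_head _ _) vP).
  - exact: (uniq_members MV MZ (mem_head _ _) vZ).
  - by rewrite /= inE eq_sym vv2.
  - apply: uniq_cat3; [exact: (uniq_membersC MP MZ (mem_head _ _) zP) | exact: (uniq_membersC MP MV2 (mem_head _ _) v2P)
     | exact: (uniq_membersC MZ MV2 (mem_head _ _) v2Z)].
apply: (@split_core v A [:: p'] z C [:: z'] [:: [:: v2]] [:: [:: v2; p'; z']] u x w) => //.
- by rewrite /= MV2.
- by rewrite /=; perm_segments.
- by rewrite /= [adj v2 p']adj_sym (outer_adj v2p') pz' nv2z'.
- move=> a b aP0 bZ ab; have bZ' : b \in z :: C ++ [:: z'].
    by move: bZ; rewrite !inE mem_cat => /orP[]->; rewrite ?orbT.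
  have bz' : b != z'.
    apply: contraTneq bZ => ->; rewrite inE eq_sym (negPf zz') /=.
    by apply/negP => h; have := member_uniq MZ; rewrite /= cat_uniq /= h !andbF.
  move: aP0; rewrite inE => /orP[/eqP ea|aA]; first by subst a; split; [apply: pE | left].
  case: (AE a b aA bZ' ab) => [[-> ->]|e1]; first by auto.
  by rewrite e1 eqxx in bz'.
Qed.

(** A longest path is free at both ends, so [free_end_cases] leaves the two situations excluded above. *)
Lemma uncapped_max : False.
Proof.
have [f1 f2 _] := uncapped_charge0 MP nc.
have nc' : ~~ capped p' by rewrite (capped_same MP (last_in _ _ _) (mem_head _ _)).
have fr' : free_end p'.
  apply/allP => y yp; apply/implyP => _; rewrite (rank_member MP (last_in _ _ _) (mem_head _ _)).
  by rewrite max_rank // (outer_notin MP (last_in _ _ _) yp).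
have one e B e' : member (e :: B ++ [:: e']) -> charge e = 0%R -> free_end e -> ~~ capped e ->
  (exists a, [/\ a \in outer e, single a & adj a e']) \/ exists v z, single_and_captive e e' v z.
  move=> Ms f0 fe nce; have [a [b [ho ab]]] := free_end_cases Ms fe nce.
  have ao : a \in outer e by case: ho => ->; rewrite !inE eqxx ?orbT.
  have bo : b \in outer e by case: ho => ->; rewrite !inE eqxx ?orbT.
  case=> [h|[_ sa aa _]|[_ sa Eb /andP[nb nb'] rb]]; first by rewrite f0 in h.
    by left; exists a.
  right; exists a, b; split=> // y; case: ho => ->; rewrite !inE => /orP[]/eqP->; auto.
case: (one _ _ _ MP f1 max_free nc) => [[v [vp sv vp']]|[v [z bz]]]; first exact: (single_both_ends_impossible vp sv vp').
case: (one _ _ _ (member_flip MP) f2 fr' nc') => [[v2 [vp sv vp']]|[v2 [z2 bz2]]].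
  have vP := outer_notin MP (last_in _ _ _) vp.
  by apply: (single_both_ends_impossible (v := v2)) => //; [apply: (outerI MP (mem_head _ _)); rewrite // adj_sym | rewrite adj_sym (outer_adj vp)].
exact: (single_and_captive_impossible bz bz2).
Qed.

End Uncapped.

End Longest.

(** * A longest path with a cap *)

Section Longest.
Variables (p : G) (A : seq G) (p' : G).
Hypothesis MP : member (p :: A ++ [:: p']).
Hypothesis maxP : forall x, rank x <= rank p.

Let P := p :: A ++ [:: p'].

(** The path of y has balance 0, which leaves few shapes for it; each shape provides a path X x from which
    a can be prolonged. The data are passed to a continuation because the list L of members involved
    depends on the shape. *)
Lemma extend Q a y : member Q -> 1 < size Q -> uniq (P ++ Q) ->
  (forall b c, b \in Q -> adj b c -> c \in P ++ Q) ->
  (forall c, adj p c -> c \in P ++ Q) -> (forall c, adj p' c -> c \in P ++ Q) ->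
  a \in A -> y \in outer a -> y \notin Q -> is_end y ->
  (forall L X x R, all member L -> uniq (P ++ Q ++ flatten L) ->
     perm_eq (X ++ x :: flatten R) (flatten L) -> size R < size L -> all (@chordless G) R ->
     (uniq (X ++ [:: x]) -> chordless (X ++ [:: x])) -> adj x a ->
     (forall u w, u \in X ++ [:: x] -> w \in P ++ Q -> adj u w -> u = x /\ w = a) -> False) -> False.
Proof.
move=> MQ szQ UPQ HQ Hp Hp' aA ya yQ Ey K.
have aPP := interior_in p p' aA; have na := is_end_interior MP aA.
have yP := outer_notin MP aPP ya.
have ay : a \in outer y by rewrite outer_sym.
have yPQ : y \notin P ++ Q by rewrite mem_cat negb_or yP yQ.
have EP b : b \in P -> is_end b -> adj b y -> False.
  by move=> bP; rewrite (is_endE MP bP) => /orP[]/eqP-> h; case/negP: yPQ; [apply: Hp | apply: Hp'].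
have adjQ b : b \in Q -> adj y b -> False.
  by move=> bQ yb; case/negP: yPQ; apply: (HQ b); rewrite // adj_sym.
have outQ t b : member t -> y \in t -> b \in t -> b \notin P ++ Q.
  move=> Mt yt bt; rewrite mem_cat negb_or.
  by rewrite (notin_members Mt MP bt aPP (notin_members MP Mt aPP yt yP)) (contraNN _ yQ) // => bQ;
     rewrite -(mem_path_of_member y MQ bQ) (mem_path_of_member y Mt bt).
have disjPQ t b : member t -> b \in t -> b \notin P ++ Q -> uniq ((P ++ Q) ++ t).
  rewrite mem_cat negb_or => Mt bt /andP[bP bQ].
  rewrite -catA; apply: uniq_cat3 => //; [exact: (uniq_membersC MP Mt bt bP) | exact: (uniq_membersC MQ Mt bt bQ)].
(* A single y has charge 0 only next to an end z, and then two of its neighbours are on the path of z. *)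
have [sy|nsy] := boolP (single y).
  have My := sy; rewrite single_member in My.
  have : charge y = 0%R.
    by have := balance0 My; rewrite /balance big_seq1.
  rewrite (charge_single sy); case: eqP => // /eqP; rewrite -lt0n -has_count => /hasP[z zy Ez] _.
  have [_ [b [by_ bz nbz]]] := single_end sy Ez zy.
  have zP : z \notin P.
    by apply/negP => zP; apply: (EP z zP Ez); rewrite adj_sym (outer_adj zy).
  have bP : b \notin P by apply: contraNN zP => bP; rewrite -(mem_path_of_member z MP bP) (path_of_same bz) mem_path_of.
  have az : a != z by apply: contraNneq na => ->.
  have ab : a != b by apply: contraNneq bP => <-.
  apply: (K [:: [:: y]] [::] y [::]) => //.
  - by rewrite /= My.
  - by rewrite catA; apply: (disjPQ _ y My (mem_head _ _) yPQ).
  - exact: outer_adj ay.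
  - move=> u w; rewrite inE => /eqP-> wPQ yw; split=> //.
    have u3 : uniq [:: z; b; a] by rewrite /= !inE negb_or eq_sym nbz [z == a]eq_sym az [b == a]eq_sym ab.
    case: (neighborsP (outer_adj zy) (outer_adj by_) (outer_adj ay) u3 yw) => [e|[e|e]] //; subst w; exfalso.
      by move: wPQ; rewrite mem_cat (negPf zP) /= => /adjQ; apply.
    by move: wPQ; rewrite mem_cat (negPf bP) /= => /adjQ; apply.
have [C [y' MY]] := nonsingle_member Ey nsy.
have yY : y \in y :: C ++ [:: y'] := mem_head _ _.
have [b [yb ba]] : exists b, b \in outer y /\ b != a.
  have [c [d h]] := outer_end MY cat1_neq0; have := outer_uniq y; rewrite h /= inE andbT => cd.
  by move: ay; rewrite h !inE => /orP[]/eqP->; [exists d | exists c]; rewrite ?inE ?eqxx ?orbT // eq_sym.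
have outY c : c \in y :: C ++ [:: y'] -> c \notin P ++ Q by apply: outQ.
have Ny := end_neighbors MY cat1_neq0 yb ay ba.
have hY : head y (C ++ [:: y']) \in y :: C ++ [:: y'] by rewrite inE head_mem ?orbT // cat1_neq0.
have yedge w : w \in P ++ Q -> b \notin P ++ Q -> adj y w -> w = a.
  by move=> wPQ bPQ /Ny[|[|]] // e; subst w; [move: (outY _ hY) | move: bPQ]; rewrite wPQ.
have cCy : chordless (C ++ [:: y']) := @chordless_catr _ [:: y] _ (member_chordless MY).
have ya0 : adj y a := outer_adj ay.
have Ey' : is_end y' := @is_end_last y' (y :: C) MY.
have [/(cappedP MY yY)[e ce]|nc] := boolP (capped y); last first.
  have [fy _ _] := uncapped_charge0 MY nc.
  have fr : free_end y.
    apply/negPn/negP => /(not_free)[x [xo Ex rx]].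
    have ax := captive_nb Ey Ex nsy xo rx ay.
    have xP : x \in P by move: ax; rewrite path_of_sym (mem_path_of_member _ MP aPP).
    by apply: (EP x xP Ex); rewrite adj_sym (outer_adj xo).
  have [v [vo sv vy']] : exists v, [/\ v \in outer y, single v & adj v y'].
    have [c [d [ho cd]]] := free_end_cases MY fr nc.
    have co : c \in outer y by case: ho => ->; rewrite !inE eqxx ?orbT.
    case=> [h|[_ sc cy _]|[_ /andP[sc _] Ed _ _]]; [by rewrite fy in h | by exists c | ].
    have : is_end a by case: ho ay => ->; rewrite !inE => /orP[]/eqP-> //; apply: (single_is_end sc).
    by rewrite (negPf na).
  have vb : v = b.
    case: (Ny v (outer_adj vo)) => [ev|[//|ev]]; last by move: na; rewrite -ev (single_is_end sv).
    by move: (outer_notin MY yY vo); rewrite ev hY.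
  subst b; have Mv := sv; rewrite single_member in Mv.
  have vPQ : v \notin P ++ Q.
    rewrite mem_cat negb_or; apply/andP; split.
      by apply/negP => vP; move: sv; rewrite (nonsingle MP vP).
    by apply/negP => vQ; move: sv szQ; rewrite /single (size_path_of_member MQ vQ) => /eqP->.
  have vY := outer_notin MY yY vo.
  have U : uniq (P ++ Q ++ flatten [:: y :: C ++ [:: y']; [:: v]]).
    have -> : flatten [:: y :: C ++ [:: y']; [:: v]] = (y :: C ++ [:: y']) ++ [:: v] by [].
    rewrite catA; apply: uniq_cat3; [exact: (disjPQ _ y) | exact: (disjPQ _ v Mv (mem_head _ _)) | ].
    exact: (uniq_membersC MY Mv (mem_head _ _) vY).
  have vy := outer_adj vo.
  have yy' := ends_neq MY.
  (* If v has a third neighbour on Y it precedes y in the new path; otherwise it follows the rest of Y. *)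
  have [/hasP[c cC vc]|nch] := boolP (has (adj v) C).
    have Nv : forall z, adj v z -> z = y \/ z = y' \/ z = c.
      apply: (neighborsP _ vy' vc); first by rewrite adj_sym.
      rewrite /= !inE !negb_or yy' /= andbT; apply/andP; split.
        by apply: contraTneq (member_uniq MY) => ->; rewrite /= mem_cat cC.
      by apply: contraTneq (member_uniq MY) => ->; rewrite /= cat_uniq /= cC !andbF.
    apply: (K [:: y :: C ++ [:: y']; [:: v]] [:: v] y [:: C ++ [:: y']]) => //.
    - by rewrite /= MY Mv.
    - perm_segments.
    - by rewrite /= cCy.
    - by move=> _; rewrite /= adj_sym vy.
    - move=> x w xX wPQ; move: xX; rewrite !inE => /orP[]/eqP-> xw; last by split=> //; apply: yedge.
      have wY : w \in y :: C ++ [:: y'].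
        by case: (Nv w xw) => [|[|]] ->; rewrite ?mem_head ?last_in // inE mem_cat cC orbT.
      by have := outY w wY; rewrite wPQ.
  apply: (K [:: y :: C ++ [:: y']; [:: v]] [::] y [:: (C ++ [:: y']) ++ [:: v]]) => //.
  - by rewrite /= MY Mv.
  - perm_segments.
  - rewrite /= andbT; apply: chordless_cat => //.
      by move: U; rewrite catA cat_uniq => /and3P[_ _] /= /andP[_].
    apply: (@joinedI _ y' v) => //; first by rewrite last_cat.
      by rewrite adj_sym.
    move=> c d; rewrite mem_cat !inE => /orP[cC|/eqP->] /eqP-> // cv; case/hasP: nch; exists c => //; by rewrite adj_sym.
  - by move=> x w; rewrite inE => /eqP-> wPQ xw; split=> //; apply: yedge.
have [x [_ _ ux fy gx]] := caps_other MY ce.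
have [eo eo' yoe yoe' _] := caps_outer MY ce.
case/and5P: (ce) => Ee nse re _ _.
have ae : a != e by apply: contraNneq na => ->.
have ex : x = a by rewrite (ux a ay ae).
subst x; rewrite gx (negPf na) in fy.
have hz := balance0_split MY.
have be : b = e.
  by apply/eqP/negPn/negP => h; move: ba; rewrite (ux b yb h) eqxx.
subst b.
have [B [e' ME]] := caps_member MY ce.
have eP : e \notin P by apply: (max_captive MP maxP re).
have eQ : e \notin Q by apply/negP => eQ; apply: (adjQ e eQ); apply: (outer_adj eo).
have ePQ : e \notin P ++ Q by rewrite mem_cat negb_or eP eQ.
have outE c : c \in e :: B ++ [:: e'] -> c \notin P ++ Q.
  move=> cE; rewrite mem_cat negb_or; apply/andP; split.
    by apply: contraNN eP => cP; rewrite -(mem_path_of_member e MP cP) (mem_path_of_member e ME cE) mem_head.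
  by apply: contraNN eQ => cQ; rewrite -(mem_path_of_member e MQ cQ) (mem_path_of_member e ME cE) mem_head.
have UYE := caps_disj MY ce ME.
have s0 := sum_int MY.
case: (caps_cases MY ce ME) => [[_ f2]|/linkedP[u [w [uA wB uw]]]|[nl [[_ _ f1 _ _]|[e'y' ne'y f1 _ _]]]|[_ h _]].
- by move: hz s0; rewrite fy f2; move: (\sum_(x <- C) charge x)%R; clear; lia.
- have := sum_int1 MY uA; rewrite (charge_linked MY ce ME uA wB uw).
  have := caps_charge_lb (member_flip MY) (caps_flip MY ce).
  by move: hz; rewrite fy; move: (charge y') (\sum_(x <- C) charge x)%R; clear; lia.
- by rewrite f1 in fy.
- have Ne := caps_nb MY ce ME.
  have y'e' := outer_adj e'y'.
  case: B ME outE UYE Ne nl => [|b0 B] ME outE UYE Ne nl; last first.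
    have szB := caps_size MY ce ME.
    apply: (cross (A := rev C) (B := b0 :: B) (member_flip MY) ME) => //.
    + rewrite uniq_catC (perm_uniq (s2 := (e :: (b0 :: B) ++ [:: e']) ++ y :: C ++ [:: y'])).
        by rewrite uniq_catC.
      by perm_segments.
    + by rewrite -size_eq0 size_rev -lt0n; apply: leq_trans szB.
    + exact: outer_adj eo.
    + move=> c d; rewrite mem_cat mem_rev mem_seq1 [d \in _]inE => /orP[cC|/eqP->] /orP[/eqP->|dB] cd //.
      * rewrite adj_sym in cd; exfalso; case: (Ne c cd) => [ec|[ec|ec]]; subst c.
        - by apply: (uniq_cat_out UYE (x := head e ((b0 :: B) ++ [:: e']))); rewrite inE ?mem_cat ?cC ?orbT //= inE eqxx !orbT.
        - by have := member_uniq MY; rewrite /= mem_cat cC.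
        - by have := member_uniq MY; rewrite /= cat_uniq /= cC !andbF.
      * by case/negP: nl; apply/linkedP; exists c, d.
      * exfalso; have dE : d \in e :: (b0 :: B) ++ [:: e'] by rewrite inE mem_cat dB orbT.
        case: (Ny d cd) => [ed|[ed|ed]]; subst d.
        - exact: (uniq_cat_out UYE hY dE).
        - by have := member_uniq ME; rewrite cons_uniq mem_cat dB.
        - by have := outE a dE; rewrite mem_cat aPP.
    + by rewrite size_rev.
  (* The cap has two vertices, and e' e y is the path that ends beside a. *)
  have ee' : adj e e' by have := member_chordless ME => /= /andP[/andP[]].
  have Ee' : is_end e' := @is_end_last e' [:: e] ME.
  have nse' : ~~ single e' by rewrite (nonsingle ME (last_in _ _ _)).
  apply: (K [:: y :: C ++ [:: y']; [:: e; e']] [:: e'; e] y [:: C ++ [:: y']]) => //.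
  + by rewrite /= MY ME.
  + have -> : flatten [:: y :: C ++ [:: y']; [:: e; e']] = (y :: C ++ [:: y']) ++ [:: e; e'] by [].
    rewrite catA; apply: uniq_cat3 => //; [exact: (disjPQ _ y) | exact: (disjPQ _ e ME (mem_head _ _))].
  + perm_segments.
  + by rewrite /= cCy.
  + by move=> _; rewrite /= adj_sym ee' (outer_adj yoe) ne'y.
  + move=> c w cX wPQ; move: cX; rewrite !inE => /or3P[]/eqP-> cw; last by split=> //; apply: yedge.
      exfalso; have [we|we] := boolP (w \in [:: e; e']); first by move: (outE w we); rewrite wPQ.
      have oe : w \in outer e' := outerI ME (last_in _ _ _) cw we.
      have y'o : y' \in outer e' by rewrite outer_sym.
      have re' : rank e' < rank y'.
        by rewrite (rank_member ME (last_in _ _ _) (mem_head _ _)) (rank_member MY (last_in _ _ _) (mem_head _ _)).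
      have := captive_nb Ee' Ey' nse' y'o re' oe.
      by rewrite (mem_path_of_member _ MY (last_in _ _ _)) => /outY; rewrite wPQ.
    exfalso; case: (Ne w cw) => [ew|[ew|ew]]; subst w.
    * by have := outE e' (last_in _ _ _); rewrite wPQ.
    * by have := outY y yY; rewrite wPQ.
    * by have := outY y' (last_in _ _ _); rewrite wPQ.
- have ne : e' != e by rewrite eq_sym (ends_neq ME).
  by move: na; rewrite -(ux e' h ne) (@is_end_last e' (e :: B)).
Qed.

End Longest.

(** The new pieces are a p q p' followed by P backwards down to the vertex after u, and the part of P from
    the vertex after a up to u followed by f f'. The first one starts at a, where [attach] applies. *)
Lemma reroute p a T1 u T2 p' Q q f f' L X x R :
  member (p :: a :: T1 ++ u :: T2 ++ [:: p']) -> member Q -> perm_eq Q [:: q; f; f'] ->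
  uniq ((p :: a :: T1 ++ u :: T2 ++ [:: p']) ++ Q ++ flatten L) ->
  adj p q -> adj p' q -> adj u f -> adj f f' ->
  (forall y, adj q y -> y \in [:: p; p'; f; f']) ->
  (forall y, y \in T1 -> adj y f -> False) ->
  (forall y, y \in T1 ++ [:: u] -> adj y f' -> False) ->
  all member L -> perm_eq (X ++ x :: flatten R) (flatten L) -> size R < size L -> all (@chordless G) R ->
  (uniq (X ++ [:: x]) -> chordless (X ++ [:: x])) -> adj x a ->
  (forall c w, c \in X ++ [:: x] -> w \in (p :: a :: T1 ++ u :: T2 ++ [:: p']) ++ Q -> adj c w ->
  c = x /\ w = a) -> False.
Proof.
move=> MP MQ pQ U pq p'q uf ff' Nq Hf Hf' ML pL sR cR cX xa H.
have cP := member_chordless MP; have uP := member_uniq MP.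
have uPQ : uniq ((p :: a :: T1 ++ u :: T2 ++ [:: p']) ++ Q).
  by move: U; rewrite catA cat_uniq => /and3P[].
have uPQ' : uniq ((p :: a :: T1 ++ u :: T2 ++ [:: p']) ++ [:: q; f; f']).
  by rewrite (perm_uniq (perm_cat (perm_refl _) pQ)) in uPQ.
have e1 : p :: a :: T1 ++ u :: T2 ++ [:: p'] = [:: p; a] ++ (T1 ++ [:: u]) ++ (T2 ++ [:: p']).
  by rewrite /= -!catA.
have e2 : p :: a :: T1 ++ u :: T2 ++ [:: p'] = ([:: p; a] ++ T1 ++ [:: u]) ++ (T2 ++ [:: p']).
  by rewrite e1 -catA.
have far : forall b c, b \in [:: p; a] -> c \in T2 ++ [:: p'] -> adj b c -> False.
  move=> b c bp cT bc; have cP' := cP; have uP' := uP; rewrite e2 in cP' uP'.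
  have := chordless_joined uP' cP' (x := b) (y := c); rewrite mem_cat bp => /(_ isT cT).
  rewrite bc catA last_cat /= => /esym/andP[/eqP eb _]; move: uP' bp; rewrite eb cat_uniq => /and3P[+ _ _].
  rewrite cat_uniq => /and3P[_ /hasPn h _]; rewrite (negPf (h u _)) //.
  by rewrite mem_cat mem_head orbT.
have ap : adj a p by rewrite adj_sym; case/andP: cP => /andP[].
have c2' : chordless (T2 ++ [:: p']) by rewrite e2 in cP; exact: chordless_catr cP.
have c1 : chordless (T1 ++ [:: u]) by rewrite e1 in cP; exact: (chordless_catl (chordless_catr cP)).
color_segments [:: inl p; inl a; inr T1; inl u; inr T2; inl p'; inl q; inl f; inl f'] uPQ'.
have naq : adj a q -> False by rewrite adj_sym => /Nq h; split_mem h; color_clash.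
apply: (attach (a := a) (A := [:: p; q] ++ rev (T2 ++ [:: p'])) (B := (T1 ++ [:: u]) ++ [:: f; f'])
   MP MQ ML U _ _ _ pL sR cR cX xa).
- apply/permP => pp; rewrite [RHS]count_cat (permP pQ pp); do 5 (rewrite ?(count_cat, count_rev) /=).
  by clear; lia.
- move=> un; rewrite -cat_cons; apply: chordless_cat_seg => // [_|u1|].
  + rewrite /= ap pq /= !andbT; exact/negP.
  + exact: chordless_rev_seg.
  + apply: (@joinedI _ q p') => //; first by rewrite rev_cat.
      by rewrite adj_sym.
    move=> b d bp; rewrite mem_rev => cT bc; have [bq|bq] := boolP (b \in [:: p; a]); first by case: (far b d).
    have eb : b = q by move: bp bq; rewrite !inE => /or3P[]/eqP->; rewrite ?eqxx ?orbT.
    subst b; split=> //; have h := Nq d bc; split_mem cT; split_mem h; try subst d; try done; color_clash.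
- move=> un; apply: chordless_cat_seg => // [_|]; first by rewrite /= ff'.
  apply: (@joinedI _ u f) => //; first by rewrite last_cat.
  move=> b d bT; rewrite !inE => /orP[]/eqP-> bc; last by case: (Hf' b bT bc).
  split=> //; move: bT; rewrite mem_cat mem_seq1 => /orP[bT|/eqP//]; by case: (Hf b bT bc).
- move=> d w cX' wA; apply: H => //; rewrite (perm_mem (perm_cat (perm_refl _) pQ)).
  move: wA; rewrite !(inE, mem_cat, mem_rev).
  by do ?[case/orP=> [->|]; rewrite ?orbT //]; move=> ->; rewrite ?orbT.
Qed.

Lemma mem_catl x s t : x \in s -> x \in s ++ t.
Proof. by rewrite mem_cat => ->. Qed.

Lemma mem_catr x s t : x \in t -> x \in s ++ t.
Proof. by rewrite mem_cat orbC => ->. Qed.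

Lemma reroute_first p a A p' Q q f f' u :
  member (p :: (a :: A) ++ [:: p']) -> (forall x, rank x <= rank p) ->
  member Q -> perm_eq Q [:: q; f; f'] -> uniq ((p :: (a :: A) ++ [:: p']) ++ Q) ->
  adj p q -> adj p' q -> u \in A -> adj u f -> adj f f' ->
  (forall y, adj q y -> y \in [:: p; p'; f; f']) ->
  (forall y, y \in a :: A -> adj y f -> y = u) ->
  (forall y, y \in a :: A -> adj y f' -> False) ->
  (forall b c, b \in Q -> adj b c -> c \in (p :: (a :: A) ++ [:: p']) ++ Q) ->
  (forall c, adj p c -> c \in (p :: (a :: A) ++ [:: p']) ++ Q) ->
  (forall c, adj p' c -> c \in (p :: (a :: A) ++ [:: p']) ++ Q) ->
  (forall y, y \in outer a -> is_end y) -> False.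
Proof.
move=> MP mx MQ pQ U pq p'q uA uf ff' Nq Hf Hf' HQ Hp Hp' Ha.
have na := is_end_interior MP (mem_head a A).
have au : a != u.
  apply: contraTneq (member_uniq MP) => ->.
  by rewrite /= [in X in _ && X]mem_cat uA /= andbF.
have [y oy] := outer_interior na; have ya : y \in outer a by rewrite oy mem_head.
have aPP := interior_in p p' (mem_head a A).
have yQ : y \notin Q.
  apply/negP => yQ; have := outer_adj ya => ay; move: yQ; rewrite (perm_mem pQ) !inE => /or3P[]/eqP ey; subst y.
  - have := Nq a; rewrite adj_sym ay => /(_ isT); rewrite !inE => /or4P[]/eqP ea; subst a.
    + by have := member_uniq MP; rewrite /= inE eqxx.
    + by have := member_uniq MP; rewrite /= [in X in _ && X]mem_cat mem_seq1 eqxx orbT /= andbF.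
    + by apply: (uniq_cat_out U aPP); rewrite (perm_mem pQ) !inE eqxx ?orbT.
    + by apply: (uniq_cat_out U aPP); rewrite (perm_mem pQ) !inE eqxx ?orbT.
  - by move: au; rewrite (Hf a (mem_head _ _) ay) eqxx.
  - by case: (Hf' a (mem_head _ _) ay).
have sz : 1 < size Q by rewrite (perm_size pQ).
apply: (extend MP mx MQ sz U HQ Hp Hp' (mem_head a A) ya yQ (Ha y ya)).
move=> L X x R ML UL pL sR cR cX xa H.
case/splitPr: uA MP U HQ Hp Hp' Hf Hf' UL H au {mx na aPP} => T1 T2 MP U HQ Hp Hp' Hf Hf' UL H au.
have eP : p :: (a :: T1 ++ u :: T2) ++ [:: p'] = p :: a :: T1 ++ u :: T2 ++ [:: p'] by rewrite /= -catA.
have uP := member_uniq MP.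
rewrite eP in MP UL H uP.
apply: (reroute MP MQ pQ UL pq p'q uf ff' Nq _ _ ML pL sR cR cX xa H) => b bT bf.
  have bu : b = u by apply: Hf => //; rewrite inE mem_cat bT orbT.
  by subst b; move: uP; rewrite /= !cat_uniq /= bT /= !andbF.
by apply: (Hf' b) => //; move: bT; rewrite !inE !mem_cat !inE => /orP[->|->]; rewrite ?orbT.
Qed.

(** If u is the first interior vertex, P is read backwards; if it is the only one, the six vertices of P
    and Q form a component. *)
Lemma reroute_any p A p' Q q f f' u :
  member (p :: A ++ [:: p']) -> (forall x, rank x <= rank p) ->
  member Q -> perm_eq Q [:: q; f; f'] -> uniq ((p :: A ++ [:: p']) ++ Q) ->
  adj p q -> adj p' q -> u \in A -> adj u f -> adj f f' ->
  (forall y, adj q y -> y \in [:: p; p'; f; f']) ->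
  (forall y, y \in A -> adj y f -> y = u) ->
  (forall y, y \in A -> adj y f' -> False) ->
  (forall b c, b \in Q -> adj b c -> c \in (p :: A ++ [:: p']) ++ Q) ->
  (forall c, adj p c -> c \in (p :: A ++ [:: p']) ++ Q) ->
  (forall c, adj p' c -> c \in (p :: A ++ [:: p']) ++ Q) ->
  (forall a y, a \in A -> a != u -> y \in outer a -> is_end y) -> False.
Proof.
move=> MP mx MQ pQ U pq p'q uA uf ff' Nq Hf Hf' HQ Hp Hp' Ha.
have uP := member_uniq MP.
case: A MP U uA Hf Hf' HQ Hp Hp' Ha uP => [//|a A] MP U uA Hf Hf' HQ Hp Hp' Ha uP.
have [au|au] := eqVneq a u; last first.
  have uA' : u \in A by move: uA; rewrite inE eq_sym (negPf au).
  apply: (reroute_first MP mx MQ pQ U pq p'q uA' uf ff' Nq Hf Hf' HQ Hp Hp') => y.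
  by apply: Ha; rewrite ?mem_head.
subst u; case/lastP: A MP U uA Hf Hf' HQ Hp Hp' Ha uP => [|A b] MP U uA Hf Hf' HQ Hp Hp' Ha uP.
  exfalso; have := @closed_card ((p :: [:: a] ++ [:: p']) ++ Q) p (mem_catl _ (mem_head p _)) _.
  rewrite size_cat (perm_size pQ) [_ + _](_ : _ = 6) // leqNgt n6 => h; apply: notF; apply: h => x y.
  rewrite mem_cat => /orP[xP xy|]; last exact: HQ.
  move: xP; rewrite !inE => /or3P[]/eqP ex; subst x; [exact: Hp | | exact: Hp'].
  have ap : adj a p by rewrite adj_sym (head_adj MP).
  have ap' : adj a p' by have := member_chordless MP => /= /andP[_ /andP[/andP[]]].
  have pp' := ends_neq MP.
  have fP : f \notin p :: [:: a] ++ [:: p'].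
    by apply/negP => fP; apply: (uniq_cat_out U fP); rewrite (perm_mem pQ) !inE eqxx ?orbT.
  have u3 : uniq [:: p; p'; f].
    rewrite /= !inE !negb_or pp' /= andbT; move: fP; rewrite !inE !negb_or => /and3P[h1 _ h2].
    by rewrite eq_sym h1 eq_sym h2.
  have fQ : f \in Q by rewrite (perm_mem pQ) !inE eqxx ?orbT.
  by case: (neighborsP ap ap' uf u3 xy) => [|[|]] ->; rewrite ?eqxx ?fQ ?orbT.
have ab : b != a.
  apply: contraTneq uP => ->; by rewrite /= [in X in _ && X]mem_cat mem_rcons mem_head andbF.
have bA : b \in a :: rcons A b by rewrite inE mem_rcons mem_head orbT.
have eA : b :: rcons (rev A) a = rev (a :: rcons A b) by rewrite rev_cons rev_rcons.
have mA z : z \in b :: rcons (rev A) a -> z \in a :: rcons A b by rewrite eA mem_rev.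
have mP z : z \in (p :: (a :: rcons A b) ++ [:: p']) ++ Q -> z \in (p' :: (b :: rcons (rev A) a) ++ [:: p]) ++ Q.
  by rewrite eA ![_ \in _ ++ Q]mem_cat mem_flip.
have MP' : member (p' :: (b :: rcons (rev A) a) ++ [:: p]) by rewrite eA; apply: member_flip.
have pp : perm_eq (p' :: (b :: rcons (rev A) a) ++ [:: p]) (p :: (a :: rcons A b) ++ [:: p']).
  by rewrite eA; perm_segments.
apply: (@reroute_first p' b (rcons (rev A) a) p Q q f f' a MP' _ MQ pQ _ p'q pq _ uf ff').
- by move=> x; rewrite -(rank_member MP (mem_head _ _) (last_in _ _ _)).
- by rewrite (perm_uniq (perm_cat pp (perm_refl _))).
- by rewrite mem_rcons mem_head.
- by move=> y /Nq; rewrite !inE => /or4P[]->; rewrite ?orbT.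
- by move=> y /mA; apply: Hf.
- by move=> y /mA; apply: Hf'.
- by move=> c d cQ cd; apply: mP; apply: HQ cd.
- by move=> c h; apply: mP; apply: Hp'.
- by move=> c h; apply: mP; apply: Hp.
- by move=> y; apply: Ha.
Qed.

(** [open_cycle_long] would apply to the two caps, taken in the order of their sizes. *)
Lemma caps_twice p A p' q B q' x D x' : member (p :: A ++ [:: p']) -> caps p p' q -> caps p p' x ->
  member (q :: B ++ [:: q']) -> member (x :: D ++ [:: x']) -> x \notin q :: B ++ [:: q'] -> False.
Proof.
have main r E r' z K z' : member (p :: A ++ [:: p']) -> caps p p' r -> caps p p' z ->
  member (r :: E ++ [:: r']) -> member (z :: K ++ [:: z']) -> z \notin r :: E ++ [:: r'] ->
  size (r :: E ++ [:: r']) <= size (z :: K ++ [:: z']) -> False.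
  move=> MP cr cz Mr Mz zr sz.
  have [rp rp' _ _ _] := caps_outer MP cr; have [zp _ _ _ _] := caps_outer MP cz.
  have rz : r != z by apply: contraNneq zr => <-; rewrite mem_head.
  have U : uniq ((p :: A ++ [:: p']) ++ (r :: E ++ [:: r']) ++ (z :: K ++ [:: z'])).
    apply: uniq_cat3; [exact: (caps_disj MP cr Mr) | exact: (caps_disj MP cz Mz)
      | exact: (uniq_membersC Mr Mz (mem_head _ _) zr)].
  apply: (open_cycle_long MP Mr Mz U (outer_adj rp') (outer_adj zp) (end_neighbors MP cat1_neq0 rp zp rz)
    (head_mem _ cat1_neq0) (caps_nb MP cr Mr) (head_mem _ cat1_neq0) sz).
move=> MP cq cx MQ MX xQ.
have [sz|/ltnW sz] := leqP (size (q :: B ++ [:: q'])) (size (x :: D ++ [:: x'])).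
  exact: (main q B q' x D x').
by apply: (main x D x' q B q' MP cx cq MX MQ) => //; apply: (notin_members MQ MX (mem_head _ _) (mem_head _ _) xQ).
Qed.

Section Capped.
Variables (p : G) (A : seq G) (p' q : G) (B : seq G) (q' : G).
Hypothesis MP : member (p :: A ++ [:: p']).
Hypothesis maxP : forall x, rank x <= rank p.
Hypothesis cq : caps p p' q.
Hypothesis MQ : member (q :: B ++ [:: q']).

Let P := p :: A ++ [:: p'].
Let Q := q :: B ++ [:: q'].

(** On a capped path, an interior vertex has charge at least 4 unless it pays to an end. *)
Lemma balanced_int a y : a \in A -> y \in outer a -> charge a = 0%R -> is_end y.
Proof.
move=> aA ya fa; apply/negPn/negP => ny.
have ca : capped a by apply: (caps_capped MP cq); apply: interior_in.
by have := capped_interior_ge4 (is_end_interior MP aA) ca ya ny; rewrite fa.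
Qed.

(** All interior vertices of P have charge 0, so their outer neighbours are ends. If Q has two vertices,
    it is a detour for [longest_end_interior], entered from p'. Otherwise [cross] forces an edge from p' to
    the interior of Q, [tri_cut] and [tri_cut3] leave only Q = q x q', and then [reroute_any] applies. *)
Lemma tri_case : ~~ linked A B -> q' \in outer p -> ~~ adj q' p' -> charge p = (- 1)%R ->
  charge p' = 1%R ->
  (forall y, y \in outer p' -> y != q -> ~~ is_end y) -> False.
Proof.
move=> nl q'p nq'p' fp fp' Hp'.
have [qp qp' pq pq' fr] := caps_outer MP cq.
have U := caps_disj MP cq MQ.
have [x [xo xq ux _ _]] := caps_other (member_flip MP) (caps_flip MP cq).
have Nq := caps_nb MP cq MQ.
have qq' : q != q' := ends_neq MQ.
have Np := end_neighbors MP cat1_neq0 qp q'p qq'.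
have qx : q != x by rewrite eq_sym.
have Np' := end_neighbors (member_flip MP) cat1_neq0 qp' xo qx.
have Eq' : is_end q' := @is_end_last q' (q :: B) MQ.
have nsq' : ~~ single q' by rewrite (nonsingle MQ (last_in _ _ _)).
have Ep := is_end_head MP.
have rq' : rank q' < rank p.
  by rewrite (rank_member MQ (last_in _ _ _) (mem_head _ _)); case/and5P: cq.
have pq'o : p \in outer q' by rewrite outer_sym.
have q'P z : z \in outer q' -> z \in P.
  by move=> zq; rewrite -(mem_path_of_member z MP (mem_head _ _)); apply: (captive_nb Eq' Ep nsq' pq'o rq' zq).
have qPn z : z \in Q -> z \notin P by move=> zQ; apply/negP => zP; apply: (uniq_cat_out U zP zQ).
have fA a : a \in A -> charge a = 0%R.
  move=> aA; have := balance0_split MP; have := sum_int1 MP aA.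
  have := charge_interior_ge0 (is_end_interior MP aA).
  by rewrite fp fp'; move: (charge a) (\sum_(x <- A) charge x)%R; clear; lia.
have EA a y (aA : a \in A) (ya : y \in outer a) : is_end y := balanced_int aA ya (fA a aA).
have hA : head p (A ++ [:: p']) \in A ++ [:: p'] := head_mem _ cat1_neq0.
have hB : head q (B ++ [:: q']) \in B ++ [:: q'] := head_mem _ cat1_neq0.
have hrA : head p' (rev A ++ [:: p]) \in p :: A.
  by have := head_mem p' (@cat1_neq0 (rev A) p); rewrite mem_cat mem_rev mem_seq1 inE orbC.
have pq0 := outer_adj qp; have p'q := outer_adj qp'; have p'x := outer_adj xo; have pq'0 := outer_adj q'p.
have xP : x \notin P by rewrite -mem_flip; apply: (outer_notin (member_flip MP) (mem_head _ _) xo).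
have pout z : z \in Q -> adj p z -> z = q \/ z = q'.
  by move=> zQ /Np[|] // ez; move: (qPn z zQ); rewrite ez inE hA orbT.
have p'out z : z \in Q -> adj p' z -> z = q \/ z = x.
  move=> zQ /Np'[|] // ez; move: (qPn z zQ); rewrite ez /P -cat_cons mem_cat hrA //.
have qout z : z \in P -> adj q z -> z = p \/ z = p'.
  by move=> zP /Nq[|] // ez; have := qPn z _; rewrite zP ez => h; have := h; rewrite inE hB orbT => /(_ isT).
have uP := member_uniq MP.
have pA : p \notin A by move: uP; rewrite /= mem_cat; case/andP => /norP[].
have p'A : p' \notin A by move: uP; rewrite /= cat_uniq /= orbF => /and4P[_ _ ->].
have qB : q \notin B by have := member_uniq MQ; rewrite /= mem_cat; case/andP => /norP[].
have q'B : q' \notin B by have := member_uniq MQ; rewrite /= cat_uniq /= orbF => /and4P[_ _ ->].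
have qA a : a \in A -> adj q a -> False.
  by move=> aA /(qout _ (interior_in p p' aA))[] ea; subst a; [rewrite aA in pA | rewrite aA in p'A].
have szB := caps_size MP cq MQ.
have szQ : size Q <= size A + 2 by rewrite /Q /= size_cat /= addn1 addn2.
have nAB a b : a \in A -> b \in B -> adj a b -> False.
  by move=> aA bB ab; case/negP: nl; apply/linkedP; exists a, b.
have BQ b : b \in B -> b \in Q by move=> bB; rewrite inE mem_cat bB orbT.
(* The new path ending in p' is q' q p'. *)
have [B0|nB] := eqVneq B [::].
  have MQ2 : member [:: q; q'] by have := MQ; rewrite B0.
  have eQ : Q = [:: q; q'] by rewrite /Q B0.
  apply: (longest_end_interior (R := [:: q; q']) (g := q) (X := [:: q'; q]) (X' := rev A ++ [:: p]) (y := x) (member_flip MP)) => //.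
  - by move=> z; have := max_size MP maxP (s := z); rewrite /= !size_cat size_rev.
  - by rewrite -eQ (perm_uniq (s2 := P ++ Q)) // /P; perm_segments.
  - exact: mem_head.
  - move=> a b aQ ab; have {aQ} [ea|ea] : a = q \/ a = q' by move: aQ; rewrite !inE => /orP[]/eqP->; auto.
      subst a; case: (Nq b ab) => [|[|]] ->; [left | right | right; exact: mem_head].
        by rewrite B0 /= !inE eqxx orbT.
      exact: last_in.
    subst a.
    have [bQ|bQ] := boolP (b \in Q); first by left; move: bQ; rewrite eQ !inE.
    by right; rewrite mem_flip; apply: q'P; apply: (outerI MQ (last_in _ _ _) ab bQ).
  - by perm_segments.
  - by move=> z; rewrite !inE orbC.
  - have q'q : adj q' q by rewrite adj_sym; have := member_chordless MQ2 => /= /andP[/andP[]].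
    by rewrite /= q'q [adj q p']adj_sym p'q nq'p'.
  - exact: (@chordless_catr _ [:: p'] _ (member_chordless (member_flip MP))).
  - rewrite !inE negb_or xq; apply: contraNneq nq'p' => <-; by rewrite adj_sym.
  - exact: Hp'.
  - move=> w wp; have [->|wq] := eqVneq w q; first by rewrite mem_head.
    by case: (outer_pair MP cat1_neq0 qp q'p qq' wp) => ->; rewrite !inE eqxx ?orbT.
  - move=> a b; rewrite mem_rev => aA bx ab; apply: (EA a) => //.
    apply: (outerI MP (interior_in p p' aA) ab); apply: contraNN xP => bP.
    by rewrite -(mem_path_of_member x MP bP) (path_of_same bx) mem_path_of.
(* Otherwise no further edge would disturb [cross]. *)
have xB : x \in B.
  apply/negPn/negP => xB; apply: (cross MP MQ U _ nB p'q pq'0 _ szB).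
    by rewrite -size_eq0 -lt0n; apply: leq_trans szB; rewrite lt0n size_eq0.
  move=> a b; rewrite mem_cat mem_seq1 inE => /orP[aA|/eqP->] /orP[/eqP->|bB] ab //.
  - by case: (qA a aA); rewrite adj_sym.
  - by case: (nAB a b).
  - by case: (p'out b (BQ b bB) ab) => eb; subst b; [rewrite bB in qB | rewrite bB in xB].
have BQ' b : b \in B -> adj p b -> False.
  by move=> bB /(pout b (BQ b bB))[] eb; subst b; [rewrite bB in qB | rewrite bB in q'B].
have p'B b : b \in B -> adj p' b -> b = x.
  by move=> bB /(p'out b (BQ b bB))[] // eb; subst b; rewrite bB in qB.
have nq'p'0 : adj p' q' -> False by rewrite adj_sym => h; rewrite h in nq'p'.
have [B1 [B2 eB]] : exists B1 B2, B = B1 ++ x :: B2 by case/splitPr: xB => B1 B2; exists B1, B2.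
have uB : uniq B by have := member_uniq MQ; rewrite /= cat_uniq => /and3P[_].
case: B1 eB => [|b B1] eB; last first.
  have eQ : Q = q :: b :: B1 ++ x :: B2 ++ [:: q'] by rewrite /Q eB /= -catA.
  have MQ1 : member (q :: b :: B1 ++ x :: B2 ++ [:: q']) by rewrite -eQ.
  have U1 := U; rewrite -/Q eQ in U1; rewrite eQ in szQ.
  apply: (tri_cut MP MQ1 U1 pq0 p'x _ _ _ szQ).
  - by move: Nq; rewrite eB.
  - move=> a c; rewrite inE => /orP[/eqP->|aA] cB; last by apply: nAB => //; rewrite eB mem_cat cB.
    by apply: BQ'; rewrite eB mem_cat cB.
  - move=> c; rewrite mem_cat mem_seq1 => /orP[cB|/eqP->] // p'c.
    have ec : c = x by apply: p'B => //; rewrite eB; apply: mem_catr; rewrite inE cB orbT.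
    by move: uB; rewrite eB -ec cat_uniq /= cB !andbF.
case: B2 eB => [|b B2] eB; last first.
  have eQ : Q = q :: x :: b :: B2 ++ [:: q'] by rewrite /Q eB.
  have MQ1 : member (q :: x :: b :: B2 ++ [:: q']) by rewrite -eQ.
  have U1 := U; rewrite -/Q eQ in U1; rewrite eQ in szQ.
  apply: (tri_cut3 MP MQ1 U1 pq0 pq'0 p'x _ _ hrA _ szQ).
  - by move: Nq; rewrite eB.
  - by move=> z /Np'[|[|]]; auto.
  - by move=> a c aA cB; apply: nAB aA _; rewrite eB.
have MQ3 : member [:: q; x; q'] by have := MQ; rewrite eB.
have eQ : Q = [:: q; x; q'] by rewrite /Q eB.
have xq' : adj x q' by have := member_chordless MQ3 => /= /andP[_ /andP[/andP[]]].
have [u [uo up]] : exists u, u \in outer q' /\ u != p.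
  have [c [d h]] := outer_end (member_flip MQ) cat1_neq0; have := outer_uniq q'; rewrite h /= inE andbT => cd.
  by move: pq'o; rewrite h !inE => /orP[]/eqP->; [exists d | exists c]; rewrite ?inE ?eqxx ?orbT // eq_sym.
have q'u := outer_adj uo.
have uA : u \in A.
  have := q'P u uo; rewrite inE mem_cat mem_seq1 (negPf up) /= => /orP[//|/eqP eu].
  by subst u; rewrite q'u in nq'p'.
have pu : p != u by rewrite eq_sym.
have Nq' := end_neighbors (member_flip MQ) cat1_neq0 pq'o uo pu; rewrite eB /= in Nq'.
have Nq3 := Nq; rewrite eB /= in Nq3.
have x3 : x \in outer p' := xo.
have Nx := interior_neighbors (s1 := [::]) (y := p') MQ3 _.
have {}Nx := Nx _; have {Nx}Nx : forall z, adj x z -> z = q \/ z = q' \/ z = p' by apply: Nx; rewrite outer_sym.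
have pPQ z : z \in P -> z \in P ++ [:: q; x; q'] by move=> zP; apply: mem_catl.
have qPQ z : z \in [:: q; x; q'] -> z \in P ++ [:: q; x; q'] by move=> zP; apply: mem_catr.
rewrite -/P -/Q eQ in U.
apply: (reroute_any MP maxP MQ3 _ U pq0 p'q uA _ _ _ _ _ _ _ _ _ (f := q') (f' := x)).
- perm_segments.
- by rewrite adj_sym.
- by rewrite adj_sym.
- by move=> z /Nq3[|[|]] ->; rewrite !inE eqxx ?orbT.
- move=> z zA; rewrite adj_sym => /Nq'[ez|[ez|//]]; subst z.
    by have := qPn x (BQ x xB); rewrite interior_in.
  by rewrite zA in pA.
- by move=> z zA; apply: nAB.
- move=> b c; rewrite !inE => /or3P[]/eqP->.
  + by move/Nq3 => [|[|]] ->; [apply: qPQ; rewrite !inE eqxx orbT | apply: pPQ; apply: mem_head | apply: pPQ; apply: last_in].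
  + by move/Nx => [|[|]] ->; [apply: qPQ; apply: mem_head | apply: qPQ; rewrite !inE eqxx !orbT | apply: pPQ; apply: last_in].
  + by move/Nq' => [|[|]] ->; [apply: qPQ; rewrite !inE eqxx orbT | apply: pPQ; apply: mem_head | apply: pPQ; apply: interior_in].
- move=> c /Np[|[|]] ->; [apply: pPQ | apply: qPQ; apply: mem_head | apply: qPQ; rewrite !inE eqxx !orbT //].
  by rewrite inE hA orbT.
- move=> c /Np'[|[|]] ->; [apply: pPQ | apply: qPQ; apply: mem_head | apply: qPQ; rewrite !inE eqxx !orbT //].
  by rewrite /P -cat_cons mem_cat hrA.
- by move=> a y aA _; apply: EA.
Qed.

(** The value -4 needs a second contribution -1, that is, a second cap. *)
Lemma charge_end_min z : caps p p' z -> charge p = (- 4%:Z)%R ->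
  exists x, [/\ x \in outer p, x != z & caps p p' x].
Proof.
move=> cz fp; have [x [xp xz _ ef gx]] := caps_other MP cz; exists x; split=> //.
rewrite fp gx in ef; have xP := outer_notin MP (mem_head _ _) xp.
have px := outer_adj xp.
move: ef; case Ex : (is_end x) => //; case sx : (single x) => //; case xp' : (adj x p') => // _.
by apply/and5P; split=> //; rewrite ?sx // 1?adj_sym // (max_rank MP maxP xP).
Qed.

(** By [cross_cut], the second vertex of the path of the cap has a neighbour on P, and u is the only candidate. *)
Lemma hit_first u z b K z' : member (z :: (b :: K) ++ [:: z']) -> caps p p' z -> z' \in outer p ->
  z' \in outer p' ->
  (forall a y, a \in A -> a != u -> y \in outer a -> is_end y) -> adj u b.
Proof.
move=> Mz cz z'p z'p' EA; apply/negPn/negP => nub.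
have [zp zp' _ _ _] := caps_outer MP cz.
have zz' := ends_neq Mz.
have U := caps_disj MP cz Mz.
have bK : b \in b :: K := mem_head _ _.
have bZ : b \in z :: (b :: K) ++ [:: z'] by rewrite !inE eqxx orbT.
have nb := is_end_interior Mz bK.
have szK : size (z :: b :: K ++ [:: z']) <= size A + 2.
  by have := caps_size MP cz Mz; rewrite /= size_cat /=; clear; lia.
apply: (cross_cut MP Mz U (outer_adj zp') (outer_adj z'p) (end_neighbors MP cat1_neq0 zp z'p zz') (head_mem _ cat1_neq0)
  (caps_nb MP cz Mz) _ szK).
have oP a : a \in P -> adj a b -> b \in outer a.
  by move=> aP0 ab; apply: (outerI MP aP0 ab); apply/negP => bP; apply: (uniq_cat_out U bP bZ).
move=> a; rewrite mem_cat mem_seq1 => /orP[aA|/eqP->] ab.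
  have au : a != u by apply: contraNneq nub => <-.
  by move: (EA a b aA au (oP a (interior_in p p' aA) ab)); rewrite (negPf nb).
have bo := oP p' (last_in _ _ _) ab.
move: nb; case: (outer_pair (member_flip MP) cat1_neq0 zp' z'p' zz' bo) => ->.
  by rewrite (is_end_head Mz).
by rewrite (@is_end_last z' (z :: b :: K)).
Qed.

(** The link is worth 8, so both ends of P have charge -4 and no other interior vertex has positive
    charge. Hence the second cap at p belongs to Q by [caps_twice], so it is q', and u is adjacent to the
    second vertex of Q from either end by [hit_first]. Thus Q = q c q', and [reroute_any] applies. *)
Lemma linked_case u w : u \in A -> w \in B -> adj u w -> False.
Proof.
move=> uA wB uw; have fu := charge_linked MP cq MQ uA wB uw.
have hz := balance0_split MP.
have s1 := sum_int1 MP uA.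
have cq' := caps_flip MP cq.
have f1 := caps_charge_lb MP cq; have f2 := caps_charge_lb (member_flip MP) cq'.
have fp : charge p = (- 4%:Z)%R.
  by move: hz s1 f1 f2; rewrite fu; move: (charge p) (charge p') (\sum_(x <- A) charge x)%R; clear; lia.
have EA a y : a \in A -> a != u -> y \in outer a -> is_end y.
  move=> aA au ya; apply: (balanced_int aA ya).
  have ua : u != a by rewrite eq_sym.
  have := sum_int2 MP uA aA ua; have := charge_interior_ge0 (is_end_interior MP aA).
  by move: hz f1 f2; rewrite fu; move: (charge a) (charge p) (charge p') (\sum_(x <- A) charge x)%R; clear; lia.
have [x [xp xq cx]] := charge_end_min cq fp.
have xQ : x \in Q.
  apply/negPn/negP => xQ; have [D [x' MX]] := caps_member MP cx.
  exact: (caps_twice MP cq cx MQ MX xQ).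
have ex : x = q'.
  by case/and5P: cx => Ex _ _ _ _; move: Ex; rewrite (is_endE MQ xQ) (negPf xq) => /eqP.
subst x; have [q'p q'p' pq' p'q' _] := caps_outer MP cx.
have [qp qp' pq p'q _] := caps_outer MP cq.
have U := caps_disj MP cq MQ.
have wo : w \in outer u.
  by apply: (outerI MP (interior_in p p' uA) uw); apply/negP => wP; apply: (uniq_cat_out U wP); rewrite inE mem_cat wB orbT.
have nu := is_end_interior MP uA.
have hit b : b \in outer u -> b = w by move=> bo; apply: (outer_interior_eq nu bo wo).
have [c eB] : exists c, B = [:: c].
  have uQ := member_uniq MQ; have hob b : b \in q :: B ++ [:: q'] -> adj u b -> b = w.
    move=> bQ ub; apply: hit; apply: (outerI MP (interior_in p p' uA) ub); apply/negP => bP.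
    exact: (uniq_cat_out U bP bQ).
  case: (B) MQ wB hob uQ => [//|b K] MQ1 _ hob uQ; exists b.
  have eb : b = w.
    apply: hob; first by rewrite !inE eqxx orbT.
    exact: (hit_first MQ1 cq q'p q'p' EA).
  case/lastP: K MQ1 hob uQ => // K d MQ1 hob uQ; exfalso.
  have := member_flip MQ1; rewrite rev_cons rev_rcons /= => MQ2.
  have ed : d = w.
    apply: hob; first by rewrite !inE mem_cat mem_rcons mem_head !orbT.
    exact: (hit_first MQ2 cx qp qp' EA).
  by move: uQ; rewrite eb ed /= [in X in _ && (X && _)]mem_cat mem_rcons mem_head /= andbF.
have ew : w = c by move: wB; rewrite eB inE => /eqP.
subst w; have MQ3 : member [:: q; c; q'] by have := MQ; rewrite eB.
have eQ : q :: B ++ [:: q'] = [:: q; c; q'] by rewrite eB.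
rewrite eQ in U.
have pp' := ends_neq MP; have qq' := ends_neq MQ.
have Np := end_neighbors MP cat1_neq0 qp q'p qq'.
have Np' := end_neighbors (member_flip MP) cat1_neq0 qp' q'p' qq'.
have Nq := end_neighbors MQ cat1_neq0 pq p'q pp'; rewrite eB /= in Nq.
have Nq' := end_neighbors (member_flip MQ) cat1_neq0 pq' p'q' pp'; rewrite eB /= in Nq'.
have uc : u \in outer c by rewrite outer_sym.
have Nc := interior_neighbors (s1 := [::]) MQ3 uc.
have pPQ z : z \in P -> z \in P ++ [:: q; c; q'] by move=> zP; apply: mem_catl.
have qPQ z : z \in [:: q; c; q'] -> z \in P ++ [:: q; c; q'] by move=> zP; apply: mem_catr.
have cQ : c \in [:: q; c; q'] by rewrite !inE eqxx orbT.
have q'Q : q' \in [:: q; c; q'] by rewrite !inE eqxx !orbT.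
have hA : head p (A ++ [:: p']) \in A ++ [:: p'] := head_mem _ cat1_neq0.
have hrA : head p' (rev A ++ [:: p]) \in p' :: rev A ++ [:: p] by rewrite inE head_mem ?cat1_neq0 // orbT.
rewrite mem_flip in hrA.
have uP := member_uniq MP.
apply: (reroute_any MP maxP MQ3 _ U (outer_adj qp) (outer_adj qp') uA _ _ _ _ _ _ _ _ EA (f := c) (f' := q')).
- exact: perm_refl.
- exact: outer_adj wo.
- by have := member_chordless MQ3 => /= /andP[_ /andP[/andP[]]].
- by move=> z /Nq[|[|]] ->; rewrite !inE eqxx ?orbT.
- move=> z zA; rewrite adj_sym => /Nc[|[|]] // ez; exfalso; subst z.
    by apply: (uniq_cat_out U (interior_in p p' zA)); rewrite mem_head.
  by apply: (uniq_cat_out U (interior_in p p' zA)).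
- move=> z zA; rewrite adj_sym => /Nq'[|[|]] ez; subst z.
  + exact: (uniq_cat_out U (interior_in p p' zA)).
  + by move: uP; rewrite /= mem_cat zA.
  + by move: uP; rewrite /= cat_uniq /= zA !andbF.
- move=> b d bQ bd; have : b = q \/ b = c \/ b = q' by move: bQ; rewrite !inE => /or3P[]/eqP->; auto.
  case=> [eb|[eb|eb]]; subst b.
  + by case: (Nq d bd) => [|[|]] ->; [apply: qPQ | apply: pPQ; apply: mem_head | apply: pPQ; apply: last_in].
  + by case: (Nc d bd) => [|[|]] ->; [apply: qPQ; apply: mem_head | apply: qPQ | apply: pPQ; apply: interior_in].
  + by case: (Nq' d bd) => [|[|]] ->; [apply: qPQ | apply: pPQ; apply: mem_head | apply: pPQ; apply: last_in].
- by move=> d /Np[|[|]] ->; [apply: pPQ; rewrite inE hA orbT | apply: qPQ; apply: mem_head | apply: qPQ].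
- by move=> d /Np'[|[|]] ->; [apply: pPQ | apply: qPQ; apply: mem_head | apply: qPQ].
Qed.

(** Balance 0 leaves charge at most 4 at the first interior vertex a of P, so its neighbour y lies on a
    capped path, and by [capped_charge_pos] this path has the same form as P: [hub_hub] applies. *)
Lemma hub_case : B = [::] -> q' \in outer p -> q' \in outer p' -> False.
Proof.
move=> B0 q'p q'p'; have MQ2 : member [:: q; q'] by have := MQ; rewrite B0.
have [qp qp' pq p'q _] := caps_outer MP cq.
have [Np Np' Nq Nq'] := hub_neighbors MP MQ2 cq q'p q'p'.
have [a [A1 eA]] : exists a A1, A = a :: A1.
  by case: (A) (max_int MP maxP) => // a A1 _; exists a, A1.
have aA : a \in A by rewrite eA mem_head.
have MP1 : member (p :: (a :: A1) ++ [:: p']) by rewrite -eA.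
have na := is_end_interior MP aA.
have [y oy] := outer_interior na; have ya : y \in outer a by rewrite oy mem_head.
have ay : a \in outer y by rewrite outer_sym.
have ny : ~~ is_end y := hub_outer_interior MP1 MQ2 cq q'p q'p' ya.
have ca : capped a by apply: (caps_capped MP cq (interior_in p p' aA)).
have cy : capped y.
  case: (hub_other MP MQ2 cq q'p q'p' aA) => [A0|[x [xA xa fx]]].
    have hA1 : size A = 1 by rewrite A0.
    by have := all_size3 MP maxP hA1 MQ2.
  have [_|ncy] := boolP (capped y); [by [] | exfalso]; have := sum_int2 MP xA aA xa.
  rewrite (charge_interior na ya) (negPf ny) ca (negPf ncy).
  have := balance0_split MP.
  have := caps_charge_lb MP cq; have := caps_charge_lb (member_flip MP) (caps_flip MP cq).
  by move: fx; move: (charge x) (charge p) (charge p') (\sum_(x <- A) charge x)%R; clear; lia.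
have aPP := interior_in p p' aA.
have yP := outer_notin MP aPP ya.
have yQ := hub_notin MP MQ2 cq q'p q'p' aA ya.
have [Y1 [r [Y2 [o' MY]]]] := interior_split ny.
have [o [C [eY yC]]] : exists o C, Y1 ++ r :: y :: Y2 ++ [:: o'] = o :: C ++ [:: o'] /\ y \in C.
  case: (Y1) => [|z T]; first by exists r, (y :: Y2); rewrite mem_head.
  by exists z, (T ++ r :: y :: Y2); rewrite /= -catA mem_cat !inE eqxx !orbT.
rewrite eY in MY; have yY : y \in o :: C ++ [:: o'] by rewrite inE mem_cat yC orbT.
have [e ce] := elimT (cappedP MY yY) cy.
have [K [e' ME]] := caps_member MY ce.
have re : rank e < rank o by case/and5P: ce.
have eP := max_captive MP maxP re.
have aE : a \notin e :: K ++ [:: e'].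
  apply: contraNN eP => aE.
  by rewrite -(mem_path_of_member e MP aPP) (mem_path_of_member e ME aE) mem_head.
have fy : charge y = 4%R by rewrite (charge_interior ny ay) (negPf na) cy ca.
have [] := capped_charge_pos MY yC _ ay ce ME aE; first by rewrite fy.
move=> K0 e'o e'o' _; subst K; rewrite /= in ME.
have [eo eo' oe o'e _] := caps_outer MY ce.
have [No No' Ne Ne'] := hub_neighbors MY ME ce e'o e'o'.
have [C1 [D [eC [h1 [h2 [h1C h2D Ny]]]]]] := interior_in_split MY yC.
have eYY : o :: C ++ [:: o'] = o :: C1 ++ y :: D ++ [:: o'] by rewrite eC -catA.
have MY' : member (o :: C1 ++ y :: D ++ [:: o']) by rewrite -eYY.
have eQ : e \notin [:: q; q'].
  have oP z : z \in [:: q; q'] -> adj z o -> False.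
    have oPP := notin_members MY MP yY aPP (notin_members MP MY aPP yY yP).
    have out z0 : z0 \in o :: C ++ [:: o'] -> z0 \notin P /\ z0 \notin [:: q; q'].
      move=> zY; split; [apply: contraNN yP => zP | apply: contraNN yQ => zQ].
        by rewrite -(mem_path_of_member y MP zP) (mem_path_of_member y MY zY).
      by rewrite -(mem_path_of_member y MQ2 zQ) (mem_path_of_member y MY zY).
    have [h3 h4] := out o (mem_head _ _).
    rewrite !inE => /orP[]/eqP-> => [/Nq|/Nq'] [ez|[ez|ez]];
      rewrite ez in h3 h4; first [by rewrite !inE eqxx ?orbT in h4 | by rewrite mem_head in h3 | by rewrite last_in in h3].
  by apply/negP => eQ; apply: (oP e eQ); apply: (outer_adj oe).
have U : uniq ((p :: a :: A1 ++ [:: p']) ++ [:: q; q'] ++ (o :: C1 ++ y :: D ++ [:: o']) ++ [:: e; e']).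
  rewrite -eYY; apply: uniq_cat4.
  - exact: (caps_disj MP1 cq (MQ2 : member (q :: [::] ++ [:: q']))).
  - by apply: (uniq_membersC MP1 MY yY); have := yP; rewrite eA.
  - by apply: (uniq_membersC MP1 ME (mem_head _ _)); have := eP; rewrite eA.
  - apply: uniq_cat3; [exact: (uniq_membersC MQ2 MY yY yQ) | exact: (uniq_membersC MQ2 ME (mem_head _ _) eQ) | ].
    exact: (uniq_membersC MY ME (mem_head _ _) (outer_notin MY (mem_head _ _) eo)).
have MP0 : member ([::] ++ p :: a :: head p' (A1 ++ [:: p']) :: behead (A1 ++ [:: p'])).
  by move: MP1; case: (A1).
have hh : head p' (A1 ++ [:: p']) \in A1 ++ [:: p'] := head_mem _ cat1_neq0.
rewrite eA /= in Np.
exact: (hub_hub MP1 MQ2 MY' ME U (outer_adj qp) (outer_adj q'p') (outer_adj ya) (outer_adj eo) (outer_adj e'o')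
  Np Nq Nq' (interior_neighbors MP0 ya) hh (Ny a ay) h1C h2D Ne Ne').
Qed.

End Capped.

Lemma max_uncapped p A p' : member (p :: A ++ [:: p']) -> (forall x, rank x <= rank p) -> ~~ capped p.
Proof.
move=> MP mx; apply/negP => /(cappedP MP (mem_head _ _))[q cq].
have [B [q' MQ]] := caps_member MP cq.
have hz := balance0_split MP.
have sA := sum_int MP.
case: (caps_cases MP cq MQ) => [[e1 e2]|/linkedP[u [w [uA wB uw]]]|[nl [[h1 h2 h3 h4 h5]|[h1 h2 h3 h4 h5]]]|[eB h1 h2]].
- by move: hz sA; rewrite e1 e2; move: (\sum_(x <- A) charge x)%R; clear; lia.
- exact: (linked_case MP mx cq MQ uA wB uw).
- exact: (tri_case MP mx cq MQ nl h1 h2 h3 h4 h5).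
- apply: (tri_case (member_flip MP) _ (caps_flip MP cq) MQ _ h1 h2 h3 h4 h5).
    by move=> x; rewrite -(rank_member MP (mem_head _ _) (last_in _ _ _)).
  apply: contraNN nl => /linkedP[u [w [uA wB uw]]]; apply/linkedP; exists u, w.
  by rewrite mem_rev in uA.
- exact: (hub_case MP mx cq MQ eB h1 h2).
Qed.

(** Everything has been shown for a path of largest rank; not all paths are single by counting. *)
Lemma no_equality : False.
Proof.
have [F0|/hasP[r rF _]] : F = [::] \/ has predT F by case: (F) => [|r T]; auto.
  by move: n6; rewrite cardG F0.
have [x xr] : exists x, x \in r by move/member_F/(member_ne): rF; case: (r) => // x r' _; exists x; apply: mem_head.
pose p0 := [arg max_(z > x) rank z].
have mx0 z : rank z <= rank p0 by rewrite /p0; case: arg_maxnP => // p1 _; apply.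
have Mp := member_path_of p0.
case: (member_cases Mp) => [[v [ev sv]]|[p [A [p' eP]]]].
  have h : forall s, s \in F -> size s <= 1.
    move=> s sF; have := member_ne (member_F sF); case: s sF => // z s sF _.
    by rewrite -(size_path_of_member (member_F sF) (mem_head z s)) -[1]/(size [:: v]) -ev rank_size.
  have := card_members rF h; have := h r rF; move: n6; rewrite cardG; clear; lia.
rewrite eP in Mp; have pP : p0 \in p :: A ++ [:: p'] by rewrite -eP mem_path_of.
have mx z : rank z <= rank p by rewrite -(rank_member Mp pP (mem_head _ _)).
exact: (uncapped_max Mp mx (max_uncapped Mp mx)).
Qed.

End Tight.

End Optimal.

(** * From factors to the induced path number *)

Section Translate.
Variable G : sgraph.
Implicit Types (x y u v : G) (s t : seq G) (F : seq (seq G)).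

Lemma path_adj_sym s u v : path_adj s u v = path_adj s v u.
Proof. by rewrite /path_adj orbC. Qed.

Lemma path_adj_cons x s u v : x \notin s -> u \in s -> v \in s ->
  path_adj (x :: s) u v = path_adj s u v.
Proof.
move=> xs us vs; have nx y : y \in s -> (x == y) = false.
  by move=> ys; apply: contraNF xs => /eqP->.
by rewrite /path_adj /= !nx // !eqSS.
Qed.

Lemma path_adj_head x s u : x \notin s -> u \in s -> path_adj (x :: s) x u = (u == head x s).
Proof.
move=> xs us; rewrite /path_adj /= eqxx; have -> : (x == u) = false by apply: contraNF xs => /eqP->.
rewrite orbF eqSS; case: s us {xs} => // y s us /=; by rewrite [y == u]eq_sym; case: (u == y).
Qed.

Lemma chordless_cons x s : uniq (x :: s) ->
  reflect ({in s, forall u, adj x u = (u == head x s)} /\ chordless s) (chordless (x :: s)).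
Proof.
move=> /andP[xs us]; apply: (iffP andP) => -[h cs]; split=> //.
  case: s h us {xs cs} => // y s /andP[xy /allP h] /andP[ys _] u; rewrite inE => /orP[/eqP->|us] /=.
    by rewrite xy eqxx.
  by rewrite (negPf (h u us)); apply/esym/negbTE; apply: contraNneq ys => <-.
case: s h us {xs cs} => // y s h /andP[ys _]; rewrite h ?mem_head //= eqxx /=; apply/allP => z zs.
by rewrite h ?inE ?zs ?orbT //=; apply: contraNneq ys => <-.
Qed.

Lemma chordlessP s : uniq s -> reflect {in s &, forall u v, path_adj s u v = adj u v} (chordless s).
Proof.
elim: s => [|x s IH] us; first by constructor.
have /andP[xs us'] := us.
apply: (iffP (chordless_cons us)) => [[h /(IH us') cs] u v|h].
  rewrite !inE => /orP[/eqP->|us0] /orP[/eqP->|vs].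
  - by rewrite adj_irrefl /path_adj /= eqxx.
  - by rewrite path_adj_head // h.
  - by rewrite path_adj_sym adj_sym path_adj_head // h.
  - by rewrite path_adj_cons // cs.
split; last by apply/(IH us') => u v us0 vs; rewrite -(path_adj_cons xs us0 vs) h // inE ?us0 ?vs orbT.
by move=> u us0; rewrite -path_adj_head // h // ?mem_head // inE us0 orbT.
Qed.

Lemma is_induced_pathE s : is_induced_path s = [&& s != [::], uniq s & chordless s].
Proof.
apply/idP/and3P => [/andP[/and3P[-> us _] /forall_inP h]|[ne us cs]].
  split=> //; apply/(chordlessP us) => u v us0 vs; apply/eqP.
  by have /forall_inP := h u us0; apply.
rewrite /is_induced_path /is_path ne us /=; apply/andP; split.
  elim: s us cs {ne} => // x [|y s] IH // /andP[_ us] /andP[/andP[xy _] cs].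
  by rewrite /= xy; apply: IH.
by apply/forall_inP => u us0; apply/forall_inP => v vs; apply/eqP/(chordlessP us).
Qed.

(** The vertex sets of the lists form the required partition. *)
Lemma factor_ipf F : factor F -> has_ipf_of_size G (size F).
Proof.
move=> facF; have uF : uniq F := uniq_flatten (fac_ne facF) (fac_un facF).
have ne s : s \in F -> exists x, x \in s.
  by case: s => [h|x s _]; [have := fac_ne facF; rewrite h | exists x; apply: mem_head].
have us s : s \in F -> uniq s.
  have := fac_un facF; elim: (F) => //= r A IH; rewrite cat_uniq => /and3P[ur _ u].
  by rewrite inE => /orP[/eqP->|/(IH u)].
pose f s : {set G} := [set:: s].
have fE s x : (x \in f s) = (x \in s) by rewrite inE.
have finj : {in F &, injective f}.
  move=> s t sF tF e; have [x xs] := ne s sF.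
  by apply: (flatten_inj (fac_un facF) sF tF xs); rewrite -fE -e fE.
pose X : {set {set G}} := [set:: map f F].
have XP A : reflect (exists2 s, s \in F & A = f s) (A \in X) by rewrite inE; apply: mapP.
apply/existsP; exists X; apply/andP; split; last first.
  apply/eqP; rewrite cardsE -(size_map f); apply/card_uniqP.
  by rewrite map_inj_in_uniq.
apply/andP; split; last first.
  apply/forall_inP => A /XP[s sF ->]; apply/existsP.
  have sz : size s == #|f s| by rewrite cardsE; apply/eqP/esym/card_uniqP; apply: us.
  exists (Tuple sz); rewrite eqxx is_induced_pathE us // (allP (fac_chordless facF)) // !andbT /=.
  by have [x] := ne s sF; case: (s).
apply/and3P; split.
- apply/eqP/setP => x; rewrite inE; have /flattenP[s sF xs] := fac_full facF x.
  by apply/bigcupP; exists (f s); [apply/XP; exists s | rewrite fE].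
- apply/trivIsetP => A B /XP[s sF ->] /XP[t tF ->] nst.
  rewrite -setI_eq0; apply/eqP/setP => x; rewrite !inE; apply/negP => /andP[xs xt].
  by case/eqP: nst; rewrite (flatten_inj (fac_un facF) sF tF xs xt).
- apply/negP => /XP[s sF e]; have [x] := ne s sF; by rewrite -fE -e inE.
Qed.

Lemma weight_bound F : factor F -> weight F <= #|G| * 5 ^ #|G|.
Proof.
move=> facF; have sz s : s \in F -> size s <= #|G|.
  move=> sF; rewrite cardE; apply: uniq_leq_size => [|x _]; last by rewrite mem_enum.
  have := fac_un facF; elim: (F) sF => //= r A IH; rewrite cat_uniq inE => h /and3P[ur _ u].
  by case/orP: h => [/eqP->|/IH]; auto.
have szF : size F <= #|G|.
  have : size F <= size (flatten F).
    have := fac_ne facF; elim: (F) => //= r A IH; rewrite inE negb_or size_cat => /andP[nr /IH h].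
    by rewrite -add1n leq_add // lt0n size_eq0 eq_sym.
  move/leq_trans; apply; rewrite cardE; apply: uniq_leq_size (fac_un facF) _ => x _; by rewrite mem_enum.
apply: (@leq_trans (size F * 5 ^ #|G|)); last by rewrite leq_mul2r szF orbT.
elim: (F) sz => [|s A IH] sz; first by rewrite /weight big_nil.
rewrite weight_cons /= mulSn leq_add ?IH // => [|r rA]; last by apply: sz; rewrite inE rA orbT.
by rewrite leq_exp2l // sz ?mem_head.
Qed.

Lemma singletons : factor [seq [:: x] | x <- enum G].
Proof.
have e : flatten [seq [:: x] | x <- enum G] = enum G by elim: (enum G) => //= x s ->.
split.
- by apply/mapP => -[].
- by apply/allP => s /mapP[x _ ->].
- by rewrite e enum_uniq.
- by move=> x; rewrite e mem_enum.
Qed.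

(** A boolean goal may assume an optimal factor: mu decreases along [better], so starting from the
    factor into singletons an optimal one would be reached. *)
Lemma optimal_exists (b : bool) : (forall F, optimal F -> b) -> b.
Proof.
move=> H; pose K := (#|G| * 5 ^ #|G|).+1.
pose mu F := size F * K + (K - weight F).
suff main n F : mu F < n -> factor F -> b by apply: (main _ _ (ltnSn _) singletons).
elim: n F => // n IH F hF facF; apply/negPn/negP => nb; case/negP: (nb).
apply: (H F); split=> // F' facF'; apply/negP => bet.
case/negP: nb; apply: (IH F') => //; rewrite ltnS in hF; apply: leq_trans hF.
have h1 : weight F < K by rewrite ltnS weight_bound.
have h2 : weight F' < K by rewrite ltnS weight_bound.
move: bet h1 h2; rewrite /mu /better.
move: (weight F) (weight F') (size F) (size F'); clearbody K; clear => w w' m m'.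
case/orP => [h|/andP[/eqP-> h]] h1 h2; last by rewrite ltn_add2l ltn_sub2l.
have : m'.+1 * K <= m * K by rewrite leq_mul2r h orbT.
by rewrite mulSn; move: (m * K) (m' * K) h1; clear; lia.
Qed.

Hypothesis cubG : cubic G.
Hypothesis conG : connected_graph G.

Lemma card4 : 4 <= #|G|.
Proof.
have [x _] : exists x : G, true by have /card_gt0P[x _] := conG.1; exists x.
case: (neighbors cubG x) => a [b [c [u h]]].
rewrite -[4]/(size [:: x; a; b; c]) cardE; apply: uniq_leq_size => [|y _]; last by rewrite mem_enum.
by rewrite cons_uniq u andbT -h adj_irrefl.
Qed.

(** The first vertex of an induced path has at most one neighbour on it. *)
Lemma not_path s : (forall x, x \in s) -> uniq s -> chordless s -> False.
Proof.
have [x0 _] : exists x : G, true by have /card_gt0P[x _] := conG.1; exists x.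
case: s => [/(_ x0)//|x s] all_s us cs.
have /(chordless_cons us)[h _] := cs.
case: (neighbors cubG x) => a [b [c [u3 hx]]].
have e y : y \in [:: a; b; c] -> y = head x s.
  rewrite -hx => xy; have := all_s y; rewrite inE => /orP[/eqP ey|ys].
    by rewrite ey adj_irrefl in xy.
  by apply/eqP; rewrite -h.
have hb : b \in [:: a; b; c] by rewrite !inE eqxx orbT.
by move: u3; rewrite (etrans (e a (mem_head _ _)) (esym (e b hb))) /= mem_head.
Qed.

Lemma ipf_gt1 k : has_ipf_of_size G k -> 1 < k.
Proof.
case/existsP => X /andP[/andP[/and3P[/eqP cov _ _] /forall_inP hX] /eqP <-].
rewrite ltnNge; apply/negP; rewrite leq_eqVlt ltnS leqn0 cards_eq0 => /orP[/cards1P[A eX]|/eqP eX].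
  have AX : A \in X by rewrite eX set11.
  have /existsP[t /andP[/eqP eA]] := hX A AX; rewrite is_induced_pathE => /and3P[_ ut ct].
  apply: (not_path _ ut ct) => x; have : x \in cover X by rewrite cov inE.
  rewrite eX /cover big_set1 => xA; have : x \in [set:: t] by rewrite -eA.
  by rewrite inE.
have [x _] : exists x : G, true by have /card_gt0P[x _] := conG.1; exists x.
by have : x \in cover X; [rewrite cov inE | rewrite eX /cover big_set0 inE].
Qed.

(** The graph is complete, so any two disjoint edges will do. *)
Lemma ipf_K4 : #|G| = 4 -> has_ipf_of_size G 2.
Proof.
move=> n4; have [x _] : exists x : G, true by have /card_gt0P[x _] := conG.1; exists x.
case: (neighbors cubG x) => a [b [c [u h]]].
have u4 : uniq [:: x; a; b; c] by rewrite cons_uniq u andbT -h adj_irrefl.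
have all4 y : y \in [:: x; a; b; c].
  have [_ e] := @uniq_min_size _ [:: x; a; b; c] (enum G) u4 (fun z _ => mem_enum G z)
    (eq_leq (etrans (esym (cardE G)) n4)).
  by rewrite e mem_enum.
have bc : adj b c.
  case: (neighbors cubG b) => a' [b' [c' [u' h']]]; rewrite h'.
  have s : {subset [:: a'; b'; c'] <= [:: x; a; c]}.
    move=> z; rewrite -h' => bz; have := all4 z; rewrite !inE => /or4P[/eqP->|/eqP->|/eqP e|/eqP->]; rewrite ?eqxx ?orbT //.
    by rewrite e adj_irrefl in bz.
  have [_ e] := uniq_min_size u' s (leqnn _).
  by rewrite e !inE eqxx !orbT.
apply: (factor_ipf (F := [:: [:: x; a]; [:: b; c]])); split=> //=.
by rewrite h mem_head bc.
Qed.

End Translate.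

Local Open Scope ring_scope.

Theorem theorem1 (G : sgraph) (hconn : connected_graph G) (hcubic : cubic G) :
  ((#|G| <= 6)%N -> induced_path_number G = 2%N) /\
  ((6 < #|G|)%N ->
     (induced_path_number G)%:R <= (#|G|%:R - 1) / 3%:R :> rat).
Proof.
rewrite /induced_path_number; case: ex_minnP => k hk mink.
have k2 := ipf_gt1 hcubic hconn hk.
have n4 := card4 hcubic hconn.
split=> hn.
  apply/eqP; rewrite eqn_leq k2 andbT.
  move: n4; rewrite leq_eqVlt => /orP[/eqP n4|n4].
    by apply: mink; apply: ipf_K4.
  apply: (@optimal_exists G) => F optF.
  have m3 := three_members hcubic hconn optF n4.
  apply: leq_trans (mink _ (factor_ipf optF.1)) _.
  by move: m3 hn; clear; lia.
suff h : (3 * k < #|G|)%N.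
  rewrite Num.Theory.ler_pdivlMr ?Num.Theory.ltr0n // Num.Theory.lerBrDr.
  by rewrite -natrM -(natrD _ _ 1) Num.Theory.ler_nat addn1 mulnC.
apply: (@optimal_exists G) => F optF.
have m3 := three_members hcubic hconn optF (ltnW (ltnW hn)).
have := mink _ (factor_ipf optF.1); rewrite -(leq_pmul2l (isT : 0 < 3)%N) => kF.
apply: leq_ltn_trans kF _; rewrite ltn_neqAle m3 andbT; apply/eqP => e.
exact: (no_equality hcubic hconn optF hn (esym e)).
Qed.
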